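(* Let $\mu\in\mathcal P$ and let $f$ be as in the context. Assume in each case below that the feasible set of the corresponding problem contains at least one measure with finite $f$-divergence $D_f(\cdot\,\Vert\,\mu)$. Then the following hold. (i) If $m^\mu>0$, then Problem (G) admits a minimizer, which further implies that Problem (B) admits a minimizer. (ii) If $m^\mu<0$ and $f'(\infty)=\infty$, then Problem (C) admits a minimizer provided that there exists a constant $c<\infty$ such that the set $\{\nu\in\mathcal P_\mu:\ \nu\succeq\mu,\ D_f(\nu\,\Vert\,\mu)\le c\}$ is nonempty and \[ \lim_{K\to\infty}\ \sup_{\substack{\nu\in\mathcal P_\mu,\ \nu\succeq\mu\\ D_f(\nu\Vert\mu)\le c}}\ \int_{\{S>K\}}S(u)\,\nu(\mathrm{d}u)=0 . \] In particular, this condition is automatically satisfied (for some such $c$) when $S(\rho)<\infty$. (iii) If $m^\mu<0$, then Problem (CM) admits a minimizer for every $M\in[r_0,\rho)$ such that $\operatorname{supp}\mu\subseteq[0,M]$. In each case, if $f$ is strictly convex, then the minimizer is unique.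
   Context: Scale function: $I=(\ell,\rho)$ with $-\infty\le\ell<0<r_0<\rho\le\infty$; $a,\sigma:I\to\mathbb R$ are Borel, $\sigma^2>0$ on $I$, and $1/\sigma^2$, $|a|/\sigma^2$ are locally integrable on $I$; $S(x):=\int_{r_0}^x\exp\{-2\int_{r_0}^u\frac{a(r)}{\sigma^2(r)}\mathrm{d}r\}\mathrm{d}u$ for $x\in I$. Thus $S$ is continuous and strictly increasing with $S(r_0)=0$; $S(\rho):=\lim_{x\uparrow\rho}S(x)\in(0,\infty]$. $\mathcal P$ is the set of probability measures $\nu$ on $[0,\rho)$ with $\int_{[0,\rho)}|S|\,\mathrm{d}\nu<\infty$; for $\nu\in\mathcal P$, $m^\nu:=\int_{[0,\rho)}S(u)\,\nu(\mathrm{d}u)$. $\mathcal P_\mu:=\{\nu\in\mathcal P: m^\nu=0\}$. For $M\ge\sup\operatorname{supp}\mu$, $\mathcal P^M:=\{\nu\in\mathcal P:\operatorname{supp}\nu\subseteq[0,M]\}$. Stochastic dominance: $\nu\succeq\mu$ means $\nu((-\infty,x])\le\mu((-\infty,x])$ for all $x\in\mathbb R$; $\nu\succ\mu$ means $\nu\succeq\mu$ with strict inequality for at least one $x$. Divergence: $f:(0,\infty)\to\mathbb R$ is convex, extended by $f(0):=\lim_{x\downarrow0}f(x)\in(-\infty,\infty]$ and $f(x)=\infty$ for $x<0$; $f'(\infty):=\lim_{x\to\infty}f(x)/x\in(-\infty,\infty]$. Standing assumption: $f\ge0$, $f(1)=0$, $f'(\infty)\ge0$. For $\nu\in\mathcal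 P$ with Lebesgue decomposition $\nu=\theta\mu+\nu^\perp$ with respect to $\mu$ ($\theta\ge0$, $\nu^\perp\perp\mu$), the extended $f$-divergence is $D_f(\nu\,\Vert\,\mu):=\int_{[0,\rho)}f(\theta(u))\,\mu(\mathrm{d}u)+f'(\infty)\,\nu^\perp([0,\rho))$, with the convention $a\cdot\infty=0$ if $a=0$ and $a\cdot\infty=\infty$ if $a>0$ when $f'(\infty)=\infty$. Problems (the feasible set is the set of measures satisfying the listed constraints; a minimizer is a feasible measure attaining the infimum): - (G): minimize $D_f(\nu\,\Vert\,\mu)$ over $\nu\in\mathcal P_\mu$. - (B) (for $m^\mu>0$): minimize $D_f(\nu\,\Vert\,\mu)$ over $\nu\in\mathcal P$ subject to $m^\nu\le0$. - (C) (for $m^\mu<0$): minimize $D_f(\nu\,\Vert\,\mu)$ over $\nu\in\mathcal P$ subject to $m^\nu\le0$, $\nu\succeq\mu$, and there exists no $\nu'\in\mathcal P$ with $m^{\nu'}\le0$ and $\nu'\succ\nu$. - (CM) (for $m^\mu<0$, $\operatorname{supp}\mu\subseteq[0,M]$): the same as (C) with $\mathcal P$ replaced by $\mathcal P^M$ throughout. *)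

(* Defs.v *)
From HB Require Import structures.
From mathcomp Require Import all_boot all_order all_algebra.
From mathcomp Require Import all_classical all_reals all_analysis.

Set Implicit Arguments.
Unset Strict Implicit.
Unset Printing Implicit Defensive.

Import Order.TTheory GRing.Theory Num.Theory.
Import numFieldNormedType.Exports.

Local Open Scope classical_set_scope.
Local Open Scope ring_scope.

Section scale_function.
Context {R : realType}.

Definition state_space (l rho : \bar R) : set R :=
  [set x | (l < x%:E)%E /\ (x%:E < rho)%E].

(* \int_p^q g, with the usual sign convention when q < p *)
Definition oriented_integral (g : R -> R) (p q : R) : R :=
  if p <= q then \int[lebesgue_measure]_(x in `[p, q]) g x
  else - \int[lebesgue_measure]_(x in `[q, p]) g x.

Definition scale_function (a sigma : R -> R) (r0 x : R) : R :=
  oriented_integral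
    (fun u => expR (- 2 * oriented_integral (fun r => a r / sigma r ^+ 2) r0 u))
    r0 x.

(* the limit of S at rho from the left; -oo is a dummy value *)
Definition scale_at_end (S : R -> R) (rho : \bar R) : \bar R :=
  match rho with
  | r%:E => lim ((S x)%:E @[x --> r^'-])
  | +oo%E => lim ((S x)%:E @[x --> +oo])
  | -oo%E => -oo%E
  end.

End scale_function.

Section measures.
Context {R : realType}.
Implicit Types (rho : \bar R) (S : R -> R).
Local Notation prob := (probability (measurableTypeR R) R).
Implicit Types mu nu : prob.

Definition halfline rho : set R := [set x | 0 <= x /\ (x%:E < rho)%E].

(* probability measures on [0, rho[ are represented by the probability
   measures on the Borel sets of R that give mass 1 to [0, rho[ *)
Definition Pset rho S : set prob :=
  [set nu | nu (halfline rho) = 1%E /\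
            nu.-integrable (halfline rho) (EFin \o S)].

Definition mean rho S nu : R := \int[nu]_(u in halfline rho) S u.

Definition Pmean0 rho S : set prob :=
  [set nu | Pset rho S nu /\ mean rho S nu = 0].

Definition supp nu : set R :=
  [set x | forall U : set R, open U -> U x -> (0 < nu U)%E].

Definition PsetM rho S (M : R) : set prob :=
  [set nu | Pset rho S nu /\ supp nu `<=` `[0, M]].

Definition dominates nu mu : Prop :=
  forall x : R, (nu `]-oo, x]%classic <= mu `]-oo, x]%classic)%E.

Definition strictly_dominates nu mu : Prop :=
  dominates nu mu /\ exists x : R, (nu `]-oo, x]%classic < mu `]-oo, x]%classic)%E.

End measures.

Section divergence.
Context {R : realType}.
Local Notation T := (measurableTypeR R).
Local Notation prob := (probability T R).
Implicit Types (rho : \bar R) (f : R -> R) (mu nu : prob).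

Definition strictly_convex_function (D : set R) f : Prop :=
  forall (t x y : R), D x -> D y -> x != y -> 0 < t -> t < 1 ->
    f (t * x + (1 - t) * y) < t * f x + (1 - t) * f y.

(* f'(oo) *)
Definition recession f : \bar R := lim ((f x / x)%:E @[x --> +oo]).

(* only the values of f on ]0, +oo[ are used *)
Definition extend f (x : R) : \bar R :=
  if x < 0 then +oo%E
  else if x == 0 then lim ((f y)%:E @[y --> 0^'+])
  else (f x)%:E.

Definition divergence_function f : Prop :=
  [/\ @convex_function R R^o `]0, +oo[ f,
      (forall x, 0 < x -> 0 <= f x),
      f 1 = 0
    & (0 <= recession f)%E].

Definition mutually_singular (m1 m2 : set T -> \bar R) : Prop :=
  exists N : set T, [/\ measurable N, m1 N = 0%E & m2 (~` N) = 0%E].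

Definition lebesgue_decomposition mu nu (theta : T -> R)
    (nuperp : {measure set T -> \bar R}) : Prop :=
  [/\ measurable_fun setT theta,
      (forall x, 0 <= theta x),
      mutually_singular mu nuperp
    & forall A : set T, measurable A ->
        nu A = (\int[mu]_(x in A) (theta x)%:E + nuperp A)%E].

(* The Lebesgue decomposition exists, theta is unique mu-a.e. and nuperp is
   unique, so the set below is a singleton and the default +oo is never used.
   In \bar R one has 0 * +oo = 0. *)
Definition fdivergence rho f mu nu : \bar R :=
  xget +oo%E [set d | exists theta nuperp,
    lebesgue_decomposition mu nu theta nuperp /\
    d = (\int[mu]_(u in halfline rho) extend f (theta u) +
         recession f * nuperp (halfline rho))%E].

End divergence.

Section problems.
Context {R : realType}.
Local Notation prob := (probability (measurableTypeR R) R).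
Implicit Types (rho : \bar R) (S f : R -> R) (mu nu : prob).
Implicit Types (Q F : set prob) (D : prob -> \bar R).

Definition feasibleG rho S : set prob := Pmean0 rho S.

Definition feasibleB rho S : set prob :=
  [set nu | Pset rho S nu /\ mean rho S nu <= 0].

(* Q is the class of admissible measures: all of P, or P^M *)
Definition feasible_dom rho S mu Q : set prob :=
  [set nu | [/\ Q nu, mean rho S nu <= 0, dominates nu mu
    & ~ exists nu', [/\ Q nu', mean rho S nu' <= 0
                      & strictly_dominates nu' nu]]].

Definition feasibleC rho S mu : set prob :=
  feasible_dom rho S mu (Pset rho S).

Definition feasibleCM rho S mu (M : R) : set prob :=
  feasible_dom rho S mu (PsetM rho S M).

Definition minimizer D F nu : Prop :=
  F nu /\ D nu = ereal_inf [set D nu' | nu' in F].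

Definition has_minimizer D F : Prop := exists nu, minimizer D F nu.

(* equality of measures is equality on measurable sets *)
Definition unique_minimizer D F : Prop :=
  forall nu1 nu2, minimizer D F nu1 -> minimizer D F nu2 ->
    forall A : set (measurableTypeR R), measurable A -> nu1 A = nu2 A.

Definition has_finite_value D F : Prop :=
  exists nu, F nu /\ (D nu < +oo)%E.

Definition dominating_sublevel rho S f mu (c : R) : set prob :=
  [set nu | [/\ Pmean0 rho S nu, dominates nu mu
              & (fdivergence rho f mu nu <= c%:E)%E]].

Definition uniformly_integrable_sublevel rho S f mu (c : R) : Prop :=
  dominating_sublevel rho S f mu c !=set0 /\
  ereal_sup [set \int[nu]_(u in halfline rho `&` [set u | (K < S u)%R]) (S u)%:E
            | nu in dominating_sublevel rho S f mu c]%E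
    @[K --> +oo%R] --> 0%E.

End problems.

(* Main.v *)
Require Import Defs.
From HB Require Import structures.
From mathcomp Require Import all_boot all_order all_algebra.
From mathcomp Require Import all_classical all_reals all_analysis.
From mathcomp Require Import measurable_realfun ring lra.

(** The proof is the direct method, applied to the densities of the measures with
    respect to mu rather than to the measures. Write D for the divergence, theta
    for a density and f'(oo) for [recession f].

    Compactness. The densities of measures with nearly minimal divergence form a
    decreasing sequence of midpoint-closed sets, bounded in L1(mu). Choosing in
    them near-minimizers of the strictly convex functional \int exp(- theta) gives
    a minimizing sequence whose densities converge almost everywhere
    ([midpoint_closed_ae_cvg]).

    Lower semicontinuity. For every slope L below f'(oo) there is a line
    L x + be below f. Fatou's lemma for f(theta_n) - (L theta_n + be) shows that
    the limit theta satisfies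
      \int f(theta) dmu + f'(oo) (1 - \int theta dmu) <= inf D,
    so that the mass lost in the limit is charged exactly as singular mass. It may
    be put back as an atom at any point x0. The resulting measure attains the
    infimum, and it still satisfies all upper bounds on \int h dnu for h >= 0 with
    h(x0) = 0 ([relaxed_minimizer]). When f'(oo) = oo no mass is lost and the
    condition on h(x0) is void.

    The mean. For (G) and (B) the atom is at 0, with h = S - S(0): mean at most 0
    is preserved. For (CM) it is at M, with h = S(M) - S: mean at least 0 is
    preserved, and so is dominance. In both cases the mean of mu is on the wrong
    side of 0. As D(mu) = 0 and D is convex, mixing a measure with mu until its
    mean is 0 does not increase D ([mix_to_tight]), so the constraint with an
    inequality and the one with an equality have the same value. For (C), mean at
    most 0 and dominance are preserved since no mass is lost, and mean at least 0
    follows from uniform integrability by truncating S.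

    Undominated measures. A strictly dominating measure has a strictly larger mean
    ([mean_lt_of_strictly_dominates]), and a measure of negative mean is strictly
    dominated by some admissible one ([push_up]). Hence the feasible measures of
    (C) and (CM) are those of mean 0 that dominate mu ([feasible_domE]).

    Uniqueness. For strictly convex f, minimizers have the same density, by
    comparison with their midpoint. If f'(oo) = oo there is no singular part.
    Otherwise, sweeping the singular part to the atom x0 does not increase D and
    strictly decreases \int h dnu, unless the singular part is carried by x0; a
    strict decrease would leave room for mixing with mu, which makes the minimum 0
    and the minimizer equal to mu, against the constraint
    ([minimizer_singular_part]).

    The scale function enters only through being increasing with S(r0) = 0. *)

Set Implicit Arguments.
Unset Strict Implicit.
Unset Printing Implicit Defensive.

Import Order.TTheory GRing.Theory Num.Theory.
Import numFieldNormedType.Exports.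

Local Open Scope classical_set_scope.
Local Open Scope ring_scope.

(** * Affine minorants of the divergence function *)

Section divergence_function.
Context {R : realType}.
Variables (f : R -> R) (hf : divergence_function f).

Definition affine_minorant (al be : R) := forall x, 0 < x -> al * x + be <= f x.

Lemma divergence_function_conv (x y t : R) : 0 < x -> 0 < y -> 0 <= t <= 1 ->
  f (t * x + (1 - t) * y) <= t * f x + (1 - t) * f y.
Proof.
move=> x0 y0 t01; have [cvf _ _ _] := hf.
have := cvf (Itv01 (proj1 (andP t01)) (proj2 (andP t01))) x y.
rewrite !inE /= !in_itv /= !andbT => /(_ x0 y0).
by rewrite !convRE.
Qed.

Lemma divergence_function_ge0 (x : R) : 0 < x -> 0 <= f x.
Proof. by have [_ f0 _ _] := hf; exact: f0. Qed.

Lemma divergence_function1 : f 1 = 0.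
Proof. by have [_ _ f1 _] := hf. Qed.

Lemma slope_le (z x w : R) : 0 < z -> z < x -> x < w ->
  (f x - f z) / (x - z) <= (f w - f x) / (w - x).
Proof.
move=> z0 zx xw.
have wz : 0 < w - z by lra.
pose t := (w - x) / (w - z).
have t01 : 0 <= t <= 1.
  by rewrite /t divr_ge0 ?ler_pdivrMr ?mul1r//=; lra.
have w0 : 0 < w by lra.
have := divergence_function_conv z0 w0 t01.
have -> : t * z + (1 - t) * w = x by rewrite /t; field; lra.
move=> fx.
rewrite ler_pdivrMr ?subr_gt0// mulrAC ler_pdivlMr ?subr_gt0//.
have : (w - z) * f x <= (w - x) * f z + (x - z) * f w.
  have -> : (w - x) * f z + (x - z) * f w = (w - z) * (t * f z + (1 - t) * f w).
    by rewrite /t; field; lra.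
  by rewrite ler_wpM2l// ltW.
lra.
Qed.

(** The slope is the supremum of the difference quotients to the left of x,
    which every quotient to the right of x bounds from above. *)
Lemma supporting_line (x : R) : 0 < x ->
  exists al, affine_minorant al (f x - al * x).
Proof.
move=> x0.
pose E := [set (f x - f z) / (x - z) | z in [set z | 0 < z < x]].
have supE w : x < w -> ubound E ((f w - f x) / (w - x)).
  by move=> xw _ [z /andP[z0 zx] <-]; exact: slope_le.
have E0 : E !=set0.
  exists ((f x - f (x / 2)) / (x - x / 2)), (x / 2) => //=.
  by apply/andP; split; lra.
exists (sup E) => w w0.
have [xw|wx|<-] := ltgtP x w; last by lra.
- have : sup E <= (f w - f x) / (w - x) by apply: ge_sup => //; exact: supE.
  rewrite ler_pdivlMr ?subr_gt0//; lra.
- have : (f x - f w) / (x - w) <= sup E.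
    apply: ub_le_sup; first by exists ((f (x + 1) - f x) / (x + 1 - x)); apply: supE; lra.
    by exists w => //=; rewrite w0.
  rewrite ler_pdivrMr ?subr_gt0//; lra.
Qed.

Lemma affine_minorant0 : affine_minorant 0 0.
Proof. by move=> x x0; rewrite mul0r add0r divergence_function_ge0. Qed.

(** f is nonincreasing on the left of 1 since it attains its minimum 0 there. *)
Let f_nincr : {in `]0, 1[ &, nonincreasing_fun (fun x => (f x)%:E)}.
Proof.
move=> y x; rewrite !in_itv/= => /andP[y0 y1] /andP[x0 x1] yx.
rewrite lee_fin.
have [al hal] := supporting_line x0.
have := hal _ y0; have := hal 1 ltr01.
rewrite divergence_function1; have := divergence_function_ge0 x0.
nra.
Qed.

Lemma extend0E : extend f 0 = ereal_sup [set (f x)%:E | x in `]0, 1[].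
Proof.
rewrite /extend ltxx eqxx; apply: cvg_lim => //.
by apply: (nonincreasing_at_right_cvge (BLeft 1)) => //; rewrite bnd_simp.
Qed.

Lemma extendN (x : R) : x < 0 -> extend f x = +oo%E.
Proof. by rewrite /extend => ->. Qed.

Lemma extend_pos (x : R) : 0 < x -> extend f x = (f x)%:E.
Proof. by move=> x0; rewrite /extend ltNge ltW//= gt_eqF. Qed.

(** For x > 0 the supporting line at x attains the supremum. At 0 the intercept
    of the supporting line at a small z is at least [f z], because its slope is
    at most 0; conversely an intercept be satisfies [be <= f z + `|al| * z] for
    every z > 0. *)
Lemma extendE (x : R) : 0 <= x ->
  extend f x = ereal_sup [set (p.1 * x + p.2)%:E
                         | p in [set p : R * R | affine_minorant p.1 p.2]].
Proof.
rewrite le_eqVlt => /predU1P[<-|x0]; last first.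
  rewrite extend_pos//; apply/eqP; rewrite eq_le; apply/andP; split.
    have [al hal] := supporting_line x0.
    by apply: ereal_sup_ubound; exists (al, f x - al * x) => //=; congr EFin; lra.
  by apply: ge_ereal_sup => _ [p hp <-]; rewrite lee_fin; exact: hp.
rewrite extend0E; apply/eqP; rewrite eq_le; apply/andP; split.
  apply: ge_ereal_sup => _ [z /= + <-]; rewrite in_itv/= => /andP[z0 z1].
  have [al hal] := supporting_line z0.
  apply: (@le_trans _ _ (al * 0 + (f z - al * z))%:E); last first.
    by apply: ereal_sup_ubound; exists (al, f z - al * z).
  have := hal 1 ltr01; rewrite divergence_function1.
  have := divergence_function_ge0 z0.
  rewrite lee_fin; nra.
apply: ge_ereal_sup => _ [[al be] /= hp <-]; rewrite mulr0 add0r.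
apply/lee_addgt0Pr => e e0.
pose z := Num.min (1 / 2) (e / (1 + `|al|)).
have d0 : 0 < 1 + `|al| by rewrite ltr_wpDr.
have z0 : 0 < z by rewrite /z lt_min divr_gt0 //= divr_gt0.
have z1 : z < 1 by rewrite /z gt_min; apply/orP; left; lra.
have ze : `|al| * z <= e.
  have : z <= e / (1 + `|al|) by rewrite /z ge_min lexx orbT.
  rewrite ler_pdivlMr//; have := normr_ge0 al; nra.
apply: (@le_trans _ _ ((f z)%:E + e%:E)%E).
  rewrite -EFinD lee_fin.
  have := hp _ z0; have := ler_norm (- al); rewrite normrN; nra.
by rewrite leeD2r//; apply: ereal_sup_ubound; exists z => //=; rewrite in_itv/= z0.
Qed.

Lemma extend_minorant (al be x : R) : affine_minorant al be -> 0 <= x ->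
  ((al * x + be)%:E <= extend f x)%E.
Proof. by move=> hp x0; rewrite extendE//; apply: ereal_sup_ubound; exists (al, be). Qed.

Lemma extend_ge0 (x : R) : (0 <= extend f x)%E.
Proof.
have [x0|x0] := leP 0 x; last by rewrite extendN// leey.
by have := extend_minorant affine_minorant0 x0; rewrite mul0r add0r.
Qed.

(** A supremum of affine functions is convex; this covers the end point 0, where
    [extend f] may be infinite. *)
Lemma extend_convex (x y t : R) : 0 <= x -> 0 <= y -> 0 <= t <= 1 ->
  (extend f (t * x + (1 - t) * y) <=
   t%:E * extend f x + (1 - t)%:E * extend f y)%E.
Proof.
move=> x0 y0 /andP[t0 t1].
have t1' : 0 <= 1 - t by lra.
rewrite [leLHS]extendE ?addr_ge0 ?mulr_ge0//.
apply: ge_ereal_sup => _ [[al be] /= hp <-].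
apply: (@le_trans _ _ (t%:E * (al * x + be)%:E + (1 - t)%:E * (al * y + be)%:E)%E).
  by rewrite -!EFinM -EFinD lee_fin; lra.
by apply: leeD; apply: lee_wpmul2l; rewrite ?lee_fin//; exact: extend_minorant.
Qed.

(** [f x / x] is nondecreasing from x = 1 on, because f vanishes at 1, whereas it
    may decrease before 1: hence the truncation [Num.max x 1] in the proof. *)
Lemma recessionE :
  recession f = ereal_sup [set (f x / x)%:E | x in [set x | 1 <= x]].
Proof.
pose g (x : R) : \bar R := (f (Num.max x 1) / Num.max x 1)%:E.
have -> : [set (f x / x)%:E | x in [set x | 1 <= x]] = range g.
  apply/seteqP; split=> _ [x /= x1 <-].
    by exists x => //; rewrite /g max_l.
  by exists (Num.max x 1) => //=; rewrite le_max lexx orbT.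
apply: cvg_lim => //.
have gc : g x @[x --> +oo] --> ereal_sup (range g).
  apply: nondecreasing_cvge => x y xy; rewrite /g lee_fin.
  have {xy} : Num.max x 1 <= Num.max y 1.
    by rewrite ge_max !le_max xy /= lexx orbT.
  have : 1 <= Num.max x 1 by rewrite le_max lexx orbT.
  move: (Num.max x 1) (Num.max y 1) => {}x {}y x1 xy.
  have x0 : 0 < x by lra.
  have y0 : 0 < y by lra.
  have [al hal] := supporting_line x0.
  have := hal _ y0; have := hal 1 ltr01; rewrite divergence_function1.
  have := divergence_function_ge0 x0 => fx0 h1 h2.
  rewrite ler_pdivrMr// mulrAC ler_pdivlMr//.
  have [x1'|x1'] := leP x 1.
    have -> : x = 1 by lra.
    by rewrite divergence_function1 mul0r mulr1 divergence_function_ge0.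
  have h3 := ler_wpM2l (ltW x0) h2.
  have al0 : 0 <= al by rewrite -(pmulr_lge0 _ (_ : 0 < x - 1)); lra.
  have : 0 <= (al * x - f x) * (y - x) by apply: mulr_ge0; lra.
  lra.
apply: cvg_trans gc; apply: near_eq_cvg.
near=> x; rewrite /g max_l//; near: x; exact: nbhs_pinfty_ge.
Unshelve. all: by end_near. Qed.

(** The intercept disappears in the limit of [al + be / x <= f x / x]. *)
Lemma slope_le_recession (al be : R) : affine_minorant al be ->
  (al%:E <= recession f)%E.
Proof.
move=> hp; apply/lee_addgt0Pr => e e0; rewrite recessionE.
pose x := Num.max 1 (`|be| / e).
have x1 : 1 <= x by rewrite le_max lexx.
have x0 : 0 < x by lra.
have xe : `|be| <= x * e by rewrite -ler_pdivrMr// le_max lexx orbT.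
apply: (@le_trans _ _ ((f x / x)%:E + e%:E)%E); last first.
  by rewrite leeD2r//; apply: ereal_sup_ubound; exists x.
rewrite -EFinD lee_fin -lerBlDr ler_pdivlMr//.
have := hp _ x0; have := ler_norm (- be); rewrite normrN; nra.
Qed.

(** If [f x > L * x] for some x >= 1, the line of slope L through (x, 0) lies
    below f: on the left of x it is negative, and on the right it is below the
    supporting line at x, whose slope is at least L as f vanishes at 1. *)
Lemma lt_recession_minorant (L : R) : 0 <= L -> (L%:E < recession f)%E ->
  exists2 be, affine_minorant L be & be <= 0.
Proof.
move=> L0; rewrite recessionE => /ereal_sup_gt[_ [x /= x1 <-]].
have x0 : 0 < x by lra.
rewrite lte_fin ltr_pdivlMr// => Lx.
have [al hal] := supporting_line x0.
exists (- (L * x)); last by have := mulr_ge0 L0 (ltW x0); lra.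
move=> y y0; have [yx|xy] := leP y x.
  apply: le_trans (divergence_function_ge0 y0).
  by have := ler_wpM2l L0 yx; lra.
have := hal _ y0; have := hal 1 ltr01; rewrite divergence_function1 => h1 h2.
have : L <= al.
  have x1' : 0 < x - 1 \/ x = 1 by lra.
  case: x1' => [x1'|x1']; last by move: Lx h1; rewrite x1' divergence_function1; lra.
  rewrite -(ler_pM2r x1'); lra.
move=> Lal; have : (al - L) * (y - x) >= 0 by apply: mulr_ge0; lra.
have := divergence_function_ge0 x0; nra.
Qed.

(** Every affine minorant has slope at most [recession f]. In terms of measures:
    a given mass costs at least as much in the singular part as in the density. *)
Lemma extend_recession (x y : R) : 0 <= x -> 0 <= y ->
  (extend f (x + y) <= extend f x + recession f * y%:E)%E.
Proof.
move=> x0 y0; rewrite [leLHS]extendE ?addr_ge0//.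
apply: ge_ereal_sup => _ [[al be] /= hp <-].
have -> : al * (x + y) + be = (al * x + be) + al * y by lra.
rewrite EFinD; apply: leeD; first exact: extend_minorant.
by rewrite EFinM; apply: lee_wpmul2r; rewrite ?lee_fin//; exact: slope_le_recession hp.
Qed.

Lemma extend_lsc : lower_semicontinuous (extend f).
Proof.
move=> x a; have [x0|x0] := leP 0 x; last first.
  rewrite extendN// => ay; exists `]-oo, 0[%classic => //.
    by apply: open_nbhs_nbhs; split; [exact: interval_open|rewrite /= in_itv].
  by move=> y /=; rewrite in_itv/= => y0; rewrite extendN.
rewrite extendE// => /ereal_sup_gt[_ [[al be] /= hp <-] afx].
exists [set y | (a%:E < (al * y + be)%:E)%E].
  move: afx; rewrite lte_fin => afx.
  have : al * y + be @[y --> x] --> al * x + be.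
    by apply: cvgD; [apply: cvgM; [exact: cvg_cst|exact: cvg_id]|exact: cvg_cst].
  by move=> /(cvgr_gt (al * x + be)) /(_ _ afx).
move=> y /= ay; have [y0|y0] := leP 0 y; last by rewrite extendN// ltry.
exact: lt_le_trans ay (extend_minorant hp y0).
Qed.

Lemma measurable_extend :
  measurable_fun [set: measurableTypeR R] (extend f).
Proof. exact: lower_semicontinuous_measurable extend_lsc. Qed.

Lemma extend1 : extend f 1 = 0%E.
Proof. by rewrite extend_pos// divergence_function1. Qed.

Lemma recession_ge0 : (0 <= recession f)%E.
Proof. exact: slope_le_recession affine_minorant0. Qed.

(** Strict convexity is assumed on the open half-line only. It is therefore used
    between the quarter points u and v, which are positive even if x = 0, and the
    convexity bounds at u and v average to the bound at x and y. *)
Lemma extend_midpoint_lt (x y : R) :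
  strictly_convex_function `]0, +oo[%classic f ->
  0 <= x -> x < y ->
  (extend f ((x + y) / 2) < 2^-1%:E * extend f x + 2^-1%:E * extend f y)%E.
Proof.
move=> sf x0 xy.
have y0 : 0 <= y by lra.
pose u := (3 * x + y) / 4; pose v := (x + 3 * y) / 4.
have u0 : 0 < u by rewrite /u; lra.
have v0 : 0 < v by rewrite /v; lra.
have uv : u != v by rewrite /u /v; apply/eqP; lra.
have hu : (extend f u <= (3 / 4)%:E * extend f x + (1 - 3 / 4)%:E * extend f y)%E.
  have -> : u = 3 / 4 * x + (1 - 3 / 4) * y by rewrite /u; lra.
  by apply: extend_convex => //; apply/andP; split; lra.
have hv : (extend f v <= (1 / 4)%:E * extend f x + (1 - 1 / 4)%:E * extend f y)%E.
  have -> : v = 1 / 4 * x + (1 - 1 / 4) * y by rewrite /v; lra.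
  by apply: extend_convex => //; apply/andP; split; lra.
have := sf (1 / 2) u v.
rewrite /= !in_itv/= !andbT => /(_ u0 v0 uv).
have -> : 1 / 2 * u + (1 - 1 / 2) * v = (x + y) / 2 by rewrite /u /v; lra.
move=> hf2.
rewrite extend_pos; last lra.
apply: (@lt_le_trans _ _ (2^-1%:E * extend f u + 2^-1%:E * extend f v)%E).
  rewrite (extend_pos u0) (extend_pos v0) -!EFinM -EFinD lte_fin.
  by apply: lt_le_trans (hf2 _ _) _; lra.
move: hu hv; rewrite (extend_pos u0) (extend_pos v0).
have := extend_ge0 x; have := extend_ge0 y.
case: (extend f x) => [a| |] //; case: (extend f y) => [b| |] // _ _.
- rewrite -!EFinM -!EFinD !lee_fin => h1 h2; lra.
- move=> _ _; rewrite (gt0_muley (x := 2^-1%:E)) ?lte_fin ?invr_gt0//.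
  by rewrite -EFinM addey// leey.
- move=> _ _; rewrite (gt0_muley (x := 2^-1%:E)) ?lte_fin ?invr_gt0//.
  by rewrite -EFinM addye// leey.
- move=> _ _; rewrite (gt0_muley (x := 2^-1%:E)) ?lte_fin ?invr_gt0//.
  by rewrite addye// leey.
Qed.

End divergence_function.

(** * Densities, mixtures and the Lebesgue decomposition *)

Section measure_constructions.
Context d (T : measurableType d) (R : realType).
Local Open Scope ereal_scope.

Lemma density_measure_exists (mu : {measure set T -> \bar R}) (theta : T -> R) :
  measurable_fun setT theta -> (forall x, (0 <= theta x)%R) ->
  exists m : {measure set T -> \bar R},
    forall A, m A = \int[mu]_(x in A) (theta x)%:E.
Proof.
move=> mtheta theta0.
pose nu A := \int[mu]_(x in A) (theta x)%:E.
have nu0 : nu set0 = 0 by rewrite /nu integral_set0.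
have nu_ge0 A : 0 <= nu A by apply: integral_ge0 => x _; rewrite lee_fin.
have nu_sigma : semi_sigma_additive nu.
  by apply: semi_sigma_additive_nng_induced => //; exact/measurable_EFinP.
pose m : {measure set T -> \bar R} :=
  HB.pack nu (isMeasure.Build _ _ _ nu nu0 nu_ge0 nu_sigma).
by exists m.
Qed.

Lemma probability_of_measure (m : {measure set T -> \bar R}) :
  m setT = 1 -> exists P : probability T R, forall A, P A = m A.
Proof.
move=> m1; exists (mnormalize m \d_point) => A /=.
by rewrite /mnormalize m1 onee_eq0 /= invr1 mule1.
Qed.

Lemma integral_cst_probability (P : probability T R) (c : R) :
  \int[P]_x c%:E = c%:E.
Proof. by rewrite -[RHS]mule1 -(probability_setT P) -integral_cst. Qed.

(** The density theta agrees almost everywhere with the Radon-Nikodym derivative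
    of m, for which this change of variables is the usual one. *)
Lemma integral_density (mu : {sigma_finite_measure set T -> \bar R})
    (m : {measure set T -> \bar R}) (theta : T -> R) (g : T -> \bar R) :
  measurable_fun setT theta -> (forall x, (0 <= theta x)%R) ->
  m setT < +oo ->
  (forall A, measurable A -> m A = \int[mu]_(x in A) (theta x)%:E) ->
  measurable_fun setT g -> (forall x, 0 <= g x) ->
  \int[m]_x g x = \int[mu]_x (g x * (theta x)%:E).
Proof.
move=> mtheta theta0 moo mE mg g0.
pose m' : {finite_measure set T -> \bar R} := mfrestr measurableT moo.
have m'E A : m' A = m A by rewrite /m' /= /mfrestr/= /mrestr setIT.
have m'mu : m' `<< mu.
  apply/null_content_dominatesP => A mA muA.
  apply: etrans (m'E A) _.
  by rewrite mE// null_set_integral//; apply/measurable_EFinP/measurable_funTS.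
have -> : \int[m]_x g x = \int[m']_x g x.
  by apply: eq_measure_integral => A _ _; exact/esym/m'E.
rewrite -(Radon_Nikodym_SigmaFinite.change_of_variables m'mu g0)//.
pose h := Radon_Nikodym_SigmaFinite.f m' mu.
have mh : measurable_fun setT h.
  exact: measurable_int (Radon_Nikodym_SigmaFinite.f_integrable m'mu).
have h0 x : 0 <= h x by exact: Radon_Nikodym_SigmaFinite.f_ge0.
apply: ge0_ae_eq_integral => //.
- by apply: emeasurable_funM => //; exact: mh.
- by apply: emeasurable_funM => //; exact/measurable_EFinP.
- by move=> x _; rewrite mule_ge0// h0.
- by move=> x _; rewrite mule_ge0// lee_fin.
apply: ae_eqe_mul2l; apply: integral_ae_eq => //.
- exact: Radon_Nikodym_SigmaFinite.f_integrable.
- exact/measurable_EFinP.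
move=> E _ mEE; rewrite -mE//; apply: etrans (m'E E).
by rewrite -Radon_Nikodym_SigmaFinite.f_integral.
Qed.

Lemma mixture_exists (t : R) (P Q : probability T R) : (0 <= t <= 1)%R ->
  exists M : probability T R, forall A, M A = t%:E * P A + (1 - t)%:E * Q A.
Proof.
move=> /andP[t0 t1].
have t1' : (0 <= 1 - t)%R by rewrite subr_ge0.
pose m := measure_add (mscale (NngNum t0) P) (mscale (NngNum t1') Q).
have mE A : m A = t%:E * P A + (1 - t)%:E * Q A by rewrite /m measure_addE.
have m1 : m setT = 1.
  by apply: etrans (mE _) _; rewrite !probability_setT !mule1 -EFinD; congr EFin; ring.
have [M MP] := probability_of_measure m1.
by exists M => A; rewrite MP; exact: mE.
Qed.

Lemma integral_mixture (t : R) (P Q M : probability T R) (g : T -> \bar R) :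
  (0 <= t <= 1)%R -> (forall A, M A = t%:E * P A + (1 - t)%:E * Q A) ->
  measurable_fun setT g -> (forall x, 0 <= g x) ->
  \int[M]_x g x = t%:E * \int[P]_x g x + (1 - t)%:E * \int[Q]_x g x.
Proof.
move=> /andP[t0 t1] ME mg g0.
have t1' : (0 <= 1 - t)%R by rewrite subr_ge0.
pose m := measure_add (mscale (NngNum t0) P) (mscale (NngNum t1') Q).
have -> : \int[M]_x g x = \int[m]_x g x.
  apply: eq_measure_integral => A _ _; apply: etrans (ME A) _.
  by rewrite /m; exact/esym/measure_addE.
by rewrite /m ge0_integral_measure_add// !ge0_integral_mscale.
Qed.

End measure_constructions.

Section lebesgue_decomposition.
Context {R : realType}.
Local Notation T := (measurableTypeR R).
Local Notation prob := (probability T R).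
Local Open Scope ereal_scope.

(** The singular part lives on a mu-null set N0 of maximal nu-measure: outside N0
    a mu-null set cannot carry nu-mass, since its union with N0 would be a mu-null
    set of larger nu-measure. So nu is absolutely continuous off N0. *)
Lemma lebesgue_decomposition_exists (mu : prob)
    (nu : {finite_measure set T -> \bar R}) :
  exists (theta : T -> R) (nuperp : {measure set T -> \bar R}),
  [/\ measurable_fun setT theta,
      (forall x, (0 <= theta x)%R),
      mutually_singular mu nuperp
    & forall A, measurable A ->
        nu A = \int[mu]_(x in A) (theta x)%:E + nuperp A].
Proof.
pose C := [set N : set T | measurable N /\ mu N = 0].
pose s := ereal_sup [set nu N | N in C].
have nuT : nu setT \is a fin_num by exact: fin_num_measure.
have nu_fin A : measurable A -> nu A \is a fin_num by exact: fin_num_measure.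
have s0 : 0 <= s.
  by apply: ereal_sup_ubound; exists set0; rewrite ?measure0//; split.
have sT : s <= nu setT.
  by apply: ge_ereal_sup => _ [N [mN _] <-]; rewrite le_measure ?inE.
have sfin : s \is a fin_num.
  by rewrite ge0_fin_numE// (le_lt_trans sT)// ltey_eq nuT.
have /choice[N NP] : forall k, exists N, C N /\ s - k.+1%:R^-1%:E < nu N.
  move=> k; have k0 : (0 < k.+1%:R^-1 :> R)%R by rewrite invr_gt0.
  have [_ [N CN <-] sN] := ub_ereal_sup_adherent k0 sfin.
  by exists N.
pose N0 := \bigcup_k N k.
have mN0 : measurable N0 by apply: bigcup_measurable => k _; have [[]] := NP k.
have muN0 : mu N0 = 0.
  apply/negligibleP => //; apply: negligible_bigcup => k.
  by have [[mNk ?] _] := NP k; apply/negligibleP.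
have sN0 : s <= nu N0.
  apply/lee_addgt0Pr => e e0.
  have [k _ /(_ _ (leqnn k)) ke] : \forall k \near \oo, (k.+1%:R^-1 < e :> R)%R.
    exact: (near_infty_natSinv_lt (PosNum e0)).
  have [[mNk _] /ltW] := NP k.
  rewrite leeBlDr// => /le_trans; apply.
  apply: leeD; last by rewrite lee_fin ltW.
  by rewrite le_measure ?inE//; exact: bigcup_sup.
have mC : measurable (~` N0) by exact: measurableC.
have nuC : nu (~` N0) < +oo by rewrite ltey_eq nu_fin.
pose nu1 : {finite_measure set T -> \bar R} := mfrestr mC nuC.
have nu1mu : nu1 `<< mu.
  apply/null_content_dominatesP => A mA muA.
  rewrite /nu1 /= /mfrestr /= /mrestr.
  have CU : C (N0 `|` A).
    split; first exact: measurableU.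
    by apply: null_set_setU => //.
  have : nu (N0 `|` A) <= nu N0.
    by apply: le_trans sN0; apply: ereal_sup_ubound; exists (N0 `|` A).
  have -> : N0 `|` A = N0 `|` (A `&` ~` N0) by rewrite -setDE setUDr setDv setD0.
  rewrite measureU//; [|exact: measurableI|by rewrite setIC -setIA setICl setI0].
  have mAC : measurable (A `&` ~` N0) by exact: measurableI.
  rewrite -[leRHS]adde0 leeD2lE ?nu_fin// => h.
  by apply: le_anti; rewrite measure_ge0 andbT; exact: h.
have [h [h0 hfin inth hE]] := radon_nikodym_sigma_finite nu1mu.
pose nu2 : {measure set T -> \bar R} := mrestr nu mN0.
exists (fine \o h), nu2; split.
- by apply: measurableT_comp => //; exact: measurable_int inth.
- by move=> x; rewrite fine_ge0.
- by exists N0; split => //; rewrite /nu2/= /mrestr setICl measure0.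
move=> A mA; under eq_integral do rewrite /= fineK//.
rewrite -hE// /nu1 /nu2/= /mfrestr /= /mrestr.
rewrite -measureU; [|exact: measurableI|exact: measurableI|]; last first.
  by rewrite setIACA setICl setI0.
by rewrite -setIUr setUCl setIT.
Qed.

End lebesgue_decomposition.

(** * The divergence as a functional of the measure *)

Section fdivergence_theory.
Context {R : realType}.
Local Notation T := (measurableTypeR R).
Local Notation prob := (probability T R).
Local Open Scope ereal_scope.
Implicit Types (mu nu P Q : prob) (rho : \bar R).

Lemma has_lebesgue_decomposition mu nu : exists theta nuperp,
  lebesgue_decomposition mu nu theta nuperp.
Proof. exact: lebesgue_decomposition_exists. Qed.

Lemma lebesgue_decomposition_total mu nu (theta : T -> R) (nuperp : {measure set T -> \bar R}) :
  lebesgue_decomposition mu nu theta nuperp ->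
  \int[mu]_x (theta x)%:E + nuperp setT = 1.
Proof. by move=> [_ _ _ nuE]; rewrite -nuE// probability_setT. Qed.

(** Both singular parts vanish off a common mu-null set N, so on [A `\` N] the two
    densities have the same integrals as nu. *)
Lemma lebesgue_decomposition_density_uniq mu nu (th1 th2 : T -> R)
    (n1 n2 : {measure set T -> \bar R}) :
  lebesgue_decomposition mu nu th1 n1 -> lebesgue_decomposition mu nu th2 n2 ->
  forall A, measurable A -> \int[mu]_(x in A) (th1 x)%:E = \int[mu]_(x in A) (th2 x)%:E.
Proof.
move=> [mt1 t10 [N1 [mN1 muN1 n1N1]] nu1] [mt2 t20 [N2 [mN2 muN2 n2N2]] nu2] A mA.
pose N := N1 `|` N2.
have mN : measurable N by exact: measurableU.
have muN : mu N = 0 by exact: null_set_setU.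
have mAN : measurable (A `\` N) by exact: measurableD.
rewrite (ge0_negligible_integral mN mA)//; last 2 first.
  exact/measurable_EFinP/measurable_funTS.
  by move=> x _; rewrite lee_fin.
rewrite [RHS](ge0_negligible_integral mN mA)//; last 2 first.
  exact/measurable_EFinP/measurable_funTS.
  by move=> x _; rewrite lee_fin.
have := nu1 _ mAN; rewrite nu2//.
rewrite (_ : n1 _ = 0); last first.
  apply: (subset_measure0 _ _ _ n1N1) => //; first exact: measurableC.
  by move=> x [_] Nx N1x; apply: Nx; left.
rewrite (_ : n2 _ = 0); last first.
  apply: (subset_measure0 _ _ _ n2N2) => //; first exact: measurableC.
  by move=> x [_] Nx N1x; apply: Nx; right.
by rewrite !adde0.
Qed.

Lemma lebesgue_decomposition_uniq mu nu (th1 th2 : T -> R)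
    (n1 n2 : {measure set T -> \bar R}) :
  lebesgue_decomposition mu nu th1 n1 -> lebesgue_decomposition mu nu th2 n2 ->
  {ae mu, forall x, th1 x = th2 x} /\ forall A, measurable A -> n1 A = n2 A.
Proof.
move=> d1 d2; have e12 := lebesgue_decomposition_density_uniq d1 d2.
have [mt1 t10 _ nu1] := d1; have [mt2 t20 _ nu2] := d2.
have fin1 A : measurable A -> \int[mu]_(x in A) (th1 x)%:E \is a fin_num.
  move=> mA; rewrite ge0_fin_numE; last by apply: integral_ge0 => x _; rewrite lee_fin.
  apply: (@le_lt_trans _ _ (nu A)); first by rewrite nu1// leeDl.
  by rewrite ltey_eq fin_num_measure.
split; last first.
  move=> A mA.
  have h : n1 A + \int[mu]_(x in A) (th1 x)%:E = n2 A + \int[mu]_(x in A) (th1 x)%:E.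
    by rewrite addeC -nu1// nu2// -e12// addeC.
  by rewrite -[LHS](addeK _ (fin1 A mA)) h addeK// fin1.
have : ae_eq mu setT (EFin \o th1) (EFin \o th2).
  apply: integral_ae_eq => //.
  - apply/integrableP; split; first exact/measurable_EFinP.
    under eq_integral do rewrite /= ger0_norm//.
    by rewrite ltey_eq fin1.
  - exact/measurable_EFinP.
  - by move=> E _ mE; exact: e12.
by apply: filterS => x /(_ I) [].
Qed.

Lemma integral_lebesgue_decomposition mu nu (theta : T -> R)
    (nuperp : {measure set T -> \bar R}) (g : T -> \bar R) :
  measurable_fun setT theta -> (forall x, (0 <= theta x)%R) ->
  (forall A, measurable A ->
    nu A = \int[mu]_(x in A) (theta x)%:E + nuperp A) ->
  measurable_fun setT g -> (forall x, 0 <= g x) ->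
  \int[nu]_x g x = \int[mu]_x (g x * (theta x)%:E) + \int[nuperp]_x g x.
Proof.
move=> mt t0 nuE mg g0.
have [m mE] := density_measure_exists mu mt t0.
have moo : m setT < +oo.
  rewrite mE; apply: (@le_lt_trans _ _ (nu setT)); last by rewrite probability_setT ltry.
  by rewrite nuE// leeDl.
rewrite -(integral_density mt t0 moo (fun A _ => mE A) mg g0).
rewrite -ge0_integral_measure_add//.
apply: eq_measure_integral => A mA _.
by apply: etrans (nuE _ mA) _; rewrite -mE; exact/esym/measure_addE.
Qed.

Variables (rho : \bar R) (f : R -> R) (mu : prob).
Hypothesis hf : divergence_function f.
Local Notation D := (fdivergence rho f mu).
Local Notation H := (halfline rho : set T).
Local Notation F := (extend f).

Lemma measurable_halfline : measurable (H : set T).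
Proof.
have -> : H = (`[0%R, +oo[ `&` [set x : R | (EFin x < rho)%E])%classic.
  by rewrite eqEsubset; split=> x /=; rewrite in_itv/= andbT.
apply: measurableI => //.
case: rho => [r| |].
- have -> : [set x : R | x%:E < r%:E] = `]-oo, r[%classic.
    by rewrite eqEsubset; split=> x /=; rewrite in_itv/= lte_fin.
  exact: measurable_itv.
- have -> : [set x : R | x%:E < +oo] = setT.
    by rewrite eqEsubset; split=> x //= _; rewrite ltry.
  exact: measurableT.
- have -> : [set x : R | x%:E < -oo] = set0 by rewrite eqEsubset; split.
  exact: measurable0.
Qed.

Lemma measurable_extend_comp (theta : T -> R) :
  measurable_fun setT theta -> measurable_fun setT (fun x => F (theta x)).
Proof. by move=> mt; apply: measurableT_comp => //; exact: measurable_extend. Qed.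

(** The choice made by [xget] is immaterial, by uniqueness of the decomposition. *)
Lemma fdivergence_decomposition nu (theta : T -> R)
    (nuperp : {measure set T -> \bar R}) :
  lebesgue_decomposition mu nu theta nuperp ->
  D nu = \int[mu]_(u in H) F (theta u) + recession f * nuperp H.
Proof.
move=> dec; rewrite /fdivergence.
set e := (X in _ = X).
case: xgetP => [d _ [th [n [dec' ->]]]|/(_ e)]; last first.
  by case; exists theta, nuperp.
have [ae nE] := lebesgue_decomposition_uniq dec' dec.
have [mt' _ _ _] := dec'; have [mt _ _ _] := dec.
rewrite nE; last exact: measurable_halfline.
congr (_ + _); apply: ae_eq_integral => //.
- exact: measurable_halfline.
- apply: measurable_funTS; exact: measurable_extend_comp.
- apply: measurable_funTS; exact: measurable_extend_comp.
- by move: ae; apply: filterS => x -> _.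
Qed.

Lemma integral_full_set (g : T -> \bar R) (P : prob) (A : set T) :
  measurable A -> P A = 1 -> measurable_fun setT g -> (forall x, 0 <= g x) ->
  \int[P]_(x in A) g x = \int[P]_x g x.
Proof.
move=> mA PA mg g0.
have PC : P (~` A) = 0 by rewrite probability_setC// PA subee.
rewrite [RHS](ge0_negligible_integral (N := ~` A))//; last exact: measurableC.
by rewrite setTD setCK.
Qed.

Lemma fdivergenceE nu (theta : T -> R) (nuperp : {measure set T -> \bar R}) :
  mu H = 1 -> nu H = 1 ->
  lebesgue_decomposition mu nu theta nuperp ->
  D nu = \int[mu]_u F (theta u) + recession f * nuperp setT.
Proof.
move=> muH nuH dec; rewrite (fdivergence_decomposition dec).
have mH := measurable_halfline.
have [mt t0 _ nuE] := dec.
rewrite integral_full_set//; last 2 first.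
- exact: measurable_extend_comp.
- by move=> x; exact: extend_ge0.
congr (_ + _ * _).
have nC : nuperp (~` H) = 0.
  apply: le_anti; rewrite measure_ge0 andbT.
  have <- : nu (~` H) = 0 by rewrite probability_setC// nuH subee.
  by rewrite nuE ?leeDr//; [apply: integral_ge0 => x _; rewrite lee_fin|exact: measurableC].
apply/esym; transitivity (nuperp H + nuperp (~` H)); last by rewrite nC adde0.
by rewrite -measureU ?setUCr ?setICr//; exact: measurableC.
Qed.

(** The measure la may charge the same sets as mu: by [extend_recession], its
    absolutely continuous part becomes cheaper when it joins the density. This
    allows atoms to be added at points that mu may charge. *)
Lemma fdivergence_le nu (theta : T -> R) (la : {measure set T -> \bar R}) :
  measurable_fun setT theta -> (forall x, (0 <= theta x)%R) ->
  (forall A, measurable A -> nu A = \int[mu]_(x in A) (theta x)%:E + la A) ->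
  D nu <= \int[mu]_u F (theta u) + recession f * la setT.
Proof.
move=> mt t0 nuE.
have laoo : la setT < +oo.
  apply: (@le_lt_trans _ _ (nu setT)); last by rewrite probability_setT ltry.
  by rewrite nuE// leeDr//; apply: integral_ge0 => x _; rewrite lee_fin.
have [th [n [mth th0 sing]]] :=
  lebesgue_decomposition_exists mu (mfrestr measurableT laoo).
rewrite /= /mfrestr/= /mrestr => laE'.
have laE A : measurable A -> la A = \int[mu]_(x in A) (th x)%:E + n A.
  by move=> mA; rewrite -laE'// setIT.
have mH := measurable_halfline.
have dec : lebesgue_decomposition mu nu (theta \+ th)%R n.
  split => //.
  - exact: measurable_funD.
  - by move=> x /=; rewrite addr_ge0.
  - move=> A mA; rewrite nuE// laE// addeA; congr (_ + _).
    under [RHS]eq_integral do rewrite /= EFinD.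
    by rewrite ge0_integralD// => [x _||x _|]; rewrite ?lee_fin//;
      apply/measurable_EFinP/measurable_funTS.
rewrite (fdivergence_decomposition dec).
have F0 (x : T) : 0 <= F (theta x) by exact: extend_ge0.
have mF := measurable_extend_comp mt.
have rec0 := recession_ge0 hf.
rewrite laE// ge0_muleDr//; last by apply: integral_ge0 => x _; rewrite lee_fin.
rewrite addeA; apply: leeD; last first.
  by apply: lee_wpmul2l => //; rewrite le_measure ?inE.
rewrite -ge0_integralZl//; [|exact/measurable_EFinP|by move=> x _; rewrite lee_fin].
rewrite -ge0_integralD//; last 2 first.
  by move=> x _; rewrite mule_ge0// lee_fin.
  exact/measurable_funeM/measurable_EFinP.
apply: (@le_trans _ _ (\int[mu]_(u in H) (F (theta u) + recession f * (th u)%:E))).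
  apply: ge0_le_integral => //.
  - by move=> x _; exact: extend_ge0.
  - apply: measurable_funTS; apply: measurable_extend_comp; exact: measurable_funD.
  - apply/measurable_funTS/emeasurable_funD => //.
    exact/measurable_funeM/measurable_EFinP.
  - by move=> x _; exact: extend_recession.
apply: ge0_subset_integral => //.
- apply: emeasurable_funD => //; exact/measurable_funeM/measurable_EFinP.
- by move=> x _; rewrite adde_ge0// mule_ge0// lee_fin.
Qed.

Lemma fdivergence_ge0 nu : 0 <= D nu.
Proof.
have [theta [nuperp dec]] := has_lebesgue_decomposition mu nu.
rewrite (fdivergence_decomposition dec) adde_ge0//.
  by apply: integral_ge0 => x _; exact: extend_ge0.
by rewrite mule_ge0//; exact: recession_ge0.
Qed.

Lemma fdivergence_self : D mu = 0.
Proof.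
apply/le_anti; rewrite fdivergence_ge0 andbT.
apply: le_trans (fdivergence_le (theta := cst 1%R) (la := mzero) _ _ _) _ => //.
- by move=> A mA; rewrite -[LHS]mul1e -integral_cst// adde0.
- rewrite [X in X + _](_ : _ = 0); first by rewrite add0e mule0.
  by under eq_integral do rewrite extend1//; rewrite integral0.
Qed.

(** Decomposing is affine because the union of two mu-null sets carries both
    singular parts. *)
Lemma mixture_decomposition (t : R) P Q (M : prob) (thP thQ : T -> R)
    (nP nQ : {measure set T -> \bar R}) : (0 <= t <= 1)%R ->
  (forall A, M A = t%:E * P A + (1 - t)%:E * Q A) ->
  lebesgue_decomposition mu P thP nP -> lebesgue_decomposition mu Q thQ nQ ->
  exists2 nM : {measure set T -> \bar R},
    lebesgue_decomposition mu M (fun x => t * thP x + (1 - t) * thQ x)%R nM &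
    nM setT = t%:E * nP setT + (1 - t)%:E * nQ setT.
Proof.
move=> /andP[t0 t1] ME [mtP tP0 [N1 [mN1 muN1 n1N1]] PE]
  [mtQ tQ0 [N2 [mN2 muN2 n2N2]] QE].
have t1' : (0 <= 1 - t)%R by rewrite subr_ge0.
pose m := measure_add (mscale (NngNum t0) nP) (mscale (NngNum t1') nQ).
have mE A : m A = t%:E * nP A + (1 - t)%:E * nQ A by rewrite /m measure_addE.
exists m => //; split.
- by apply: measurable_funD; exact: measurable_funM.
- by move=> x; rewrite addr_ge0// mulr_ge0.
- exists (N1 `|` N2); split; [exact: measurableU|exact: null_set_setU|].
  apply: etrans (mE _) _.
  rewrite (_ : nP _ = 0); last first.
    apply: (subset_measure0 _ _ _ n1N1); [exact/measurableC/measurableU|exact: measurableC|].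
    by move=> x Nx N1x; apply: Nx; left.
  rewrite (_ : nQ _ = 0); last first.
    apply: (subset_measure0 _ _ _ n2N2); [exact/measurableC/measurableU|exact: measurableC|].
    by move=> x Nx N1x; apply: Nx; right.
  by rewrite !mule0 adde0.
- move=> A mA; rewrite ME PE// QE//.
  under [in RHS]eq_integral do rewrite EFinD !EFinM.
  have mt1 : measurable_fun A (fun x => (thP x)%:E) by exact/measurable_EFinP/measurable_funTS.
  have mt2 : measurable_fun A (fun x => (thQ x)%:E) by exact/measurable_EFinP/measurable_funTS.
  rewrite ge0_integralD//; last 4 first.
  + by move=> x _; rewrite mule_ge0 ?lee_fin.
  + exact: measurable_funeM.
  + by move=> x _; rewrite mule_ge0 ?lee_fin.
  + exact: measurable_funeM.
  rewrite !ge0_integralZl ?lee_fin//; [|by move=> x _; rewrite lee_fin..].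
  have iP0 : 0 <= \int[mu]_(x in A) (thP x)%:E.
    by apply: integral_ge0 => x _; rewrite lee_fin.
  have iQ0 : 0 <= \int[mu]_(x in A) (thQ x)%:E.
    by apply: integral_ge0 => x _; rewrite lee_fin.
  rewrite [X in _ = _ + X](mE A).
  move: (\int[mu]_(x in A) _) (\int[mu]_(x in A) _) iP0 iQ0 => a b a0 b0.
  by rewrite (ge0_muleDr _ a0)// (ge0_muleDr _ b0)// addeACA.
Qed.

Lemma fdivergence_convex (t : R) P Q (M : prob) : (0 <= t <= 1)%R ->
  (forall A, M A = t%:E * P A + (1 - t)%:E * Q A) ->
  mu H = 1 -> P H = 1 -> Q H = 1 ->
  D M <= t%:E * D P + (1 - t)%:E * D Q.
Proof.
move=> t01 ME muH PH QH; have /andP[t0 t1] := t01.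
have t1' : (0 <= 1 - t)%R by rewrite subr_ge0.
have [thP [nP decP]] := has_lebesgue_decomposition mu P.
have [thQ [nQ decQ]] := has_lebesgue_decomposition mu Q.
have [nM decM nME] := mixture_decomposition t01 ME decP decQ.
have MH : M H = 1 by rewrite ME PH QH !mule1 -EFinD; congr EFin; ring.
rewrite (fdivergenceE muH MH decM) (fdivergenceE muH PH decP) (fdivergenceE muH QH decQ) nME.
have [mtP tP0 _ _] := decP; have [mtQ tQ0 _ _] := decQ.
have rec0 := recession_ge0 hf.
have FP0 (x : T) : 0 <= F (thP x) by exact: extend_ge0.
have FQ0 (x : T) : 0 <= F (thQ x) by exact: extend_ge0.
have mFP := measurable_extend_comp mtP.
have mFQ := measurable_extend_comp mtQ.
have iP0 : 0 <= \int[mu]_x F (thP x) by exact: integral_ge0.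
have iQ0 : 0 <= \int[mu]_x F (thQ x) by exact: integral_ge0.
rewrite (ge0_muleDr t%:E iP0) ?mule_ge0// (ge0_muleDr (1 - t)%:E iQ0) ?mule_ge0//.
rewrite (ge0_muleDr (recession f) (y := t%:E * _)) ?mule_ge0 ?lee_fin//.
rewrite [leRHS]addeACA; apply: leeD; last by rewrite muleCA [X in _ + X]muleCA.
rewrite -!ge0_integralZl ?lee_fin//.
rewrite -ge0_integralD//; last 4 first.
+ by move=> x _; rewrite mule_ge0 ?lee_fin.
+ exact: measurable_funeM.
+ by move=> x _; rewrite mule_ge0 ?lee_fin.
+ exact: measurable_funeM.
apply: ge0_le_integral => //.
- by move=> x _; exact: extend_ge0.
- by apply: measurable_extend_comp; apply: measurable_funD; exact: measurable_funM.
- by apply: emeasurable_funD; exact: measurable_funeM.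
- by move=> x _; exact: extend_convex.
Qed.

End fdivergence_theory.

(** * Almost everywhere convergent minimizing sequences *)

Section almost_everywhere_limits.
Context d (T : measurableType d) (R : realType).
Local Open Scope ereal_scope.

Lemma measurable_limn_einf (g : (T -> \bar R)^nat) :
  (forall n, measurable_fun setT (g n)) ->
  measurable_fun setT (fun x => limn_einf (g ^~ x)).
Proof.
move=> mg; rewrite /limn_einf.
apply: measurableT_comp => //.
apply: (measurable_fun_limn_esup (f := fun n x => - g n x)) => n.
exact: measurableT_comp.
Qed.

Lemma le_limn_einf (u v : (\bar R)^nat) :
  (forall n, u n <= v n) -> limn_einf u <= limn_einf v.
Proof.
move=> uv; rewrite !limn_einf_lim; apply: lee_lim; try exact: is_cvg_einfs.
apply: nearW => n; apply: le_ereal_inf_tmp => _ [k /= nk <-].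
by apply: le_trans (uv k); apply: ereal_inf_lbound; exists k.
Qed.

Lemma limn_einf_le (u b : (\bar R)^nat) (l : \bar R) :
  (forall n, u n <= b n) -> b @ \oo --> l -> limn_einf u <= l.
Proof.
by move=> ub bl; have [<- _] := cvg_limn_einf_sup bl; exact: le_limn_einf.
Qed.

Lemma cvg_invSn (b : \bar R) : b + (n.+1%:R^-1)%:E @[n --> \oo] --> b.
Proof.
rewrite -[X in _ --> X]adde0; apply: cvgeD => //.
- exact: fin_num_adde_defl.
- exact: cvg_cst.
- apply: cvg_EFin; first by apply: nearW.
  exact: cvg_harmonic.
Qed.

Lemma fatou_ae (mu : {measure set T -> \bar R}) (g : (T -> \bar R)^nat)
    (h : T -> \bar R) (b : \bar R) :
  (forall n, measurable_fun setT (g n)) -> (forall n x, 0 <= g n x) ->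
  measurable_fun setT h -> (forall x, 0 <= h x) ->
  {ae mu, forall x, h x <= limn_einf (g ^~ x)} ->
  (forall n, \int[mu]_x g n x <= b + (n.+1%:R^-1)%:E) ->
  \int[mu]_x h x <= b.
Proof.
move=> mg g0 mh h0 hg gb.
apply: (@le_trans _ _ (\int[mu]_x limn_einf (g ^~ x))).
  apply: ae_ge0_le_integral => //.
  - move=> x _; rewrite limn_einf_lim; apply: lime_ge; first exact: is_cvg_einfs.
    by apply: nearW => n; apply: le_ereal_inf_tmp => _ [k _ <-].
  - exact: measurable_limn_einf.
  - by move: hg; apply: filterS => x hx _.
apply: (le_trans (fatou mu measurableT mg (fun n x _ => g0 n x))).
apply: (limn_einf_le (b := fun n => b + (n.+1%:R^-1)%:E)) => [n|]; [exact: gb|exact: cvg_invSn].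
Qed.

(** The total variation of the sequence has a finite integral, so it is finite
    almost everywhere. *)
Lemma ae_cvg_summable (mu : {measure set T -> \bar R}) (u : (T -> R)^nat) (c : R) :
  (forall n, measurable_fun setT (u n)) -> (0 <= c)%R ->
  (forall n, \int[mu]_x (`|u n.+1 x - u n x|)%:E <= (c / (2 ^ n.+1)%:R)%:E) ->
  {ae mu, forall x, cvgn (u ^~ x)}.
Proof.
move=> mu_ c0 uc.
pose v n x := `|u n.+1 x - u n x|%R.
have mv n : measurable_fun setT (fun x => (v n x)%:E).
  by apply/measurable_EFinP; apply: measurableT_comp => //; exact: measurable_funB.
pose V x := \sum_(0 <= n <oo) (v n x)%:E.
have mV : measurable_fun setT V.
  apply: (ge0_emeasurable_sum (P := xpredT)) => [k x _ _|k _]; last exact: mv.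
  by rewrite lee_fin /v.
have V0 x : 0 <= V x by apply: nneseries_ge0 => n _ _; rewrite lee_fin /v.
have intV : mu.-integrable setT V.
  apply/integrableP; split => //.
  under eq_integral do rewrite gee0_abs//.
  rewrite /V integral_nneseries//; last by move=> n x _; rewrite lee_fin /v.
  apply: (@le_lt_trans _ _ c%:E); last by rewrite ltry.
  apply: le_trans (epsilon_trick0 xpredT c0).
  apply: lee_nneseries => [n _ _|n _]; last exact: uc.
  by apply: integral_ge0 => x _; rewrite lee_fin /v.
have := integrable_ae measurableT intV.
apply: filterS => x /(_ I) Vx.
have cs : cvgn (series (telescope (u ^~ x))).
  apply: normed_cvg; apply: nondecreasing_is_cvgn.
    by apply/nondecreasing_seqP => n; rewrite /= seriesSr lerDl /=.
  exists (fine (V x)) => _ [n _ <-].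
  rewrite /= -lee_fin fineK// /series/= -sumEFin.
  by apply: nneseries_lim_ge => k _ _; rewrite lee_fin.
have -> : u ^~ x = (fun n => u 0%N x + series (telescope (u ^~ x)) n)%R.
  by apply/funext => n; exact: (eq_sum_telescope (u ^~ x)).
by apply: is_cvgD => //; exact: is_cvg_cst.
Qed.

(** The limit of [expR (- u n / 2)] is not 0, as otherwise u would tend to +oo
    and its lower limit would be infinite; so the logarithm applies. *)
Lemma cvg_expR_cvg (u : R^nat) (l : \bar R) :
  cvgn (fun n => expR (- u n / 2)) -> limn_einf (EFin \o u) \is a fin_num ->
  u @ \oo --> fine (limn_einf (EFin \o u)).
Proof.
set h := fun n => expR (- u n / 2) => ch lfin.
have uE n : u n = (- 2 * ln (h n))%R by rewrite /h expRK; field.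
have : (0 <= limn h)%R.
  by apply: limr_ge => //; apply: nearW => n; rewrite expR_ge0.
rewrite le_eqVlt => /predU1P[h0|h0].
  have uy : u @ \oo --> +oo%R.
    apply/cvgryPge => A.
    have : h @ \oo --> 0%R by rewrite h0.
    move=> /cvgr_lt /(_ (expR (- A / 2))); rewrite expR_gt0 => /(_ isT).
    by apply: filterS => n; rewrite /h ltr_expR; lra.
  have : EFin \o u @ \oo --> +oo by apply/cvgeryP.
  move=> /cvg_limn_einf_sup[ly _]; move: lfin.
  by rewrite ly.
have ul : u @ \oo --> (- 2 * ln (limn h))%R.
  have -> : u = (fun n => - 2 * ln (h n))%R by apply/funext => n; exact: uE.
  apply: cvgM; first exact: cvg_cst.
  by apply: (cvg_comp _ _ ch); exact: continuous_ln.
have : EFin \o u @ \oo --> (- 2 * ln (limn h))%:E by apply: cvg_EFin => //; exact: nearW.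
by move=> /cvg_limn_einf_sup[-> _].
Qed.

(** A strict inequality on a set A could not be made up for on its complement,
    so the integrals agree on every A. *)
Lemma ge0_integral_le_ae_eq (mu : {measure set T -> \bar R})
    (g h : T -> \bar R) :
  measurable_fun setT g -> measurable_fun setT h ->
  (forall x, 0 <= g x) -> (forall x, g x <= h x) ->
  \int[mu]_x h x < +oo -> \int[mu]_x h x <= \int[mu]_x g x ->
  {ae mu, forall x, g x = h x}.
Proof.
move=> mg mh g0 gh hoo hg.
have h0 x : 0 <= h x by exact: le_trans (gh x).
have le_int A : measurable A -> \int[mu]_(x in A) g x <= \int[mu]_(x in A) h x.
  by move=> mA; apply: ge0_le_integral => //; exact: measurable_funTS.
have split_int (k : T -> \bar R) A : measurable_fun setT k -> (forall x, 0 <= k x) ->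
    measurable A -> \int[mu]_x k x = \int[mu]_(x in A) k x + \int[mu]_(x in ~` A) k x.
  move=> mk k0 mA; have mC := measurableC mA.
  by rewrite -ge0_integral_setU ?setUCr//; apply/disj_setPS => x [].
have : ae_eq mu setT g h.
  apply: integral_ae_eq => //.
    apply/integrableP; split => //.
    under eq_integral do rewrite gee0_abs//.
    by apply: le_lt_trans hoo; exact: le_int.
  move=> A _ mA; apply: le_anti; rewrite le_int//=.
  move: hoo hg; rewrite (split_int h A)// (split_int g A)//.
  have := le_int A mA; have := le_int _ (measurableC mA).
  have : 0 <= \int[mu]_(x in A) g x by exact: integral_ge0.
  have : 0 <= \int[mu]_(x in ~` A) g x by exact: integral_ge0.
  have : 0 <= \int[mu]_(x in ~` A) h x by exact: integral_ge0.
  have : 0 <= \int[mu]_(x in A) h x by exact: integral_ge0.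
  move: (\int[mu]_(x in A) g x) (\int[mu]_(x in ~` A) g x).
  move: (\int[mu]_(x in A) h x) (\int[mu]_(x in ~` A) h x).
  move=> [a| |] // [a'| |] // [c| |] // [c'| |] //.
  by rewrite -!EFinD !lee_fin; lra.
by apply: filterS => x; apply.
Qed.

Let Phi (mu : {measure set T -> \bar R}) (a : T -> R) :=
  \int[mu]_x (expR (- a x))%:E.

Let midpoint (a b : T -> R) (x : T) := (2^-1 * a x + (1 - 2^-1) * b x)%R.

Let measurable_expRN (a : T -> R) (k : R) : measurable_fun setT a ->
  measurable_fun setT (fun x => (expR (- a x / k))%:E).
Proof.
move=> ma; apply/measurable_EFinP; apply: measurableT_comp => //.
by apply: measurable_funM => //; exact: measurableT_comp.
Qed.

(** The parallelogram law in L2 for [expR (- a / 2)] and [expR (- b / 2)], whose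
    product is [expR (- midpoint a b)]. It measures the strict convexity of Phi. *)
Let Phi_midpoint (mu : probability T R) (a b : T -> R) :
  measurable_fun setT a -> measurable_fun setT b ->
  \int[mu]_x ((expR (- a x / 2) - expR (- b x / 2)) ^+ 2)%:E
    + (Phi mu (midpoint a b) + Phi mu (midpoint a b)) = Phi mu a + Phi mu b.
Proof.
move=> ma mb.
have mE (c : T -> R) : measurable_fun setT c ->
    measurable_fun setT (fun x => (expR (- c x))%:E).
  by move=> mc; under eq_fun do rewrite -[(- _)%R]divr1; exact: measurable_expRN.
have mm : measurable_fun setT (midpoint a b).
  by apply: measurable_funD; exact: measurable_funM.
have msq : measurable_fun setT
    (fun x => ((expR (- a x / 2) - expR (- b x / 2)) ^+ 2)%:E).
  by apply/measurable_EFinP/measurable_funX/measurable_funB;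
    apply/measurable_EFinP; exact: measurable_expRN.
have e0 (c : T -> R) x : [set: T] x -> 0 <= (expR (- c x))%:E.
  by move=> _; rewrite lee_fin expR_ge0.
rewrite /Phi -(ge0_integralD mu measurableT (@e0 a) (mE _ ma) (@e0 b) (mE _ mb)).
rewrite -(ge0_integralD mu measurableT (@e0 _) (mE _ mm) (@e0 _) (mE _ mm)).
rewrite -ge0_integralD//; last 3 first.
- by move=> x _; rewrite lee_fin sqr_ge0.
- by move=> x _; rewrite adde_ge0// e0.
- by apply: emeasurable_funD; exact: mE.
apply: eq_integral => x _; rewrite -!EFinD; congr EFin.
have -> : expR (- a x) = (expR (- a x / 2) * expR (- a x / 2))%R.
  by rewrite -expRD; congr expR; field.
have -> : expR (- b x) = (expR (- b x / 2) * expR (- b x / 2))%R.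
  by rewrite -expRD; congr expR; field.
have -> : expR (- midpoint a b x) = (expR (- a x / 2) * expR (- b x / 2))%R.
  by rewrite -expRD /midpoint; congr expR; field.
by ring.
Qed.

(** A compactness principle for decreasing midpoint-closed sets that are bounded
    in L1. The infimum of the strictly convex functional Phi over [C n] increases
    with n to a limit Js. If [u k] in [C k] is chosen with [Phi (u k)] close to
    Js, the midpoint of [u k] and [u k.+1] has a Phi not much below Js, so
    [Phi_midpoint] makes [expR (- u k / 2)] a Cauchy sequence in L2, at a geometric
    rate. It converges almost everywhere, and so does u, because the L1 bound and
    Fatou's lemma exclude infinite lower limits. *)
Lemma midpoint_closed_ae_cvg (mu : probability T R) (C : nat -> set (T -> R)) :
  (forall n, C n !=set0) -> (forall n, C n.+1 `<=` C n) ->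
  (forall n a, C n a -> [/\ measurable_fun setT a, (forall x, (0 <= a x)%R) &
                          \int[mu]_x (a x)%:E <= 1]) ->
  (forall n a b, C n a -> C n b ->
    C n (fun x => 2^-1 * a x + (1 - 2^-1) * b x)%R) ->
  exists (u : (T -> R)^nat) (theta : T -> R),
    [/\ forall n, C n (u n), measurable_fun setT theta,
        forall x, (0 <= theta x)%R
      & {ae mu, forall x, u ^~ x @ \oo --> theta x}].
Proof.
move=> C0 Cdecr CP Cmid.
have Cle n m : (n <= m)%N -> C m `<=` C n.
  move=> /subnKC <-; elim: (m - n)%N => [|k IH]; first by rewrite addn0.
  by rewrite addnS; apply: subset_trans (Cdecr _) IH.
pose J n := ereal_inf [set Phi mu a | a in C n].
have Phi0 a : 0 <= Phi mu a by apply: integral_ge0 => x _; rewrite lee_fin expR_ge0.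
have Phi1 n a : C n a -> Phi mu a <= 1.
  move=> /CP [ma a0 _].
  rewrite -(integral_cst_probability mu 1).
  apply: ge0_le_integral => //.
  - by apply/measurable_EFinP; apply: measurableT_comp => //; exact: measurableT_comp.
  - by move=> x _; rewrite lee_fin -expR0 ler_expR oppr_le0.
have J0 n : 0 <= J n by apply: le_ereal_inf_tmp => _ [a _ <-].
have J1 n : J n <= 1.
  have [a Ca] := C0 n.
  by apply: le_trans (Phi1 _ _ Ca); apply: ereal_inf_lbound; exists a.
have Jle n m : (n <= m)%N -> J n <= J m.
  by move=> nm; apply: ereal_inf_le_tmp => _ [a Ca <-]; exists a => //; exact: Cle nm _ Ca.
pose Js := ereal_sup (range J).
have Js1 : Js <= 1 by apply: ge_ereal_sup => _ [n _ <-].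
have JJs n : J n <= Js by apply: ereal_sup_ubound; exists n.
have Js0 : 0 <= Js := le_trans (J0 0%N) (JJs 0%N).
have Jsfin : Js \is a fin_num by rewrite ge0_fin_numE// (le_lt_trans Js1)// ltry.
have Jfin n : J n \is a fin_num by rewrite ge0_fin_numE// (le_lt_trans (J1 n))// ltry.
(* The tolerance 4^-k on Phi gives L2 distances of order 2^-k. *)
pose eps (k : nat) : R := ((2 ^ k * 2 ^ k)%:R^-1)%R.
have eps0 k : (0 < eps k)%R by rewrite invr_gt0 ltr0n muln_gt0 expn_gt0.
have /choice[NU NUP] : forall k, exists p : nat * (T -> R),
    [/\ (k <= p.1)%N, Js - (eps k)%:E <= J p.1, C p.1 p.2 &
        Phi mu p.2 <= Js + (eps k)%:E].
  move=> k.
  have [_ [m _ <-] Jm] := ub_ereal_sup_adherent (eps0 k) Jsfin.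
  pose n := maxn k m.
  have [_ [a Ca <-] Ja] := lb_ereal_inf_adherent (eps0 k) (Jfin n).
  exists (n, a); split => //=; first exact: leq_maxl.
    by apply: le_trans (ltW Jm) _; apply: Jle; exact: leq_maxr.
  by apply: le_trans (ltW Ja) _; apply: leeD2r; exact: JJs.
pose N k := (NU k).1; pose u k := (NU k).2.
have Cu k : C k (u k) by have [kN _ Cu _] := NUP k; exact: Cle kN _ Cu.
have uP k : measurable_fun setT (u k) by have [] := CP _ _ (Cu k).
have u0 k x : (0 <= u k x)%R by have [] := CP _ _ (Cu k).
have sq_le k : \int[mu]_x ((expR (- u k x / 2) - expR (- u k.+1 x / 2)) ^+ 2)%:E
    <= (4 * eps k)%:E.
  have epsS : (eps k.+1 <= eps k)%R.
    by rewrite lef_pV2 ?posrE ?ltr0n ?muln_gt0 ?expn_gt0// ler_nat leq_mul// leq_exp2l.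
  have PhiM : Js - (eps k)%:E <= Phi mu (midpoint (u k) (u k.+1)).
    have [_ h1 C1 _] := NUP k; have [_ h2 C2 _] := NUP k.+1.
    pose m := minn (N k) (N k.+1).
    have : J m <= Phi mu (midpoint (u k) (u k.+1)).
      apply: ereal_inf_lbound; exists (midpoint (u k) (u k.+1)) => //.
      apply: Cmid; first by apply: Cle C1; exact: geq_minl.
      by apply: Cle C2; exact: geq_minr.
    apply: le_trans; rewrite /m; case: (leqP (N k) (N k.+1)) => _ //.
    by apply: le_trans h2; apply: leeB => //; rewrite lee_fin.
  have := Phi_midpoint mu (uP k) (uP k.+1).
  have [_ _ _ hk] := NUP k; have [_ _ _ hk1] := NUP k.+1.
  have fin1 := Phi1 _ _ (Cu k); have fin2 := Phi1 _ _ (Cu k.+1).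
  have finm := Phi1 k _ (Cmid _ _ _ (Cu k) (Cdecr _ _ (Cu k.+1))).
  move: hk hk1 fin1 fin2 finm PhiM (Phi0 (u k)) (Phi0 (u k.+1))
    (Phi0 (midpoint (u k) (u k.+1))).
  rewrite -/(u k) -/(u k.+1) -/(midpoint (u k) (u k.+1)).
  move: (Phi mu _) (Phi mu _) (Phi mu _) => [p| |] [q| |] [r| |] //.
  move: Jsfin; case: (Js) => [js| |] // _.
  rewrite -!EFinD !lee_fin => pk qk _ _ _ rk _ _ _.
  case: (\int[mu]_x _) => [s| |] //; rewrite -!EFinD.
  by move=> [srpq]; rewrite lee_fin; lra.
pose h k x := expR (- u k x / 2).
have mh k : measurable_fun setT (h k).
  by apply/measurable_EFinP; exact: measurable_expRN.
have hcvg : {ae mu, forall x, cvgn (h ^~ x)}.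
  (* By |y| <= c^-1 + c * y^2 with c = 2^k, consecutive terms are at L1 distance
     at most 2^-k + 2^k * (4 * 4^-k) = 10 / 2^(k+1). *)
  apply: (@ae_cvg_summable _ _ 10) => // k.
  apply: (@le_trans _ _ (\int[mu]_x (((2 ^ k)%:R^-1)%:E +
      ((2 ^ k)%:R)%:E * ((h k x - h k.+1 x) ^+ 2)%:E))).
    apply: ge0_le_integral => //.
    - apply/measurable_EFinP; apply: measurableT_comp => //; exact: measurable_funB.
    - apply: emeasurable_funD; first exact: measurable_cst.
      by apply: measurable_funeM; apply/measurable_EFinP/measurable_funX/measurable_funB.
    - move=> x _; rewrite -EFinM -EFinD lee_fin distrC.
      have : (0 < (2 ^ k)%:R :> R)%R by rewrite ltr0n expn_gt0.
      move: ((2 ^ k)%:R : R) (h k x - h k.+1 x)%R => c y c0.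
      rewrite -(ler_pM2r c0) mulrDl mulVf ?gt_eqF//.
      have := sqr_ge0 (`|y| * c - 1)%R; have := sqr_ge0 (`|y| * c)%R.
      rewrite -[(y ^+ 2)%R]real_normK ?num_real//; lra.
  rewrite ge0_integralD//; last 2 first.
  - by move=> x _; rewrite mule_ge0// lee_fin ?sqr_ge0.
  - by apply: measurable_funeM; apply/measurable_EFinP/measurable_funX/measurable_funB.
  rewrite integral_cst_probability ge0_integralZl//; last 2 first.
  - by apply/measurable_EFinP/measurable_funX/measurable_funB.
  - by move=> x _; rewrite lee_fin sqr_ge0.
  apply: (@le_trans _ _ (((2 ^ k)%:R^-1)%:E + ((2 ^ k)%:R)%:E * (4 * eps k)%:E)).
    by apply: leeD2l; apply: lee_wpmul2l; [rewrite lee_fin|exact: sq_le].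
  rewrite -EFinM -EFinD lee_fin /eps expnS !natrM.
  have : (0 < (2 ^ k)%:R :> R)%R by rewrite ltr0n expn_gt0.
  move: ((2 ^ k)%:R : R) => c c0.
  rewrite le_eqVlt; apply/orP; left; apply/eqP; field.
  by rewrite gt_eqF.
pose L x := limn_einf (fun n => (u n x)%:E).
have mL : measurable_fun setT L by apply: measurable_limn_einf => n; exact/measurable_EFinP.
have L0 x : 0 <= L x.
  rewrite /L limn_einf_lim; apply: lime_ge; first exact: is_cvg_einfs.
  by apply: nearW => n; apply: le_ereal_inf_tmp => _ [k _ <-]; rewrite lee_fin.
have Lfin : {ae mu, forall x, L x \is a fin_num}.
  have : mu.-integrable setT L.
    apply/integrableP; split => //.
    under eq_integral do rewrite gee0_abs//.
    apply: (@le_lt_trans _ _ 1); last by rewrite ltry.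
    apply: (fatou_ae (g := fun n x => (u n x)%:E)) => //.
    - by move=> n; exact/measurable_EFinP.
    - by apply: aeW => x; exact: lexx.
    - move=> n; apply: (@le_trans _ _ 1); first by have [] := CP _ _ (Cu n).
      by rewrite leeDl// lee_fin invr_ge0.
  by move=> /(integrable_ae measurableT); apply: filterS => x; exact.
exists u, (fine \o L); split => //.
- by apply: measurableT_comp.
- by move=> x; rewrite fine_ge0.
by apply: filterS2 hcvg Lfin => x hx Lx; exact: cvg_expR_cvg.
Qed.

End almost_everywhere_limits.

(** * Attaining the infimum up to a displaced atom *)

Section relaxed_minimizer.
Context {R : realType}.
Local Notation T := (measurableTypeR R).
Local Notation prob := (probability T R).
Local Open Scope ereal_scope.
Variables (rho : \bar R) (f : R -> R) (mu : prob).
Hypotheses (hf : divergence_function f) (muH : mu (halfline rho) = 1).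
Local Notation D := (fdivergence rho f mu).
Local Notation H := (halfline rho : set T).
Local Notation F := (extend f).

(** What is left of a constraint after mass has escaped or has been moved to a
    point x0: the upper bounds on the integrals of those nonnegative functions
    that such a displacement cannot increase, singled out by the predicate ok. *)
Definition inherits_moment_bounds (ok : (R -> R) -> Prop) (K : set prob)
    (nu' : prob) : Prop :=
  forall h : R -> R, measurable_fun [set: T] h -> (forall x, (0 <= h x)%R) -> ok h ->
  forall c : \bar R, (forall nu, K nu -> \int[nu]_x (h x)%:E <= c) ->
    \int[nu']_x (h x)%:E <= c.

(** Affine minorants are continuous and [extend f] is their supremum. *)
Lemma extend_sub_affine_lsc (y_ : R^nat) (y L be : R) :
  (forall n, (0 <= y_ n)%R) -> (0 <= y)%R -> y_ @ \oo --> y ->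
  F y - (L * y + be)%:E <= limn_einf (fun n => F (y_ n) - (L * y_ n + be)%:E).
Proof.
move=> y_0 y0 yy; rewrite leeBlDr// extendE//.
apply: ge_ereal_sup => _ [[al c] /= hp <-].
rewrite -leeBlDr//.
have : (al * y_ n + c - (L * y_ n + be))%:E @[n --> \oo] -->
    (al * y + c - (L * y + be))%:E.
  apply: cvg_EFin; first exact: nearW.
  by apply: cvgB; apply: cvgD; try exact: cvg_cst; apply: cvgM => //; exact: cvg_cst.
move=> /cvg_limn_einf_sup[+ _]; rewrite -EFinB => <-.
apply: le_limn_einf => n; rewrite EFinB; apply: leeD => //.
exact: extend_minorant.
Qed.

Lemma cvg_mule_limn_einf (c : R) (y_ : R^nat) (y : R) :
  y_ @ \oo --> y -> (c * y)%:E <= limn_einf (fun n => (c * y_ n)%:E).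
Proof.
move=> yy; have : (c * y_ n)%:E @[n --> \oo] --> (c * y)%:E.
  by apply: cvg_EFin; [exact: nearW|apply: cvgM => //; exact: cvg_cst].
by move=> /cvg_limn_einf_sup[-> _].
Qed.

(** Let the slope L increase to [recession f]; if that limit is infinite, the
    bound by i leaves only q = 0. *)
Lemma recession_sup (X : \bar R) (q i : R) : 0 <= X -> (0 <= q)%R ->
  (forall L, (0 <= L)%R -> L = 0%R \/ L%:E < recession f ->
    X + (L * q)%:E <= i%:E) ->
  (recession f = +oo -> q = 0%R) /\ X + recession f * q%:E <= i%:E.
Proof.
have := recession_ge0 hf.
case: (recession f) => [r| |] //= r0 X0 q0 h.
- split=> //; rewrite -EFinM.
  have Xr : X \is a fin_num.
    rewrite ge0_fin_numE//; apply: (@le_lt_trans _ _ i%:E); last by rewrite ltry.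
    by have := h 0%R (lexx _) (or_introl erefl); rewrite mul0r adde0.
  move: r0; rewrite lee_fin le_eqVlt => /predU1P[<-|r0].
    exact: h (lexx _) (or_introl erefl).
  apply/lee_addgt0Pr => e e0.
  pose L := Num.max 0%R (r - e / (1 + q))%R.
  have q1 : (0 < 1 + q)%R by rewrite ltr_wpDr.
  have L0 : (0 <= L)%R by rewrite le_max lexx.
  have Lr : (L < r)%R by rewrite gt_max r0 /= ltrBlDr ltrDl divr_gt0.
  have rL : (r * q <= L * q + e)%R.
    have : (r - e / (1 + q) <= L)%R by rewrite le_max lexx orbT.
    have : (e / (1 + q) * q <= e)%R.
      by rewrite mulrAC ler_pdivrMr// ler_wpM2l ?(ltW e0)// lerDr.
    nra.
  apply: (@le_trans _ _ (X + (L * q)%:E + e%:E)).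
    by rewrite -addeA; apply: leeD2l; rewrite -EFinD lee_fin.
  by apply: leeD2r; apply: h => //; right; rewrite lte_fin.
- suff -> : q = 0%R.
    split=> //; rewrite mule0.
    by have := h 0%R (lexx _) (or_introl erefl); rewrite mul0r.
  apply/eqP; rewrite eq_le q0 andbT leNgt; apply/negP => qp.
  pose L := ((`|i| + 1) / q)%R.
  have L0 : (0 <= L)%R by rewrite divr_ge0// addr_ge0.
  have := h L L0; rewrite ltry => /(_ (or_intror isT)).
  rewrite /L divfK ?gt_eqF// leNgt => /negP; apply.
  apply: (@lt_le_trans _ _ (`|i| + 1)%:E); last by rewrite leeDr.
  by rewrite lte_fin (le_lt_trans (ler_norm i))// ltrDl.
Qed.

Lemma full_mass_closed (A : set T) (x0 : R) (K : set prob) (nu' : prob) :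
  measurable A -> A x0 -> (forall nu, K nu -> nu A = 1) ->
  inherits_moment_bounds (fun h => h x0 = 0%R) K nu' -> nu' A = 1.
Proof.
move=> mA Ax0 KA inh; have mAC : measurable (~` A) by exact: measurableC.
have ok : \1_(~` A) x0 = 0%R :> R by rewrite indicE memNset//; apply.
have : nu' (~` A) <= 0.
  have := inh (\1_(~` A)) _ _ ok 0.
  rewrite integral_indic// setIT; apply => //.
  move=> nu Knu; apply: (@le_trans _ _ (nu (~` A))).
    by rewrite integral_indic// setIT.
  by rewrite probability_setC// KA// subee.
rewrite probability_setC// => h.
apply: le_anti; rewrite probability_le1//=.
by move: h; rewrite leeBlDr ?add0e// fin_num_measure.
Qed.

(** Near-minimizers have densities in midpoint-closed sets, so a minimizing
    sequence may be taken with almost everywhere convergent densities. Let theta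
    be the limit density and s its integral. Fatou's lemma bounds
    [\int F theta + recession f * (1 - s)] by the infimum I, that is, the mass
    that escapes is charged as singular mass. Putting it back as an atom at x0
    thus yields a probability measure with divergence at most I. Fatou's lemma
    also preserves the bounds on nonnegative integrands; the atom adds nothing to
    them if they vanish at x0, or if [recession f = +oo], as then s = 1. *)
Theorem relaxed_minimizer (K : set prob) (x0 : R) :
  (forall nu, K nu -> nu H = 1) -> H x0 ->
  (forall P Q M : prob, K P -> K Q ->
     (forall A, M A = 2^-1%:E * P A + (1 - 2^-1)%:E * Q A) -> K M) ->
  (exists nu, K nu /\ D nu < +oo) ->
  exists nuhat : prob,
  [/\ nuhat H = 1, (forall nu, K nu -> D nuhat <= D nu)
    & inherits_moment_bounds (fun h => h x0 = 0%R \/ recession f = +oo) K nuhat].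
Proof.
move=> KH Hx0 Kmid [nu0 [Knu0 Dnu0]].
pose I := ereal_inf [set D nu | nu in K].
have I0 : 0 <= I by apply: le_ereal_inf_tmp => _ [nu _ <-]; exact: fdivergence_ge0.
have IleD nu : K nu -> I <= D nu by move=> Knu; apply: ereal_inf_lbound; exists nu.
have Ifin : I \is a fin_num.
  by rewrite ge0_fin_numE// (le_lt_trans _ Dnu0)// IleD.
pose C n := [set a : T -> R | exists nu nuperp,
  [/\ K nu, D nu <= I + (n.+1%:R^-1)%:E & lebesgue_decomposition mu nu a nuperp]].
have C0 n : C n !=set0.
  have n0 : (0 < n.+1%:R^-1 :> R)%R by rewrite invr_gt0.
  have [_ [nu Knu <-] Dnu] := lb_ereal_inf_adherent n0 Ifin.
  have [a [nuperp dec]] := has_lebesgue_decomposition mu nu.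
  by exists a, nu, nuperp; split => //; exact: ltW.
have Cdecr n : C n.+1 `<=` C n.
  move=> a [nu [nuperp [Knu Dnu dec]]]; exists nu, nuperp; split => //.
  apply: (le_trans Dnu); apply: leeD2l; rewrite lee_fin.
  by rewrite lef_pV2 ?posrE ?ltr0n// ler_nat.
have CP n a : C n a -> [/\ measurable_fun setT a, forall x, (0 <= a x)%R &
    \int[mu]_x (a x)%:E <= 1].
  move=> [nu [nuperp [_ _ dec]]]; have [ma a0 _ _] := dec; split => //.
  by rewrite -(lebesgue_decomposition_total dec) leeDl.
have half01 : (0 <= (2^-1 : R) <= 1)%R by apply/andP; split; lra.
have Cmid n a b : C n a -> C n b -> C n (fun x => 2^-1 * a x + (1 - 2^-1) * b x)%R.
  move=> [P [nP [KP DP decP]]] [Q [nQ [KQ DQ decQ]]].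
  have [M ME] := mixture_exists P Q half01.
  have [nM decM _] := mixture_decomposition half01 ME decP decQ.
  exists M, nM; split => //; first exact: Kmid ME.
  apply: le_trans (fdivergence_convex hf half01 ME muH (KH _ KP) (KH _ KQ)) _.
  move: DP DQ (fdivergence_ge0 rho mu hf P) (fdivergence_ge0 rho mu hf Q).
  move: Ifin; case: (I) => [i| |] // _; rewrite -EFinD.
  case: (D P) => [p| |] //; case: (D Q) => [q| |] //.
  rewrite -!EFinM -EFinD !lee_fin; move: (n.+1%:R^-1)%R => e; lra.
have [u [theta [Cu mth th0 uth]]] := midpoint_closed_ae_cvg C0 Cdecr CP Cmid.
have uP k : measurable_fun setT (u k) by have [] := CP _ _ (Cu k).
have u0 k x : (0 <= u k x)%R by have [] := CP _ _ (Cu k).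
have moment (g : R -> R) : measurable_fun [set: T] g -> (forall x, (0 <= g x)%R) ->
    forall b : \bar R, (forall nu, K nu -> \int[nu]_x (g x)%:E <= b) ->
    \int[mu]_x ((g x)%:E * (theta x)%:E) <= b.
  move=> mg g0 b hb.
  apply: (fatou_ae (g := fun n (x : T) => (g x)%:E * (u n x)%:E)).
  - by move=> n; apply: emeasurable_funM; exact/measurable_EFinP.
  - by move=> n x; rewrite mule_ge0// lee_fin.
  - by apply: emeasurable_funM; exact/measurable_EFinP.
  - by move=> x; rewrite mule_ge0// lee_fin.
  - by apply: filterS uth => x ux; exact: cvg_mule_limn_einf.
  move=> n; have [nu [nuperp [Knu _ [_ _ _ nuE]]]] := Cu n.
  apply: (@le_trans _ _ b); last by rewrite leeDl// lee_fin invr_ge0.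
  apply: le_trans (hb _ Knu).
  rewrite (integral_lebesgue_decomposition (uP n) (u0 n) nuE); last 2 first.
  - exact/measurable_EFinP.
  - by move=> x; rewrite lee_fin.
  by rewrite leeDl//; apply: integral_ge0 => x _; rewrite lee_fin.
have th_le1 : \int[mu]_x (theta x)%:E <= 1.
  have := moment (cst 1%R) (measurable_cst _) (fun _ => ler01) 1.
  under eq_integral do rewrite mul1e; apply => nu _.
  by rewrite (integral_cst_probability nu 1).
have th_ge0 : 0 <= \int[mu]_x (theta x)%:E by apply: integral_ge0 => x _; rewrite lee_fin.
have th_fin : \int[mu]_x (theta x)%:E \is a fin_num.
  by rewrite ge0_fin_numE// (le_lt_trans th_le1)// ltry.
pose s := fine (\int[mu]_x (theta x)%:E).
have sE : \int[mu]_x (theta x)%:E = s%:E by rewrite fineK.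
have s0 : (0 <= s)%R by rewrite -lee_fin -sE.
have s1 : (0 <= 1 - s)%R by rewrite subr_ge0 -lee_fin -sE.
pose i := fine I.
have iE : I = i%:E by rewrite fineK.
have mF (a : T -> R) : measurable_fun setT a -> measurable_fun setT (fun x => F (a x)).
  by move=> ma; exact: measurable_extend_comp.
have F0 (a : T -> R) x : 0 <= F (a x) by exact: extend_ge0.
(* Fatou's lemma for [G = F - (L * y + be)], which is nonnegative. As the integral
   of [L * u n] is L times 1 minus the singular mass, and that singular mass costs
   at least L per unit, the bound obtained for theta charges L per unit of the
   mass 1 - s that escapes. *)
have slope L : (0 <= L)%R -> L = 0%R \/ L%:E < recession f ->
    \int[mu]_x F (theta x) + (L * (1 - s))%:E <= i%:E.
  move=> L0 Lrec.
  have [be hbe be0] : exists2 be, affine_minorant f L be & (be <= 0)%R.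
    case: Lrec => [->|Lrec]; first by exists 0%R => //; exact: affine_minorant0.
    exact: lt_recession_minorant.
  have Lle : L%:E <= recession f by exact: slope_le_recession hbe.
  pose G y := F y - (L * y + be)%:E.
  have G0 y : (0 <= y)%R -> 0 <= G y.
    by move=> y0; rewrite /G sube_ge0 ?orbT//; exact: extend_minorant.
  have mG (a : T -> R) : measurable_fun setT a -> measurable_fun setT (fun x => G (a x)).
    move=> ma; apply: emeasurable_funB; first exact: mF.
    by apply/measurable_EFinP; apply: measurable_funD => //; exact: measurable_funM.
  have intG (a : T -> R) : measurable_fun setT a -> (forall x, (0 <= a x)%R) ->
      \int[mu]_x G (a x) + L%:E * \int[mu]_x (a x)%:E = \int[mu]_x F (a x) + (- be)%:E.
    move=> ma a0.
    have ma' : measurable_fun setT (fun x => (a x)%:E) by exact/measurable_EFinP.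
    rewrite -ge0_integralZl//; last by move=> x _; rewrite lee_fin.
    rewrite -[X in _ = _ + X](integral_cst_probability mu).
    rewrite -ge0_integralD//; last 4 first.
    - by move=> x _; exact: G0.
    - exact: mG.
    - by move=> x _; rewrite mule_ge0// lee_fin.
    - exact: measurable_funeM.
    rewrite -ge0_integralD//; last 2 first.
    - exact: mF.
    - by move=> x _; rewrite lee_fin oppr_ge0.
    apply: eq_integral => x _; rewrite /G.
    have := F0 a x; case: (F (a x)) => [y| |] // _.
    by rewrite -EFinM -!EFinD; congr EFin; lra.
  have intGle : \int[mu]_x G (theta x) <= (i - be - L)%:E.
    apply: (fatou_ae (g := fun n (x : T) => G (u n x))).
    - by move=> n; exact: mG.
    - by move=> n x; exact: G0.
    - exact: mG.
    - by move=> x; exact: G0.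
    - by apply: filterS uth => x ux; exact: extend_sub_affine_lsc.
    move=> n; have [nu [nuperp [Knu Dnu dec]]] := Cu n.
    have := intG _ (uP n) (u0 n).
    move: Dnu; rewrite (fdivergenceE hf muH (KH _ Knu) dec) iE -EFinD.
    have /esym := lebesgue_decomposition_total dec.
    have : 0 <= nuperp setT by exact: measure_ge0.
    have : 0 <= \int[mu]_x (u n x)%:E by apply: integral_ge0 => x _; rewrite lee_fin.
    have : 0 <= \int[mu]_x F (u n x) by exact: integral_ge0.
    have : 0 <= \int[mu]_x G (u n x) by apply: integral_ge0 => x _; exact: G0.
    move: (\int[mu]_x G (u n x)) (\int[mu]_x F (u n x)).
    move: (\int[mu]_x (u n x)%:E) (nuperp setT).
    move=> [z| |] // [w| |] // [x| |] // [y| |] //; rewrite ?lee_fin => x0' y0 z0 w0.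
    + move=> [zw] Dle; rewrite -!EFinM -!EFinD => -[e].
      have : (L * w)%:E <= recession f * w%:E.
        by rewrite EFinM; apply: lee_wpmul2r; rewrite ?lee_fin.
      move: Dle; case: (recession f * w%:E) => [v| |] //; rewrite -?EFinD ?lee_fin//.
      move: (n.+1%:R^-1)%R => c; nra.
    + move=> _ Dle; have : 0 <= recession f * w%:E.
        by rewrite mule_ge0 ?lee_fin//; exact: recession_ge0.
      by move: Dle; case: (recession f * w%:E).
  have := intG _ mth th0; rewrite sE.
  have : 0 <= \int[mu]_x F (theta x) by exact: integral_ge0.
  have : 0 <= \int[mu]_x G (theta x) by apply: integral_ge0 => x _; exact: G0.
  move: intGle; move: (\int[mu]_x G (theta x)) (\int[mu]_x F (theta x)) => [x| |] // [y| |] //.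
  rewrite -EFinM -!EFinD !lee_fin => h _ _ [e]; lra.
have IF0 : 0 <= \int[mu]_x F (theta x) by exact: integral_ge0.
have [q0 Fle] := recession_sup IF0 s1 slope.
have [m mE] := density_measure_exists mu mth th0.
pose la := mscale (NngNum s1) (@dirac _ T x0 R).
have laE A : la A = (1 - s)%:E * @dirac _ T x0 R A by [].
have m1 : measure_add m la setT = 1.
  apply: etrans (measure_addE _ _ _) _.
  rewrite mE sE [X in _ + X](laE setT) diracT mule1 -EFinD; congr EFin; lra.
have [nuhat nuhatP] := probability_of_measure m1.
have nuhatE A : measurable A -> nuhat A = \int[mu]_(x in A) (theta x)%:E + la A.
  by move=> mA; rewrite nuhatP -mE; exact: measure_addE.
have nuhat_moment :
    inherits_moment_bounds (fun h => h x0 = 0%R \/ recession f = +oo) K nuhat.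
  move=> g mg g0 gx0 b hb.
  rewrite (integral_lebesgue_decomposition mth th0 nuhatE); last 2 first.
  - exact/measurable_EFinP.
  - by move=> x; rewrite lee_fin.
  rewrite [X in _ + X](_ : _ = 0) ?adde0; first exact: moment.
  rewrite ge0_integral_mscale//; last 2 first.
  - exact/measurable_EFinP.
  - by move=> x _; rewrite lee_fin.
  rewrite integral_dirac//; last exact/measurable_EFinP.
  by rewrite diracT mul1e /=; case: gx0 => [->|/q0 ->]; rewrite ?mule0 ?mul0e.
exists nuhat; split => //.
  apply: (full_mass_closed (measurable_halfline rho) Hx0 KH) => h mh h0 hx0.
  by apply: nuhat_moment => //; left.
move=> nu Knu; apply: le_trans (IleD _ Knu); rewrite iE.
apply: le_trans Fle.
have -> : (1 - s)%:E = la setT by rewrite laE diracT mule1.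
exact: fdivergence_le nuhatE.
Qed.

End relaxed_minimizer.

(** * Consequences of strict convexity *)

Section strict_convexity.
Context {R : realType}.
Local Notation T := (measurableTypeR R).
Local Notation prob := (probability T R).
Local Open Scope ereal_scope.
Variables (rho : \bar R) (f : R -> R) (mu : prob).
Hypotheses (hf : divergence_function f) (muH : mu (halfline rho) = 1).
Local Notation D := (fdivergence rho f mu).
Local Notation H := (halfline rho : set T).
Local Notation F := (extend f).
Local Notation strict := (strictly_convex_function (`]0, +oo[%classic)%R f).

Let half01 : (0 <= (2^-1 : R) <= 1)%R.
Proof. by apply/andP; split; lra. Qed.

(** The midpoint cannot have a smaller divergence, so the convexity inequality
    between the three densities is an equality almost everywhere. *)
Lemma density_unique_of_midpoint (P Q M : prob) (thP thQ : T -> R)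
    (nP nQ : {measure set T -> \bar R}) : strict ->
  P H = 1 -> Q H = 1 ->
  lebesgue_decomposition mu P thP nP -> lebesgue_decomposition mu Q thQ nQ ->
  (forall A, M A = 2^-1%:E * P A + (1 - 2^-1)%:E * Q A) ->
  D P < +oo -> D Q = D P -> D P <= D M ->
  {ae mu, forall x, thP x = thQ x}.
Proof.
move=> sf PH QH decP decQ ME Poo QP PM.
have [nM decM nME] := mixture_decomposition half01 ME decP decQ.
have MH : M H = 1 by rewrite ME PH QH !mule1 -EFinD; congr EFin; lra.
have [mtP tP0 _ _] := decP; have [mtQ tQ0 _ _] := decQ; have [mtM tM0 _ _] := decM.
pose thM (x : T) := (2^-1 * thP x + (1 - 2^-1) * thQ x)%R.
pose h x := 2^-1%:E * F (thP x) + 2^-1%:E * F (thQ x).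
have mF (c : T -> R) : measurable_fun setT c -> measurable_fun setT (fun x => F (c x)).
  by move=> mc; exact: measurable_extend_comp.
have F0 (c : T -> R) x : 0 <= F (c x) by exact: extend_ge0.
have half_ge0 : (0 <= (2^-1 : R))%R by lra.
have mh : measurable_fun setT h.
  by apply: emeasurable_funD; apply: measurable_funeM; exact: mF.
have hE : \int[mu]_x h x = 2^-1%:E * \int[mu]_x F (thP x) + 2^-1%:E * \int[mu]_x F (thQ x).
  rewrite /h ge0_integralD//; last 4 first.
  - by move=> x _; rewrite mule_ge0.
  - by apply: measurable_funeM; exact: mF.
  - by move=> x _; rewrite mule_ge0.
  - by apply: measurable_funeM; exact: mF.
  by rewrite !ge0_integralZl//; exact: mF.
have Fle x : F (thM x) <= h x.
  have := extend_convex hf (tP0 x) (tQ0 x) half01.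
  by rewrite -/(thM x) (_ : (1 - 2^-1 : R)%R = 2^-1%R)//; lra.
have intM0 : 0 <= \int[mu]_x F (thM x) by exact: integral_ge0.
have key : \int[mu]_x h x < +oo /\ \int[mu]_x h x <= \int[mu]_x F (thM x).
  move: Poo QP PM; rewrite (fdivergenceE hf muH PH decP) (fdivergenceE hf muH QH decQ).
  rewrite (fdivergenceE hf muH MH decM) hE nME -/(thM _).
  rewrite ge0_muleDr ?mule_ge0 ?lee_fin//; last lra.
  rewrite (muleCA (recession f) 2^-1%:E) (muleCA (recession f) (1 - 2^-1)%:E).
  have rec0 := recession_ge0 hf.
  have iP0 : 0 <= \int[mu]_x F (thP x) by exact: integral_ge0.
  have iQ0 : 0 <= \int[mu]_x F (thQ x) by exact: integral_ge0.
  have rP0 : 0 <= recession f * nP setT by rewrite mule_ge0.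
  have rQ0 : 0 <= recession f * nQ setT by rewrite mule_ge0.
  move: intM0 iP0 iQ0 rP0 rQ0.
  move: (\int[mu]_x F (thM x)) (\int[mu]_x F (thP x)) (\int[mu]_x F (thQ x)).
  move: (recession f * nP setT) (recession f * nQ setT).
  move=> [p| |] // [q| |] // [z| |] // [x| |] // [y| |] //; rewrite -!EFinM -!EFinD ?ltry ?leey//.
  rewrite !lee_fin => _ _ _ _ _ _ [e]; lra.
have [hoo hM] := key.
have := ge0_integral_le_ae_eq (mF _ mtM) mh (F0 _) Fle hoo hM.
apply: filterS => x Fh.
have [//|xy] := eqVneq (thP x) (thQ x).
have midE : thM x = ((thP x + thQ x) / 2)%R by rewrite /thM; lra.
have : F (thM x) < h x.
  rewrite midE; have [lt|lt|/eqP] := ltgtP (thP x) (thQ x); last by rewrite (negbTE xy).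
    exact: extend_midpoint_lt.
  by rewrite addrC /h addeC; exact: extend_midpoint_lt.
by rewrite -Fh ltxx.
Qed.

Lemma lebesgue_decomposition_self : lebesgue_decomposition mu mu (cst 1%R) mzero.
Proof.
split => //; first by exists set0; rewrite measure0.
by move=> A mA; rewrite -[LHS]mul1e -integral_cst// adde0.
Qed.

(** The singular parts are atoms at x0, and their masses agree because all total
    masses are 1. *)
Lemma eq_prob_of_density (P Q : prob) (thP thQ : T -> R)
    (nP nQ : {measure set T -> \bar R}) (x0 : R) :
  lebesgue_decomposition mu P thP nP -> lebesgue_decomposition mu Q thQ nQ ->
  {ae mu, forall x, thP x = thQ x} ->
  nP (~` [set x0]) = 0 -> nQ (~` [set x0]) = 0 ->
  forall A : set T, measurable A -> P A = Q A.
Proof.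
move=> decP decQ thPQ nP0 nQ0 A mA.
have [mtP tP0 _ PE] := decP; have [mtQ tQ0 _ QE] := decQ.
have intE B : measurable B -> \int[mu]_(x in B) (thP x)%:E = \int[mu]_(x in B) (thQ x)%:E.
  move=> mB; apply: ge0_ae_eq_integral => //.
  - exact/measurable_EFinP/measurable_funTS.
  - exact/measurable_EFinP/measurable_funTS.
  - by move=> x _; rewrite lee_fin.
  - by move=> x _; rewrite lee_fin.
  - by move: thPQ; apply: filterS => x -> _.
have nPQ : nP setT = nQ setT.
  have := lebesgue_decomposition_total decQ; have := lebesgue_decomposition_total decP.
  rewrite intE//.
  have : 0 <= nP setT by exact: measure_ge0.
  have : 0 <= nQ setT by exact: measure_ge0.
  have : 0 <= \int[mu]_x (thQ x)%:E by apply: integral_ge0 => x _; rewrite lee_fin.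
  move: (nP setT) (nQ setT) (\int[mu]_x (thQ x)%:E).
  move=> [p| |] // [q| |] // [z| |] //; rewrite -!EFinD => _ _ _ [e1] [e2].
  by congr EFin; lra.
have m1 : measurable (~` [set x0] : set T) by apply: measurableC.
have conc (n : {measure set T -> \bar R}) (B : set T) : n (~` [set x0]) = 0 ->
    measurable B -> n B = if x0 \in B then n setT else 0.
  move=> n0 mB; case: ifPn => xB; last first.
    apply: (subset_measure0 _ _ _ n0) => // x Bx /= xx0.
    by move/negP: xB; apply; rewrite -xx0; exact/mem_set.
  apply: le_anti; rewrite le_measure ?inE//=.
  have nC : n (~` B) = 0.
    apply: (subset_measure0 _ _ _ n0) => //; first exact: measurableC.
    by move=> x Bx /= xx0; apply: Bx; rewrite xx0; exact: set_mem.
  have : n (B `|` ~` B) <= n B + n (~` B) by apply: measureU2 => //; exact: measurableC.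
  by rewrite setUCr nC adde0.
by rewrite PE// QE// intE// (conc nP)// (conc nQ)// nPQ.
Qed.

(** mu also has divergence 0, the least possible value, and has density 1. *)
Lemma fdivergence_eq0 (nu : prob) : strict -> nu H = 1 -> D nu = 0 ->
  forall A : set T, measurable A -> nu A = mu A.
Proof.
move=> sf nuH Dnu.
have [th [n dec]] := has_lebesgue_decomposition mu nu.
have [M ME] := mixture_exists nu mu half01.
have [mt t0 _ nuE] := dec.
have ae1 : {ae mu, forall x, th x = cst 1%R x}.
  apply: (density_unique_of_midpoint sf nuH muH dec lebesgue_decomposition_self ME).
  - by rewrite Dnu ltry.
  - by rewrite Dnu fdivergence_self.
  - by rewrite Dnu; exact: fdivergence_ge0.
have n0 : n setT = 0.
  have := lebesgue_decomposition_total dec.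
  have -> : \int[mu]_x (th x)%:E = \int[mu]_x 1%:E.
    apply: ge0_ae_eq_integral => //; first exact/measurable_EFinP.
      by move=> x _; rewrite lee_fin.
    by move: ae1; apply: filterS => x -> _.
  rewrite (integral_cst_probability mu 1).
  have : 0 <= n setT by exact: measure_ge0.
  by move: (n setT) => [p| |] //; rewrite -EFinD => _ [e]; congr EFin; lra.
apply: (eq_prob_of_density (x0 := 0%R) dec lebesgue_decomposition_self ae1) => //.
by apply: (subset_measure0 _ _ _ n0) => //; exact: measurableC.
Qed.

(** [D nu <= D M <= t * D P <= t * D nu] with t < 1 forces [D nu = 0]. *)
Lemma minimizer_eq_mu (nu P M : prob) (t : R) : strict ->
  nu H = 1 -> P H = 1 -> D nu < +oo -> (0 <= t < 1)%R ->
  (forall A, M A = t%:E * P A + (1 - t)%:E * mu A) ->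
  D P <= D nu -> D nu <= D M ->
  forall A : set T, measurable A -> nu A = mu A.
Proof.
move=> sf nuH PH nuoo /andP[t0 t1] ME Pnu nuM; apply: fdivergence_eq0 => //.
have t01 : (0 <= t <= 1)%R by rewrite t0 ltW.
have := fdivergence_convex hf t01 ME muH PH muH.
rewrite fdivergence_self// mule0 adde0.
move: nuoo Pnu nuM (fdivergence_ge0 rho mu hf nu) (fdivergence_ge0 rho mu hf P).
move: (D nu) (D P) (D M) => [d| |] // [p| |] // [m| |] //.
rewrite -EFinM !lee_fin => _ h1 h2 h3 h4 h5; congr EFin.
by apply/eqP; rewrite eq_le h3 andbT; nra.
Qed.

(** The divergence depends on the singular part only through its mass, so moving
    all of it to an atom at x0 does not increase the divergence; it can decrease
    it, if mu charges x0. *)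
Lemma sweep_singular_part (nu : prob) (theta : T -> R)
    (nuperp : {measure set T -> \bar R}) (x0 : R) :
  nu H = 1 -> lebesgue_decomposition mu nu theta nuperp ->
  exists nu' : prob, D nu' <= D nu /\
    forall g : R -> R, measurable_fun [set: T] g -> (forall x, (0 <= g x)%R) ->
      g x0 = 0%R ->
      \int[nu']_x (g x)%:E + \int[nuperp]_x (g x)%:E = \int[nu]_x (g x)%:E.
Proof.
move=> nuH dec; have [mt t0 _ nuE] := dec.
have dec1 := lebesgue_decomposition_total dec.
have n0 : 0 <= nuperp setT by exact: measure_ge0.
have nfin : nuperp setT \is a fin_num.
  rewrite ge0_fin_numE//; apply: (@le_lt_trans _ _ 1); last by rewrite ltry.
  by rewrite -dec1 leeDr//; apply: integral_ge0 => x _; rewrite lee_fin.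
pose q := fine (nuperp setT).
have q0 : (0 <= q)%R by rewrite fine_ge0.
have [m mE] := density_measure_exists mu mt t0.
pose la := mscale (NngNum q0) (@dirac _ T x0 R).
have laT : la setT = nuperp setT.
  by rewrite [LHS](_ : _ = q%:E * @dirac _ T x0 R setT)// diracT mule1 fineK.
have m1 : measure_add m la setT = 1.
  by apply: etrans (measure_addE _ _ _) _; rewrite mE [X in _ + X]laT.
have [nu' nu'P] := probability_of_measure m1.
have nu'E A : measurable A -> nu' A = \int[mu]_(x in A) (theta x)%:E + la A.
  by move=> mA; rewrite nu'P -mE; exact: measure_addE.
exists nu'; split.
  by rewrite (fdivergenceE hf muH nuH dec) -laT; exact: fdivergence_le nu'E.
move=> g mg g0 gx0.
have mg' : measurable_fun setT (fun x : T => (g x)%:E) by exact/measurable_EFinP.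
have g0' (x : T) : 0 <= (g x)%:E by rewrite lee_fin.
rewrite (integral_lebesgue_decomposition mt t0 nu'E)//.
rewrite (integral_lebesgue_decomposition mt t0 nuE)//.
congr (_ + _); rewrite [X in _ + X](_ : _ = 0) ?adde0//.
rewrite ge0_integral_mscale// integral_dirac//.
by rewrite diracT mul1e gx0 mule0.
Qed.

End strict_convexity.

(** * Minimization under a moment constraint *)

Lemma minimizerP {R : realType} (D : probability (measurableTypeR R) R -> \bar R)
    (K : set (probability (measurableTypeR R) R)) nu :
  minimizer D K nu <-> K nu /\ forall nu', K nu' -> (D nu <= D nu')%E.
Proof.
split=> [[Knu Dnu]|[Knu Dnu]]; split => //.
  by move=> nu' Knu'; rewrite Dnu; apply: ereal_inf_lbound; exists nu'.
apply: le_anti; rewrite ereal_inf_lbound ?andbT; last by exists nu.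
by apply: le_ereal_inf_tmp => _ [nu' Knu' <-]; exact: Dnu.
Qed.

Lemma measurable_zeros_off {R : realType} (g : R -> R) (x0 : R) :
  measurable_fun [set: measurableTypeR R] g ->
  measurable [set x : measurableTypeR R | x != x0 /\ g x = 0].
Proof.
move=> mg; rewrite (_ : [set _ | _] = ~` [set x0] `&` g @^-1` [set 0]); last first.
  by rewrite eqEsubset; split=> x [/eqP].
apply: measurableI; first by apply: measurableC; exact: measurable_set1.
by rewrite -[X in measurable X]setTI; apply: mg => //; exact: measurable_set1.
Qed.

(** The problems with mean zero share the following form. W is a set of measures
    that is stable under mixtures and under moving mass to x0; the moment of a
    nonnegative function g that vanishes at x0 is prescribed, equal to b or at
    most b; and mu lies in W but has a moment larger than b. *)
Section moment_problem.
Context {R : realType}.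
Local Notation T := (measurableTypeR R).
Local Notation prob := (probability T R).
Local Open Scope ereal_scope.
Variables (rho : \bar R) (f : R -> R) (mu : prob).
Hypotheses (hf : divergence_function f) (muH : mu (halfline rho) = 1).
Local Notation D := (fdivergence rho f mu).
Local Notation H := (halfline rho : set T).
Local Notation strict := (strictly_convex_function (`]0, +oo[%classic)%R f).

Variables (W : set prob) (g : R -> R) (b x0 : R).
Hypotheses (mg : measurable_fun [set: T] g) (g0 : forall x, (0 <= g x)%R).
Hypotheses (gx0 : g x0 = 0%R) (Hx0 : H x0).
Hypothesis WH : forall nu, W nu -> nu H = 1.
Hypothesis Wmix : forall (t : R) (P Q M : prob), (0 <= t <= 1)%R ->
  (forall A, M A = t%:E * P A + (1 - t)%:E * Q A) -> W P -> W Q -> W M.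
Hypothesis Wclosed : forall (K : set prob) (nu' : prob), K `<=` W ->
  inherits_moment_bounds (fun h => h x0 = 0%R) K nu' -> W nu'.
Hypotheses (Wmu : W mu) (mub : b%:E < \int[mu]_x (g x)%:E)
  (muoo : \int[mu]_x (g x)%:E < +oo).

Definition relaxed_constraint : set prob :=
  [set nu | W nu /\ \int[nu]_x (g x)%:E <= b%:E].
Definition tight_constraint : set prob :=
  [set nu | W nu /\ \int[nu]_x (g x)%:E = b%:E].

Let mgE : measurable_fun [set: T] (fun x => (g x)%:E).
Proof. exact/measurable_EFinP. Qed.

Let g0E (x : T) : 0 <= (g x)%:E. Proof. by rewrite lee_fin. Qed.

Lemma tight_constraint_sub : tight_constraint `<=` relaxed_constraint.
Proof. by move=> nu [Wnu e]; split => //; rewrite e. Qed.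

Let half01 : (0 <= (2^-1 : R) <= 1)%R.
Proof. by apply/andP; split; lra. Qed.

Lemma relaxed_constraint_midpoint (P Q M : prob) :
  relaxed_constraint P -> relaxed_constraint Q ->
  (forall A, M A = 2^-1%:E * P A + (1 - 2^-1)%:E * Q A) -> relaxed_constraint M.
Proof.
move=> [WP Pb] [WQ Qb] ME; split; first exact: Wmix ME _ _.
rewrite (integral_mixture half01 ME)//.
have : 0 <= \int[P]_x (g x)%:E by exact: integral_ge0.
have : 0 <= \int[Q]_x (g x)%:E by exact: integral_ge0.
move: Pb Qb; case: (\int[P]_x _) => [p| |] //; case: (\int[Q]_x _) => [q| |] //.
by rewrite -!EFinM -EFinD !lee_fin; lra.
Qed.

(** The weight t makes the moment of the mixture equal to b. As [D mu = 0],
    convexity gives [D M <= t * D nu]. *)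
Lemma mix_to_tight nu : relaxed_constraint nu ->
  exists M (t : R), [/\ (0 <= t <= 1)%R, tight_constraint M, D M <= D nu,
    (forall A, M A = t%:E * nu A + (1 - t)%:E * mu A) &
    (\int[nu]_x (g x)%:E < b%:E -> (t < 1)%R)].
Proof.
move=> [Wnu nub].
have nu0 : 0 <= \int[nu]_x (g x)%:E by exact: integral_ge0.
have [p pE] : exists p : R, \int[nu]_x (g x)%:E = p%:E.
  by move: nub nu0; case: (\int[nu]_x _) => [p| |] //; exists p.
have [c cE] : exists c : R, \int[mu]_x (g x)%:E = c%:E.
  have : 0 <= \int[mu]_x (g x)%:E by exact: integral_ge0.
  by move: muoo; case: (\int[mu]_x _) => [c| |] //; exists c.
have pb : (p <= b)%R by rewrite -lee_fin -pE.
have bc : (b < c)%R by rewrite -lte_fin -cE.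
have cp : (0 < c - p)%R by lra.
pose t := ((c - b) / (c - p))%R.
have t0 : (0 <= t)%R by apply: divr_ge0; lra.
have t1 : (t <= 1)%R by rewrite ler_pdivrMr// mul1r; lra.
have t01 : (0 <= t <= 1)%R by rewrite t0.
have [M ME] := mixture_exists nu mu t01.
exists M, t; split => //.
- split; first exact: Wmix ME _ _.
  rewrite (integral_mixture t01 ME)// pE cE -!EFinM -EFinD /t; congr EFin; field.
  by rewrite gt_eqF.
- apply: (le_trans (fdivergence_convex hf t01 ME muH (WH Wnu) muH)).
  rewrite fdivergence_self// mule0 adde0 -[leRHS]mul1e.
  by apply: lee_wpmul2r; rewrite ?lee_fin//; exact: fdivergence_ge0.
- by rewrite pE lte_fin => pb'; rewrite ltr_pdivrMr// mul1r; lra.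
Qed.

Lemma tight_minimizer_relaxed nu :
  minimizer D tight_constraint nu -> minimizer D relaxed_constraint nu.
Proof.
move=> /minimizerP[Knu Dnu]; apply/minimizerP; split.
  exact: tight_constraint_sub.
move=> nu' /mix_to_tight[M [t [_ KM DM _ _]]].
exact: le_trans (Dnu _ KM) DM.
Qed.

(** The relaxed constraint is inherited by the measure that [relaxed_minimizer]
    provides, because g vanishes at x0; mixing with mu makes it tight at no cost. *)
Lemma tight_minimizer_exists : has_finite_value D relaxed_constraint ->
  has_minimizer D tight_constraint.
Proof.
move=> fin.
have [nu [_ Dnu nuP]] := relaxed_minimizer hf muH
  (fun nu Knu => WH (proj1 Knu)) Hx0 relaxed_constraint_midpoint fin.
have Knu : relaxed_constraint nu.
  split; last by apply: nuP => //; [left|move=> nu' []].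
  apply: (Wclosed (K := relaxed_constraint)) => [nu' []//|h mh h0 hx0 c hc].
  by apply: nuP => //; left.
have [M [t [_ KM DM _ _]]] := mix_to_tight Knu.
exists M; apply/minimizerP; split => // nu' Knu'.
by apply: (le_trans DM); apply: Dnu; exact: tight_constraint_sub.
Qed.

(** Otherwise sweeping the singular part of nu to x0 would lower the moment
    strictly below b, since g is positive off x0 up to null sets. There would be
    room for mixing the swept measure with mu with a weight t < 1, and
    [minimizer_eq_mu] would give [nu = mu], whose moment exceeds b. *)
Lemma minimizer_singular_part nu theta nuperp : strict ->
  (forall nu, W nu -> nu [set x | x != x0 /\ g x = 0%R] = 0) ->
  minimizer D relaxed_constraint nu -> D nu < +oo ->
  lebesgue_decomposition mu nu theta nuperp ->
  nuperp (~` [set x0]) = 0.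
Proof.
move=> sf gsep /minimizerP[[Wnu nub] nuD] nuoo dec.
have [nu' [Dnu' nu'E]] := sweep_singular_part hf muH x0 (WH Wnu) dec.
have nu'le (h : R -> R) : measurable_fun [set: T] h -> (forall x, (0 <= h x)%R) ->
    h x0 = 0%R -> \int[nu']_x (h x)%:E <= \int[nu]_x (h x)%:E.
  move=> mh h0 hx0; rewrite -nu'E// leeDl//; apply: integral_ge0 => x _.
  by rewrite lee_fin.
have Wnu' : W nu'.
  apply: (Wclosed (K := [set nu])) => [_ -> //|h mh h0 hx0 c /(_ nu erefl)].
  exact/le_trans/nu'le.
have Knu' : relaxed_constraint nu'.
  by split => //; apply: le_trans nub; exact: nu'le.
have nu'b : b%:E <= \int[nu']_x (g x)%:E.
  rewrite leNgt; apply/negP => nu'b.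
  have [M [t [/andP[t0 _] KM _ ME /(_ nu'b) t1]]] := mix_to_tight Knu'.
  have t01 : (0 <= t < 1)%R by rewrite t0.
  have numu := minimizer_eq_mu hf muH sf (WH Wnu) (WH Wnu') nuoo t01 ME Dnu'
    (nuD _ (tight_constraint_sub KM)).
  have : \int[mu]_x (g x)%:E = \int[nu]_x (g x)%:E.
    by apply: eq_measure_integral => A mA _; exact/esym/numu.
  by move=> e; move: mub; rewrite e ltNge nub.
have ng : \int[nuperp]_x (g x)%:E = 0.
  have := nu'E g mg g0 gx0.
  have : 0 <= \int[nuperp]_x (g x)%:E by exact: integral_ge0.
  have : 0 <= \int[nu]_x (g x)%:E by exact: integral_ge0.
  move: nub nu'b (nu'le g mg g0 gx0).
  case: (\int[nu]_x _) => [q| |] //; case: (\int[nu']_x _) => [p| |] //.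
  case: (\int[nuperp]_x _) => [r| |] //; rewrite -EFinD !lee_fin => h1 h2 _ _ h3 [e].
  by congr EFin; lra.
have [N [mN N0 gN]] : {ae nuperp, forall x, (g x)%:E = 0}.
  have : ae_eq nuperp setT (EFin \o g) (cst 0).
    apply/(ae_eq_integral_abs _ measurableT); first exact/measurable_EFinP.
    by rewrite -ng; apply: eq_integral => x _; rewrite /= ger0_norm.
  by apply: filterS => x /(_ I).
pose Z := [set x : T | x != x0 /\ g x = 0%R].
have mZ : measurable Z by exact: measurable_zeros_off.
have nZ : nuperp Z = 0.
  apply: le_anti; rewrite measure_ge0 andbT -(gsep _ Wnu).
  have [_ _ _ ->] // := dec.
  by rewrite leeDr//; apply: integral_ge0 => x _; have [_ t0 _ _] := dec; rewrite lee_fin.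
have NZ0 : nuperp (N `|` Z) = 0 by exact: null_set_setU.
apply: (subset_measure0 _ _ _ NZ0).
- by apply: measurableC; exact: measurable_set1.
- exact: measurableU.
move=> x /= /eqP xx0; have [gx|gx] := eqVneq (g x) 0%R; first by right.
by left; apply: gN => /= -[gx']; move: gx; rewrite gx' eqxx.
Qed.

Lemma relaxed_minimizer_unique : strict ->
  (forall nu, W nu -> nu [set x | x != x0 /\ g x = 0%R] = 0) ->
  has_finite_value D relaxed_constraint ->
  unique_minimizer D relaxed_constraint.
Proof.
move=> sf gsep [nu0 [Knu0 nu0oo]] P Q minP minQ.
have [KP leP] := (minimizerP _ _ _).1 minP; have [KQ leQ] := (minimizerP _ _ _).1 minQ.
have Poo : D P < +oo by apply: le_lt_trans nu0oo; exact: leP.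
have QP : D Q = D P by apply: le_anti; rewrite leQ// leP.
have [thP [nP decP]] := has_lebesgue_decomposition mu P.
have [thQ [nQ decQ]] := has_lebesgue_decomposition mu Q.
have [M ME] := mixture_exists P Q half01.
have KM : relaxed_constraint M by exact: relaxed_constraint_midpoint ME.
have thPQ := density_unique_of_midpoint hf muH sf (WH (proj1 KP)) (WH (proj1 KQ))
  decP decQ ME Poo QP (leP _ KM).
apply: (eq_prob_of_density decP decQ thPQ (x0 := x0)).
  exact: minimizer_singular_part minP Poo decP.
by apply: minimizer_singular_part minQ _ decQ => //; rewrite QP.
Qed.

End moment_problem.

(** * Stochastic dominance on rays and tails *)

Section stochastic_dominance.
Context {R : realType}.
Local Notation T := (measurableTypeR R).
Local Notation prob := (probability T R).
Local Open Scope ereal_scope.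
Implicit Types (nu mu P Q : prob).

Lemma integral_tail nu (g : R -> R) : measurable_fun [set: T] g ->
  (forall x, (0 <= g x)%R) ->
  \int[nu]_x (g x)%:E =
  \int[lebesgue_measure]_(r in `[0%R, +oo[) nu [set x | (r < g x)%R].
Proof.
move=> mg g0.
pose X : {RV nu >-> R} := @mfun_Sub _ _ T R g (mem_set mg).
have := @ge0_expectation_ccdf _ _ _ nu X g0.
rewrite expectation_def => ->; apply: eq_integral => r _.
rewrite /ccdf /distribution /pushforward /=; congr (nu _).
by rewrite eqEsubset; split=> x /=; rewrite in_itv/= andbT.
Qed.

Lemma measurable_tail nu (g : R -> R) : measurable_fun [set: T] g ->
  measurable_fun [set: R] (fun r : R => nu [set x | (r < g x)%R]).
Proof.
move=> mg.
pose X : {RV nu >-> R} := @mfun_Sub _ _ T R g (mem_set mg).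
have := @ccdf_measurable _ _ _ nu X.
congr measurable_fun; apply/funext => r.
rewrite /ccdf /distribution /pushforward /=; congr (nu _).
by rewrite eqEsubset; split=> x /=; rewrite in_itv/= andbT.
Qed.

Lemma ray_open_bigcup (c : R) :
  \bigcup_n (`]-oo, (c - n.+1%:R^-1)%R] : set R)%classic = `]-oo, c[%classic.
Proof.
rewrite eqEsubset; split=> x /=.
  move=> [n _]; rewrite /= !in_itv/= => /le_lt_trans; apply.
  by rewrite ltrBlDr ltrDl invr_gt0.
rewrite in_itv/= => xc; have cx : (0 < c - x)%R by rewrite subr_gt0.
have [n _ /(_ _ (leqnn n)) ke] := near_infty_natSinv_lt (PosNum cx).
by exists n => //; rewrite /= in_itv/= lerBrDr -lerBrDl; exact: ltW.
Qed.

Lemma dominates_ray_open nu' nu c : dominates nu' nu ->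
  nu' `]-oo, c[%classic <= nu `]-oo, c[%classic.
Proof.
move=> dom.
pose A n := (`]-oo, (c - n.+1%:R^-1)%R] : set R)%classic.
have AE : \bigcup_n A n = `]-oo, c[%classic by exact: ray_open_bigcup.
have ndA : nondecreasing_seq A.
  move=> n m nm; apply/subsetPset => x; rewrite /A /= !in_itv/= => /le_trans; apply.
  by rewrite lerB// lef_pV2 ?posrE ?ltr0n// ler_nat.
have mA n : measurable (A n : set T) by exact: measurable_itv.
have cvgA (m : prob) : m (A n) @[n --> \oo] --> m `]-oo, c[%classic.
  by rewrite -AE; apply: nondecreasing_cvg_mu => //; rewrite AE; exact: measurable_itv.
rewrite -(cvg_lim _ (cvgA nu))// -(cvg_lim _ (cvgA nu'))//.
apply: lee_lim; [by apply/cvg_ex; eexists; exact: cvgA..|].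
by apply: nearW => n; exact: dom.
Qed.

(** A set that is closed downwards is empty, the whole line, or an open or a
    closed ray. *)
Lemma dominates_down_set nu' nu (L : set R) : dominates nu' nu ->
  (forall x y, L x -> (y <= x)%R -> L y) -> nu' L <= nu L.
Proof.
move=> dom downL.
have [->|/set0P[x0 Lx0]] := eqVneq L set0; first by rewrite !measure0.
have [ubL|nubL] := pselect (has_ubound L); last first.
  have -> : L = setT; last by rewrite !probability_setT.
  rewrite eqEsubset; split=> // x _; apply: contrapT => nLx; apply: nubL.
  exists x => y Ly; rewrite leNgt; apply/negP => xy; apply: nLx.
  exact: downL Ly (ltW xy).
have supL : has_sup L by split => //; exists x0.
have [Ls|nLs] := pselect (L (sup L)).
  have -> : L = `]-oo, (sup L)]%classic; last exact: dom.
  rewrite eqEsubset; split=> x /=; rewrite in_itv/= => xs.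
    by apply: ub_le_sup.
  exact: downL Ls xs.
have -> : L = `]-oo, (sup L)[%classic; last exact: dominates_ray_open.
rewrite eqEsubset; split=> x /=; rewrite in_itv/= => xs.
  rewrite lt_neqAle; apply/andP; split; last by apply: ub_le_sup.
  by apply/eqP => xE; apply: nLs; rewrite -xE.
have /(sup_adherent)/(_ supL) : (0 < sup L - x)%R by rewrite subr_gt0.
by rewrite subKr => -[y Ly xy]; exact: downL Ly (ltW xy).
Qed.

Lemma cdf_right_continuous_lt nu c (v : \bar R) : nu `]-oo, c]%classic < v ->
  exists2 e : R, (0 < e)%R & nu `]-oo, (c + e)%R]%classic < v.
Proof.
move=> nuv.
pose A n := (`]-oo, (c + n.+1%:R^-1)%R] : set R)%classic.
have AE : \bigcap_n A n = `]-oo, c]%classic.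
  rewrite eqEsubset; split=> x /=.
    move=> h; rewrite in_itv/= leNgt; apply/negP => cx.
    have cx' : (0 < x - c)%R by rewrite subr_gt0.
    have [n _ /(_ _ (leqnn n)) ke] := near_infty_natSinv_lt (PosNum cx').
    by have := h n I; rewrite /A /= in_itv/= -lerBlDl leNgt ke.
  move=> + n _; rewrite /A /= !in_itv/= => /le_trans; apply.
  by rewrite lerDl invr_ge0.
have niA : nonincreasing_seq A.
  move=> n m nm; apply/subsetPset => x; rewrite /A /= !in_itv/= => /le_trans; apply.
  by rewrite lerD2l lef_pV2 ?posrE ?ltr0n// ler_nat.
have mA n : measurable (A n : set T) by exact: measurable_itv.
have cvgA : nu (A n) @[n --> \oo] --> nu `]-oo, c]%classic.
  rewrite -AE; apply: nonincreasing_cvg_mu => //.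
    by rewrite (le_lt_trans (probability_le1 _ _))// ltry.
  by rewrite AE; exact: measurable_itv.
have nufin : nu `]-oo, c]%classic \is a fin_num by exact: fin_num_measure.
have : \forall n \near \oo, nu (A n) < v.
  by move: cvgA => /(_ [set y | y < v]); apply; exact: open_ereal_lt'.
move=> [n _ /(_ _ (leqnn n)) /= nuA].
by exists n.+1%:R^-1%R => //; rewrite invr_gt0.
Qed.

End stochastic_dominance.

(** * The mean as a functional of the measure *)

Section borel_display.
Context {R : realType}.
Local Notation T := (measurableTypeR R).
Local Open Scope ereal_scope.

(** Two convertible copies of the Borel sets of the line occur here: that of the
    type of real numbers itself, on which S is integrated in [Pset], and that of
    [measurableTypeR R], which carries the measures. Pushing forward along the
    identity moves the integrability of S from one to the other. *)
Lemma Pset_integrable (rho : \bar R) (S : R -> R) (nu : probability T R) :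
  Pset rho S nu <-> nu (halfline rho) = 1 /\
    (nu : {measure set T -> \bar R}).-integrable (halfline rho : set T) (EFin \o S : T -> \bar R).
Proof.
pose mid : @measurable_fun _ _ T R setT idfun := @measurable_id _ R setT.
have mH := measurable_halfline rho.
have intE : measurable_fun (halfline rho : set T) (EFin \o S : T -> \bar R) ->
    \int[nu : set R -> \bar R]_(x in halfline rho) `|(EFin \o S) x| =
    \int[(nu : {measure set T -> \bar R})]_(x in (halfline rho : set T)) `|(EFin \o S) x|.
  move=> mS.
  apply: (@ge0_integral_pushforward _ _ T R R idfun mid nu (halfline rho)
    (fun x => `|(EFin \o S) x|)) => //.
  exact: measurableT_comp.
split=> -[nuH] /integrableP[mS intS]; split => //; apply/integrableP; split => //.
- by rewrite -intE.
- by rewrite intE.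
Qed.

End borel_display.

Section scale_moments.
Context {R : realType}.
Local Notation T := (measurableTypeR R).
Local Notation prob := (probability T R).
Local Open Scope ereal_scope.
Variables (rho : \bar R) (S : R -> R) (r0 : R).
Local Notation H := (halfline rho : set T).
Hypotheses (r0_gt0 : (0 < r0)%R) (Hr0 : H r0).
Hypothesis Smono : forall x y, H x -> H y -> (x < y)%R -> (S x < S y)%R.
Hypothesis mS : measurable_fun H S.
Implicit Types (nu P Q : prob).

Lemma halfline_down x y : (0 <= y)%R -> (y <= x)%R -> H x -> H y.
Proof.
by move=> y0 yx [x0 xrho]; split => //; apply: le_lt_trans xrho; rewrite lee_fin.
Qed.

Let H0 : H 0%R. Proof. exact: halfline_down (ltW r0_gt0) Hr0. Qed.

Let mH := @measurable_halfline R rho.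

Lemma S_le x y : H x -> H y -> (x <= y)%R -> (S x <= S y)%R.
Proof.
by move=> Hx Hy; rewrite le_eqVlt => /predU1P[->//|xy]; exact/ltW/Smono.
Qed.

(** Nonnegative, and zero in the half-line only at 0: through it, upper bounds on
    the mean become upper bounds on the integral of a nonnegative function. *)
Definition lower_excess : R -> R := ((fun x => S x - S 0) \_ H)%R.

Lemma lower_excessE x : H x -> lower_excess x = (S x - S 0)%R.
Proof. by move=> Hx; rewrite /lower_excess patchE mem_set. Qed.

Lemma measurable_lower_excess : measurable_fun [set: T] lower_excess.
Proof.
by apply/(measurable_restrictT _ mH); apply: measurable_funB => //.
Qed.

Lemma lower_excess_ge0 x : (0 <= lower_excess x)%R.
Proof.
rewrite /lower_excess patchE; case: ifPn => // /set_mem Hx.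
by rewrite subr_ge0; apply: S_le => //; case: Hx.
Qed.

Lemma lower_excess0 : lower_excess 0 = 0%R.
Proof. by rewrite lower_excessE// subrr. Qed.

Lemma lower_excess_gt0 x : H x -> x != 0%R -> (0 < lower_excess x)%R.
Proof.
move=> Hx x0; rewrite lower_excessE// subr_gt0; apply: Smono => //.
by rewrite lt_neqAle eq_sym x0; case: Hx.
Qed.

Let integral_lower_excess nu :
  \int[nu]_x (lower_excess x)%:E = \int[nu]_(x in H) (S x - S 0)%:E.
Proof.
rewrite [RHS]integral_mkcond; apply: eq_integral => x _.
by rewrite /lower_excess !patchE; case: ifP.
Qed.

Let integrable_cst nu (c : R) : @integrable _ T R nu H (cst c%:E).
Proof. exact: finite_measure_integrable_cst. Qed.

Lemma PsetP nu : nu H = 1 ->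
  Pset rho S nu <-> \int[nu]_x (lower_excess x)%:E < +oo.
Proof.
move=> nuH; rewrite Pset_integrable integral_lower_excess.
have intc := integrable_cst nu (S 0).
have intE : @integrable _ T R nu H (EFin \o (fun x => S x - S 0)%R) <->
    \int[nu]_(x in H) (S x - S 0)%:E < +oo.
  have absE : \int[nu]_(x in H) `|(EFin \o (fun x => S x - S 0)%R) x| =
      \int[nu]_(x in H) (S x - S 0)%:E.
    apply: eq_integral => x /set_mem Hx; rewrite /= ger0_norm//.
    by rewrite -lower_excessE// lower_excess_ge0.
  split; first by move=> /integrableP[_]; rewrite absE.
  move=> oo; apply/integrableP; rewrite absE; split => //.
  by apply/measurable_EFinP; exact: measurable_funB.
rewrite -intE; split => [[_ intS]|intS].
  have := integrableB mH intS intc.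
  by rewrite (_ : _ \- _ = EFin \o (fun x => S x - S 0)%R)//; exact/funext.
split => //; have := integrableD mH intS intc.
rewrite (_ : _ \+ _ = EFin \o S)//.
by apply/funext => x /=; rewrite -EFinD subrK.
Qed.

Lemma integral_lower_excessE nu : Pset rho S nu ->
  \int[nu]_x (lower_excess x)%:E = (mean rho S nu - S 0)%:E.
Proof.
move=> /Pset_integrable[nuH intS]; rewrite integral_lower_excess.
have intc := integrable_cst nu (S 0).
under eq_integral do rewrite EFinB.
rewrite (integralB mH intS intc) EFinB; congr (_ - _); last first.
  by apply: etrans (integral_cst nu mH _) _; apply: etrans (mule1 _); congr (_ * _).
by rewrite /mean /Rintegral fineK//; exact: integrable_fin_num intS.
Qed.

Lemma Pset_mean_le nu (m : R) : nu H = 1 ->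
  (Pset rho S nu /\ (mean rho S nu <= m)%R) <->
  \int[nu]_x (lower_excess x)%:E <= (m - S 0)%:E.
Proof.
move=> nuH; split=> [[Pnu le0]|le0].
  by rewrite integral_lower_excessE// lee_fin lerD2r.
have Pnu : Pset rho S nu by apply/PsetP => //; rewrite (le_lt_trans le0)// ltry.
by split => //; move: le0; rewrite integral_lower_excessE// lee_fin lerD2r.
Qed.

Lemma mean_mixture (t : R) P Q (M : prob) : (0 <= t <= 1)%R ->
  (forall A, M A = t%:E * P A + (1 - t)%:E * Q A) ->
  Pset rho S P -> Pset rho S Q ->
  Pset rho S M /\ mean rho S M = (t * mean rho S P + (1 - t) * mean rho S Q)%R.
Proof.
move=> t01 ME PP PQ.
have MH : M H = 1.
  by rewrite ME (proj1 PP) (proj1 PQ) !mule1 -EFinD; congr EFin; ring.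
have := integral_mixture t01 ME
  (_ : measurable_fun setT (fun x => (lower_excess x)%:E)) (fun x => _).
rewrite (integral_lower_excessE PP) (integral_lower_excessE PQ) -!EFinM -EFinD.
move=> ME'.
have {}ME' : \int[M]_x (lower_excess x)%:E =
    (t * (mean rho S P - S 0) + (1 - t) * (mean rho S Q - S 0))%:E.
  apply: ME'; first by apply/measurable_EFinP; exact: measurable_lower_excess.
  by move=> x; rewrite lee_fin lower_excess_ge0.
have PM : Pset rho S M by apply/PsetP => //; rewrite ME' ltry.
split => //; move: ME'; rewrite integral_lower_excessE// => -[]; lra.
Qed.

Lemma dominates_mixture (t : R) P Q (M mu : prob) : (0 <= t <= 1)%R ->
  (forall A, M A = t%:E * P A + (1 - t)%:E * Q A) ->
  dominates P mu -> dominates Q mu -> dominates M mu.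
Proof.
move=> /andP[t0 t1] ME domP domQ x; rewrite ME.
have t1' : (0 <= 1 - t)%R by rewrite subr_ge0.
apply: (@le_trans _ _ (t%:E * mu `]-oo, x]%classic + (1 - t)%:E * mu `]-oo, x]%classic)).
  apply: leeD.
    by apply: lee_wpmul2l; [rewrite lee_fin|exact: domP].
  by apply: lee_wpmul2l; [rewrite lee_fin|exact: domQ].
rewrite -ge0_muleDl ?lee_fin// -EFinD (_ : (t + (1 - t) = 1 :> R)%R) ?mul1e//; lra.
Qed.

(** By the layer-cake formula, the mean of [S - S 0] is the integral over r >= 0
    of the tail [phi m r], the mass of the points where [S - S 0 > r]. Dominance
    orders the tails. If nu' has strictly less mass than nu on the ray up to y0,
    by right continuity it also has less mass up to some z > y0 than nu has up to
    y0; so the tails differ for all r between the levels of y0 and z, a set of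
    positive length, and the means cannot agree. *)
Lemma mean_lt_of_strictly_dominates nu nu' :
  Pset rho S nu -> Pset rho S nu' -> strictly_dominates nu' nu ->
  (mean rho S nu < mean rho S nu')%R.
Proof.
move=> Pnu Pnu' [dom [y0 lty]].
pose phi (m : prob) (r : R) := m [set x | (r < lower_excess x)%R].
have mphi (m : prob) : measurable_fun [set: R] (phi m).
  exact: measurable_tail measurable_lower_excess.
have intE (m : prob) : \int[m]_x (lower_excess x)%:E =
    \int[lebesgue_measure]_(r in `[0%R, +oo[) phi m r.
  by apply: integral_tail; [exact: measurable_lower_excess|exact: lower_excess_ge0].
(* Up to null sets, the complement of the tail event. The negative numbers are
   added to make it closed downwards. *)
pose L r := [set x : R | (x < 0)%R \/ (H x /\ (lower_excess x <= r)%R)].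
have mgt r : measurable ([set x : T | (r < lower_excess x)%R]).
  have -> : [set x : T | (r < lower_excess x)%R] = lower_excess @^-1` `]r, +oo[.
    by rewrite eqEsubset; split=> x /=; rewrite in_itv/= andbT.
  by rewrite -[X in measurable X]setTI; apply: measurable_lower_excess.
have null (m : prob) : m H = 1 -> m (~` H) = 0.
  by move=> mH1; rewrite probability_setC// mH1 subee.
have mL r : measurable (L r : set T).
  have -> : (L r : set T) = `]-oo, 0%R[%classic `|`
      (H `&` ~` [set x : T | (r < lower_excess x)%R]).
    rewrite eqEsubset; split=> x; rewrite /L /= in_itv/=.
      by move=> [|[Hx xr]]; [left|right; split => //; apply/negP; rewrite -leNgt].
    by move=> [|[Hx /negP]]; [left|right; rewrite leNgt].
  apply: measurableU; first exact: measurable_itv.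
  by apply: measurableI => //; exact: measurableC.
have phiE (m : prob) r : m H = 1 -> (0 <= r)%R -> phi m r = 1 - m (L r).
  move=> mH1 r0'; rewrite -probability_setC//.
  have -> : ~` (L r : set T) = [set x : T | (r < lower_excess x)%R] `|`
      (~` H `&` `[0%R, +oo[%classic).
    rewrite eqEsubset; split=> x; rewrite /L /= in_itv/= andbT.
      move=> /not_orP[/negP]; rewrite -leNgt => x0 /not_andP[nHx|/negP].
        by right.
      by rewrite -ltNge; left.
    move=> [rx [|[_]]|[nHx x0]].
    + move=> x0; move: rx; rewrite /lower_excess patchE memNset ?ltNge ?r0'//.
      by move=> [x0' _]; move: x0; rewrite ltNge x0'.
    + by rewrite leNgt rx.
    + by move=> [|[]//]; rewrite ltNge x0.
  rewrite measureU0//.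
    by apply: measurableI; [exact: measurableC|exact: measurable_itv].
  apply: (subset_measure0 _ _ _ (null _ mH1)); [|exact: measurableC|exact: subIsetl].
  by apply: measurableI; [exact: measurableC|exact: measurable_itv].
have phile r : (0 <= r)%R -> phi nu r <= phi nu' r.
  move=> r0'; rewrite !phiE ?(proj1 Pnu) ?(proj1 Pnu')//.
  apply: leeB => //; apply: dominates_down_set => // x y [x0|[Hx xr]] yx.
    by left; exact: le_lt_trans x0.
  have [y_lt0|y_ge0] := ltP y 0%R; first by left.
  have Hy : H y by exact: halfline_down Hx.
  right; split => //; apply: le_trans xr; rewrite !lower_excessE// lerD2r.
  exact: S_le.
have le_int : \int[nu]_x (lower_excess x)%:E <= \int[nu']_x (lower_excess x)%:E.
  rewrite !intE; apply: ge0_le_integral => //.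
  - apply: (measurable_funS measurableT) => //; exact: mphi.
  - apply: (measurable_funS measurableT) => //; exact: mphi.
  - by move=> r; rewrite /= in_itv/= andbT; exact: phile.
rewrite ltNge; apply/negP => le_mean.
(* y0 belongs to the half-line: a ray that ends on the left of the half-line has
   nu-mass 0, and one that ends on its right has nu'-mass 1. *)
have y0_ge0 : (0 <= y0)%R.
  rewrite leNgt; apply/negP => y0lt; move: lty.
  rewrite (_ : nu `]-oo, y0]%classic = 0) ?ltNge ?measure_ge0//.
  apply: (subset_measure0 _ _ _ (null _ (proj1 Pnu))) => //; first exact: measurableC.
  by move=> x; rewrite /= in_itv/= => xy0 [x0 _]; move: (le_lt_trans xy0 y0lt); rewrite ltNge x0.
have Hy0 : H y0.
  apply: contrapT => nHy0; move: lty; rewrite ltNge => /negP; apply.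
  apply: (@le_trans _ _ 1); first exact: probability_le1.
  rewrite -(proj1 Pnu'); apply: le_measure; rewrite ?inE//.
  move=> x [x0 xrho]; rewrite /= in_itv/= leNgt; apply/negP => y0x; apply: nHy0.
  by apply: halfline_down (ltW y0x) _.
have [e0 e0_gt0 lt_e0] := cdf_right_continuous_lt lty.
have [z [y0z Hz lt_z]] : exists z, [/\ (y0 < z)%R, H z &
    nu' `]-oo, z]%classic < nu `]-oo, y0]%classic].
  have [c [c0 Hc]] : exists c : R, (0 < c)%R /\ H (y0 + c)%R.
    have [_ y0rho] := Hy0; move: y0rho; rewrite /halfline /=.
    case: rho => [r| |] //.
    - rewrite lte_fin => y0r; exists ((r - y0) / 2)%R; split; first lra.
      by split; rewrite ?lte_fin; lra.
    - by move=> _; exists 1%R; split => //; split; rewrite ?ltry//; lra.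
  exists (y0 + Num.min c e0)%R; split.
  - by rewrite ltrDl lt_min c0.
  - apply: halfline_down Hc; last by rewrite lerD2l ge_min lexx.
    by rewrite addr_ge0// le_min !ltW.
  - apply: le_lt_trans lt_e0; apply: le_measure; rewrite ?inE//.
    apply: subset_itvl; rewrite bnd_simp lerD2l ge_min lexx orbT//.
pose a := (S y0 - S 0)%R; pose b := (S z - S 0)%R.
have ab : (a < b)%R by rewrite ltrD2r; exact: Smono.
have a0 : (0 <= a)%R by rewrite subr_ge0; exact: S_le.
have phi_lt r : (a <= r)%R -> (r < b)%R -> phi nu r < phi nu' r.
  move=> ar rb; have r0' := le_trans a0 ar.
  rewrite !phiE ?(proj1 Pnu) ?(proj1 Pnu')//.
  have finm (m : prob) (A : set T) : measurable A -> m A \is a fin_num.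
    by move=> mA; exact: fin_num_measure.
  have le1 : nu' (L r) <= nu' `]-oo, z]%classic.
    apply: le_measure; rewrite ?inE// => x [x0|[Hx xr]]; rewrite /= in_itv/=.
      by apply: le_trans (ltW y0z); apply: le_trans y0_ge0; exact: ltW.
    rewrite leNgt; apply/negP => zx; move: xr; rewrite leNgt => /negP; apply.
    by rewrite (lt_trans rb)// lower_excessE// ltrD2r; exact: Smono.
  have le2 : nu `]-oo, y0]%classic <= nu (L r).
    apply: le_measure; rewrite ?inE// => x; rewrite /= in_itv/= => xy0.
    have [x0|x0] := ltP x 0%R; [by left|right].
    have Hx : H x by exact: halfline_down Hy0.
    by split => //; apply: le_trans ar; rewrite lower_excessE// lerD2r; exact: S_le.
  have := le_lt_trans le1 (lt_le_trans lt_z le2).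
  move: (finm nu _ (mL r)) (finm nu' _ (mL r)).
  move: (nu (L r)) (nu' (L r)) => [p| |] // [q| |] // _ _.
  by rewrite -!EFinB !lte_fin; lra.
pose phi0 m := phi m \_ `[0%R, +oo[%classic.
have mphi0 (m : prob) : measurable_fun [set: R] (phi0 m).
  have mI : measurable (`[0%R, +oo[%classic : set R) by exact: measurable_itv.
  by apply/(measurable_restrictT _ mI); apply: measurable_funS (mphi m).
have phi0E (m : prob) : \int[lebesgue_measure]_r phi0 m r = \int[m]_x (lower_excess x)%:E.
  by rewrite intE -integral_mkcond.
have aeE : {ae lebesgue_measure, forall r, phi0 nu r = phi0 nu' r}.
  apply: ge0_integral_le_ae_eq => //; try exact: mphi0.
  - by move=> r; rewrite /phi0 patchE; case: ifP.
  - move=> r; rewrite /phi0 !patchE; case: ifPn => // /set_mem.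
    by rewrite /= in_itv/= andbT; exact: phile.
  - by rewrite phi0E integral_lower_excessE// ltry.
  - by rewrite !phi0E !integral_lower_excessE// lee_fin lerD2r.
have [N [mN N0 phiN]] := aeE.
have : lebesgue_measure `[a, b[%classic = 0.
  apply: (subset_measure0 _ _ _ N0) => // r; rewrite /= in_itv/= => /andP[ar rb].
  apply: phiN => /=; rewrite /phi0 !patchE mem_set; last first.
    by rewrite /= in_itv/= andbT (le_trans a0).
  by move=> e; move: (phi_lt r ar rb); rewrite e ltxx.
by rewrite lebesgue_measure_itv/= lte_fin ab => /eqP; rewrite -EFinB eqe subr_eq0 gt_eqF.
Qed.

End scale_moments.

(** * Measures of mean zero as the maximal ones for dominance *)

Section support_and_push_up.
Context {R : realType}.
Local Notation T := (measurableTypeR R).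
Local Notation prob := (probability T R).
Local Open Scope ereal_scope.
Implicit Types (nu P Q : prob).

(** U is covered by countably many null balls with rational centres and radii. *)
Lemma null_of_locally_null nu (U : set R) :
  (forall x, U x -> exists V : set R, [/\ open V, V x & nu V = 0]) ->
  nu.-negligible (U : set T).
Proof.
move=> locU.
pose b (p : rat * rat) : set T := ball (ratr p.1 : R) (ratr p.2).
have mb p : measurable (b p) by rewrite /b; exact: measurable_ball.
pose B (k : nat) : set T :=
  if unpickle k is Some p then if nu (b p) == 0 then b p else set0 else set0.
apply: (negligibleS (A := \bigcup_k B k)); last first.
  apply: negligible_bigcup => k; rewrite /B.
  case: unpickle => [p|]; last exact: negligible_set0.
  by case: ifPn => [/eqP n0|_]; [apply/negligibleP|exact: negligible_set0].
move=> x /locU[V [oV /mem_set Vx nV]].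
have [c [r [/set_mem xb bV]]] := open_subball_rat oV Vx.
have : unpickle (pickle (c, r)) = Some (c, r) by exact: pickleK.
move: (pickle _) => k kE; exists k => //; rewrite /B kE ifT//; apply/eqP.
by apply: (subset_measure0 _ _ _ nV); [exact: mb|exact: open_measurable|].
Qed.

Lemma supp_subset_itv nu (M : R) :
  supp nu `<=` `[0%R, M]%classic <-> nu `[0%R, M]%classic = 1.
Proof.
have mI : measurable (`[0%R, M]%classic : set T) by exact: measurable_itv.
have mC : measurable (~` (`[0%R, M]%classic : set T)) by exact: measurableC.
split => [suppM|nuM].
  have : nu (~` (`[0%R, M]%classic : set T)) = 0.
    apply/negligibleP => //; apply: null_of_locally_null => x nMx.
    have /existsNP[V /not_implyP[oV /not_implyP[Vx /negP]]] : ~ supp nu x.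
      by move=> /suppM.
    rewrite -leNgt => nV; exists V; split => //.
    by apply: le_anti; rewrite nV measure_ge0.
  rewrite probability_setC// => h; apply: le_anti; rewrite probability_le1//=.
  by rewrite -[leRHS]add0e -leeBlDr ?fin_num_measure// h.
move=> x suppx; apply: contrapT => nMx.
have := suppx (~` `[0%R, M]%classic) _ nMx.
rewrite lt_neqAle => /(_ _)/andP[|/negP]; last first.
  move=> + _; apply; apply/eqP/esym.
  have <- : 1 - nu `[0%R, M]%classic = 0 by rewrite nuM subee.
  exact: probability_setC.
by apply: closed_openC; exact: interval_closed.
Qed.

End support_and_push_up.

Section extremal_measures.
Context {R : realType}.
Local Notation T := (measurableTypeR R).
Local Notation prob := (probability T R).
Local Open Scope ereal_scope.
Variables (rho : \bar R) (S : R -> R) (r0 : R).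
Local Notation H := (halfline rho : set T).
Hypotheses (r0_gt0 : (0 < r0)%R) (Hr0 : H r0) (Sr0 : S r0 = 0%R).
Hypothesis Smono : forall x y, H x -> H y -> (x < y)%R -> (S x < S y)%R.
Hypothesis mS : measurable_fun H S.
Implicit Types (nu P Q mu : prob).
Local Notation g := (lower_excess rho S).

Let H0 : H 0%R. Proof. exact: halfline_down (ltW r0_gt0) Hr0. Qed.
Let mH := @measurable_halfline R rho.
Let mg : measurable_fun [set: T] g.
Proof. exact: measurable_lower_excess. Qed.
Let g0 x : (0 <= g x)%R. Proof. exact: lower_excess_ge0 r0_gt0 Hr0 Smono x. Qed.
Let mgE : measurable_fun [set: T] (fun x => (g x)%:E).
Proof. exact/measurable_EFinP. Qed.
Let g0E (x : T) : 0 <= (g x)%:E. Proof. by rewrite lee_fin. Qed.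

Let Sle x y : H x -> H y -> (x <= y)%R -> (S x <= S y)%R.
Proof. exact: S_le Smono x y. Qed.

(** Otherwise [S >= S r0 = 0] almost everywhere. *)
Lemma mass_below_r0 nu : Pset rho S nu -> (mean rho S nu < 0)%R ->
  exists2 y, (y < r0)%R & 0 < nu `]-oo, y]%classic.
Proof.
move=> Pnu m0; apply: contrapT => /forall2NP noy.
have null0 : nu `]-oo, r0[%classic = 0.
  pose A n := (`]-oo, (r0 - n.+1%:R^-1)%R] : set R)%classic.
  have mA n : measurable (A n : set T) by exact: measurable_itv.
  rewrite -ray_open_bigcup; apply/negligibleP; first exact: bigcup_measurable.
  apply: negligible_bigcup => n; apply/negligibleP => //.
  have [|/negP] := noy (r0 - n.+1%:R^-1)%R.
    by rewrite ltrBlDr ltrDl invr_gt0.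
  by rewrite -leNgt => n0; apply: le_anti; rewrite n0 measure_ge0.
have S0_le0 : (S 0 <= 0)%R by have := Sle H0 Hr0 (ltW r0_gt0); rewrite Sr0.
have nullHC : nu (~` H) = 0 by rewrite probability_setC// (proj1 Pnu) subee.
have : (- S 0)%:E <= \int[nu]_x (g x)%:E.
  rewrite -(integral_cst_probability nu); apply: ae_ge0_le_integral => //.
  - by move=> x _; rewrite lee_fin oppr_ge0.
  exists (`]-oo, r0[%classic `|` ~` H); split.
  - by apply: measurableU; [exact: measurable_itv|exact: measurableC].
  - by apply: null_set_setU => //; exact: measurableC.
  move=> x /= /not_implyP[_ /negP]; rewrite -ltNge => gx.
  apply: contrapT => /not_orP[/negP]; rewrite /= in_itv/= -leNgt => r0x /contrapT Hx.
  move: gx; rewrite lower_excessE// lte_fin ltNge => /negP; apply.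
  by rewrite lerDr -Sr0; exact: Sle.
rewrite (integral_lower_excessE Pnu) lee_fin; lra.
Qed.

(** Pushing nu forward along [Num.max x r0] empties the rays that end before r0
    and leaves the longer ones unchanged. The image P has a nonnegative mean, which
    may be too large, so it is mixed with nu: with weight t on nu, where t solves
    [t * m + (1 - t) * p = 0] for [p = `|mean P|], the mean is at most 0. As m < 0
    entails t < 1, the mixture strictly dominates nu at the ray found by
    [mass_below_r0]. *)
Lemma push_up nu : Pset rho S nu -> (mean rho S nu < 0)%R ->
  exists nu', [/\ Pset rho S nu', (mean rho S nu' <= 0)%R, strictly_dominates nu' nu &
    forall M, (r0 <= M)%R -> nu `[0%R, M]%classic = 1 -> nu' `[0%R, M]%classic = 1].
Proof.
move=> Pnu m0; have [y yr0 nuy] := mass_below_r0 Pnu m0.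
pose phi (x : T) : T := Num.max x r0.
have mphi : measurable_fun setT phi.
  by apply: measurable_maxr; [exact: measurable_id|exact: measurable_cst].
have mpre (A : set T) : measurable A -> measurable (phi @^-1` A).
  by move=> mA; rewrite -[X in measurable X]setTI; exact: mphi.
pose P : prob := distribution nu (mfun_Sub (mem_set mphi) : {RV nu >-> T}).
have PE A : P A = nu (phi @^-1` A) by [].
have PH : P H = 1.
  rewrite PE; apply: le_anti; rewrite probability_le1 -?(proj1 Pnu)/=; last first.
    exact: mpre.
  apply: le_measure; rewrite ?inE//.
    exact: mpre.
  move=> x Hx; rewrite /phi /=; by case: leP.
have Pg : \int[P]_x (g x)%:E = \int[nu]_x (g (phi x))%:E.
  exact: (@ge0_integral_distribution _ _ _ T R nu _ (fun x => (g x)%:E)).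
have PP : Pset rho S P.
  apply/(PsetP r0_gt0 Hr0 Smono mS PH); rewrite Pg.
  apply: (@le_lt_trans _ _ (\int[nu]_x (g x)%:E + (g r0)%:E)); last first.
    rewrite (integral_lower_excessE Pnu).
    by rewrite -EFinD ltry.
  rewrite -(integral_cst_probability nu) -ge0_integralD//.
  apply: ge0_le_integral => //.
  - by apply/measurable_EFinP; exact: (measurableT_comp mg mphi).
  - by apply: emeasurable_funD => //; exact: measurable_cst.
  move=> x _; rewrite -EFinD lee_fin /phi.
  by have [xr|rx] := leP x r0; rewrite ?lerDr ?lerDl.
pose m := mean rho S nu; pose p := `|mean rho S P|%R.
have p0 : (0 <= p)%R by exact: normr_ge0.
have pm : (0 < p - m)%R by rewrite /m; lra.
pose t := (p / (p - m))%R.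
have t0 : (0 <= t)%R by rewrite divr_ge0// ltW.
have t1 : (t < 1)%R by rewrite ltr_pdivrMr// mul1r; rewrite /m; lra.
have t01 : (0 <= t <= 1)%R by rewrite t0 ltW.
have [M ME] := mixture_exists nu P t01.
have [PM mM] := mean_mixture r0_gt0 Hr0 Smono mS t01 ME Pnu PP.
have P_ray z : P `]-oo, z]%classic = if (z < r0)%R then 0 else nu `]-oo, z]%classic.
  rewrite PE; case: ifPn => [zr|]; last rewrite -leNgt => rz.
    rewrite (_ : _ @^-1` _ = set0) ?measure0//.
    rewrite eqEsubset; split=> x //=; rewrite in_itv/= /phi ge_max => /andP[_].
    by rewrite leNgt zr.
  congr (nu _); rewrite eqEsubset; split=> x /=; rewrite !in_itv/= /phi ge_max.
    by move=> /andP[].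
  by move=> ->.
exists M; split => //.
- rewrite mM -/m.
  have : (mean rho S P <= p)%R by exact: ler_norm.
  have : (t * m + (1 - t) * p = 0)%R by rewrite /t; field; rewrite gt_eqF.
  have : (0 <= 1 - t)%R by lra.
  nra.
- split.
    move=> z; rewrite ME P_ray.
    have : nu `]-oo, z]%classic \is a fin_num by exact: fin_num_measure.
    have : 0 <= nu `]-oo, z]%classic by exact: measure_ge0.
    case: (nu _) => [n| |] // n0 _; case: ifPn => _.
      by rewrite mule0 adde0 -EFinM lee_fin; move: n0; rewrite lee_fin; nra.
    by rewrite -!EFinM -EFinD lee_fin; lra.
  exists y; rewrite ME P_ray yr0 mule0 adde0.
  have : nu `]-oo, y]%classic \is a fin_num by exact: fin_num_measure.
  move: nuy; case: (nu _) => [n| |] //; rewrite -EFinM !lte_fin => n0 _; nra.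
- move=> N rN nuN; rewrite ME nuN.
  suff -> : P `[0%R, N]%classic = 1 by rewrite !mule1 -EFinD; congr EFin; ring.
  rewrite PE; apply: le_anti; rewrite probability_le1 -?nuN/=; last first.
    by apply: mpre; exact: measurable_itv.
  apply: le_measure; rewrite ?inE.
  + exact: measurable_itv.
  + by apply: mpre; exact: measurable_itv.
  move=> x; rewrite /= !in_itv/= /phi => /andP[x0 xN].
  by rewrite le_max x0 /= ge_max xN rN.
Qed.

(** For the order of strict dominance, having mean 0 means being maximal: a
    strictly dominating measure has a larger mean, and a measure with negative
    mean is strictly dominated by its push-up. *)
Lemma feasible_domE (Q : set prob) mu nu :
  (forall nu, Q nu -> Pset rho S nu) ->
  (forall nu, Q nu -> (mean rho S nu < 0)%R ->
    exists nu', [/\ Q nu', (mean rho S nu' <= 0)%R & strictly_dominates nu' nu]) ->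
  feasible_dom rho S mu Q nu <-> [/\ Q nu, mean rho S nu = 0%R & dominates nu mu].
Proof.
move=> QP Qup; split.
  move=> [Qnu m0 dom nex]; split => //; apply/eqP; rewrite eq_le m0 /= leNgt.
  by apply/negP => lt0; apply: nex; exact: Qup.
move=> [Qnu m0 dom]; split => //; first by rewrite m0.
move=> [nu' [Qnu' m0' sdom]].
have := mean_lt_of_strictly_dominates r0_gt0 Hr0 Smono mS (QP _ Qnu) (QP _ Qnu') sdom.
by rewrite m0 ltNge m0'.
Qed.

Section bounded_support.
Variable M : R.
Hypotheses (rM : (r0 <= M)%R) (HM : H M).

Lemma itv_sub_halfline : (`[0%R, M]%classic : set R) `<=` halfline rho.
Proof.
by move=> x; rewrite /= in_itv/= => /andP[x0 xM]; exact: halfline_down HM.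
Qed.

Let mI : measurable (`[0%R, M]%classic : set T).
Proof. exact: measurable_itv. Qed.

Lemma itv_mass_halfline nu : nu `[0%R, M]%classic = 1 -> nu H = 1.
Proof.
move=> nuI; apply: le_anti; rewrite probability_le1//= -nuI.
by apply: le_measure; rewrite ?inE//; exact: itv_sub_halfline.
Qed.

(** The counterpart of [lower_excess] for measures on [0, M], vanishing at M: it
    expresses lower bounds on the mean by upper bounds on an integral. *)
Definition upper_excess : R -> R := ((fun x => S M - S x) \_ `[0, M]%classic)%R.

Lemma upper_excessE x : (0 <= x <= M)%R -> upper_excess x = (S M - S x)%R.
Proof. by move=> x0M; rewrite /upper_excess patchE mem_set//= in_itv/=. Qed.

Lemma measurable_upper_excess : measurable_fun [set: T] upper_excess.
Proof.
apply/(measurable_restrictT _ mI); apply: measurable_funB => //.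
exact: measurable_funS itv_sub_halfline mS.
Qed.

Lemma upper_excess_ge0 x : (0 <= upper_excess x)%R.
Proof.
rewrite /upper_excess patchE; case: ifPn => // /set_mem Ix.
rewrite subr_ge0; apply: Sle => //; first exact: itv_sub_halfline.
by move: Ix; rewrite /= in_itv/= => /andP[].
Qed.

Lemma upper_excess_end : upper_excess M = 0%R.
Proof. by rewrite upper_excessE ?subrr// lexx andbT; exact: le_trans (ltW r0_gt0) rM. Qed.

Lemma upper_excess_gt0 x : (0 <= x < M)%R -> (0 < upper_excess x)%R.
Proof.
move=> /andP[x0 xM]; rewrite upper_excessE ?x0 ?ltW// subr_gt0; apply: Smono => //.
by apply: halfline_down HM => //; exact: ltW.
Qed.

Lemma bounded_support_moments nu : nu `[0%R, M]%classic = 1 ->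
  Pset rho S nu /\ \int[nu]_x (upper_excess x)%:E = (S M - mean rho S nu)%:E.
Proof.
move=> nuI; have nuH := itv_mass_halfline nuI.
have mu' : measurable_fun setT (fun x : T => (upper_excess x)%:E).
  by apply/measurable_EFinP; exact: measurable_upper_excess.
have u0 (x : T) : 0 <= (upper_excess x)%:E by rewrite lee_fin upper_excess_ge0.
have sumE : \int[nu]_x (g x)%:E + \int[nu]_x (upper_excess x)%:E = (S M - S 0)%:E.
  rewrite -(integral_full_set mI nuI mgE)// -(integral_full_set mI nuI mu')//.
  rewrite -ge0_integralD//; [|exact: measurable_funTS..].
  transitivity (\int[nu]_(x in (`[0%R, M]%classic : set T)) (S M - S 0)%:E).
    apply: eq_integral => x /set_mem Ix; rewrite -EFinD; congr EFin.
    rewrite lower_excessE; last exact: itv_sub_halfline.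
    by move: Ix; rewrite /= in_itv/= => Ix; rewrite upper_excessE//; ring.
  rewrite (integral_full_set (g := fun=> (S M - S 0)%:E) mI nuI)//.
    exact: integral_cst_probability.
  by move=> x; rewrite lee_fin subr_ge0; apply: Sle => //; exact: le_trans (ltW r0_gt0) rM.
have Pnu : Pset rho S nu.
  apply/(PsetP r0_gt0 Hr0 Smono mS nuH).
  apply: (@le_lt_trans _ _ (S M - S 0)%:E); last by rewrite ltry.
  by rewrite -sumE leeDl//; exact: integral_ge0.
split => //; move: sumE; rewrite (integral_lower_excessE Pnu).
have : 0 <= \int[nu]_x (upper_excess x)%:E by exact: integral_ge0.
case: (\int[nu]_x _) => [c| |] // _; rewrite -EFinD => -[e]; congr EFin; lra.
Qed.

Lemma PsetM_E nu : PsetM rho S M nu <-> nu `[0%R, M]%classic = 1.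
Proof.
split=> [[_ /supp_subset_itv//]|nuI]; split; last exact/supp_subset_itv.
by have [] := bounded_support_moments nuI.
Qed.

End bounded_support.

End extremal_measures.

(** * Monotonicity of the scale function *)

Section scale_function_properties.
Context {R : realType}.
Local Notation mu := (@lebesgue_measure R).

Lemma oriented_integral_sub (g : R -> R) (r0 p q m M : R) :
  mu.-integrable `[m, M] (EFin \o g) -> m <= p -> p <= q -> q <= M ->
  m <= r0 <= M ->
  oriented_integral g r0 q - oriented_integral g r0 p =
  \int[mu]_(x in `[p, q]) g x.
Proof.
move=> intg mp pq qM /andP[mr rM].
have sub (x y : R) : m <= x -> y <= M -> mu.-integrable `[x, y] (EFin \o g).
  move=> mx yM; apply: integrableS intg => //.
  by apply: subset_itv; rewrite bnd_simp.
have chasles (x y z : R) : m <= x -> x <= y -> y <= z -> z <= M ->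
    \int[mu]_(t in `[x, z]) g t =
    \int[mu]_(t in `[x, y]) g t + \int[mu]_(t in `[y, z]) g t.
  move=> mx xy yz zM; apply/eqP; rewrite addrC -subr_eq; apply/eqP.
  rewrite Rintegral_itvB ?bnd_simp//; last exact: sub.
  apply: Rintegral_itv_obnd_cbnd; apply: integrableS (sub y z _ zM) => //.
    by apply: subset_itv; rewrite bnd_simp.
  exact: le_trans xy.
rewrite /oriented_integral; case: ifPn => [r0q|]; last rewrite -ltNge => qr0.
  case: ifPn => [r0p|]; last rewrite -ltNge => pr0.
    by rewrite (chasles r0 p q)// addrC addKr.
  by rewrite opprK addrC -chasles// ltW.
rewrite leNgt (le_lt_trans pq qr0)/= opprK.
by rewrite (chasles p q r0)// ?(ltW qr0)//; ring.
Qed.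

Lemma oriented_integral_continuous (g : R -> R) (r0 m M : R) :
  mu.-integrable `[m, M] (EFin \o g) -> m <= r0 <= M ->
  {within `[m, M], continuous (oriented_integral g r0)}.
Proof.
move=> intg /[dup] r0mM /andP[mr rM]; have mM := le_trans mr rM.
pose G x := oriented_integral g r0 m + \int[mu]_(t in `[m, x]) g t.
have GE : {in `[m, M]%classic, G =1 oriented_integral g r0}.
  move=> x /set_mem; rewrite /= in_itv/= => /andP[mx xM].
  by rewrite /G -(oriented_integral_sub intg (lexx m) mx xM r0mM) addrC subrK.
apply: (subspace_eq_continuous GE).
move=> x; apply: cvgD; first exact: cvg_cst.
exact: (parameterized_integral_continuous mM intg).
Qed.

Variables (l rho : \bar R) (a sigma : R -> R) (r0 : R).
Local Notation I := (state_space l rho).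
Hypothesis Ir0 : I r0.
Hypothesis ma : measurable_fun I a.
Hypothesis loc_sigma : locally_integrable I (fun x => (sigma x ^+ 2)^-1).
Hypothesis loc_a : locally_integrable I (fun x => `|a x| / sigma x ^+ 2).
Local Notation S := (scale_function a sigma r0).

Let h r := a r / sigma r ^+ 2.

Let sub_state (m M : R) : I m -> I M -> `[m, M] `<=` I.
Proof.
move=> [lm _] [_ Mrho] x; rewrite /= in_itv/= => /andP[mx xM]; split.
  by apply: lt_le_trans lm _; rewrite lee_fin.
by apply: le_lt_trans Mrho; rewrite lee_fin.
Qed.

Lemma drift_integrable (m M : R) : I m -> I M ->
  mu.-integrable `[m, M] (EFin \o h).
Proof.
move=> Im IM; have sub := sub_state Im IM.
have [_ oI loc] := loc_a.
have mI : measurable I by exact: open_measurable.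
apply/integrableP; split.
  apply/measurable_EFinP; apply: (measurable_funS mI sub).
  by apply: measurable_funM => //; case: loc_sigma.
have := loc _ sub (@segment_compact _ m M).
rewrite (_ : \int[_]_(x in _) _ = \int[mu]_(x in `[m, M]) `|(EFin \o h) x|)%E//.
apply: eq_integral => x /set_mem /sub Ix; rewrite /= /h.
by rewrite !normrM normr_id.
Qed.

Let G u := expR (- 2 * oriented_integral h r0 u).

Lemma scale_density_continuous (m M : R) : I m -> I M -> m <= r0 <= M ->
  {within `[m, M], continuous G}.
Proof.
move=> Im IM mrM x.
have cont : {within `[m, M], continuous (fun u => - 2 * oriented_integral h r0 u)}.
  move=> y; apply: cvgM; first exact: cvg_cst.
  exact: (oriented_integral_continuous (drift_integrable Im IM) mrM).
exact: cvg_comp (cont x) (@continuous_expR R _).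
Qed.

Lemma scale_density_integrable (m M : R) : I m -> I M -> m <= r0 <= M ->
  mu.-integrable `[m, M] (EFin \o G).
Proof.
move=> Im IM mrM; apply: continuous_compact_integrable.
  exact: segment_compact.
exact: scale_density_continuous.
Qed.

Lemma scale_function0 : S r0 = 0.
Proof. by rewrite /scale_function /oriented_integral lexx set_itv1 Rintegral_set1. Qed.

(** The density G of S is positive and continuous, hence bounded below on [p, q]
    by a positive constant. *)
Lemma scale_function_lt (p q : R) : I p -> I q -> p < q -> S p < S q.
Proof.
move=> Ip Iq pq.
(* [m, M] contains p, q and the base point r0 of all the integrals. *)
pose m := Num.min p r0; pose M := Num.max q r0.
have Im : I m by rewrite /m; case: leP.
have IM : I M by rewrite /M; case: leP.
have mp : m <= p by rewrite ge_min lexx.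
have qM : q <= M by rewrite le_max lexx.
have mrM : m <= r0 <= M by rewrite ge_min le_max lexx !orbT.
have intG := scale_density_integrable Im IM mrM.
have cG := scale_density_continuous Im IM mrM.
rewrite -subr_gt0 [ltRHS](_ : _ = \int[mu]_(x in `[p, q]) G x); last first.
  exact: (oriented_integral_sub intG mp (ltW pq) qM mrM).
have sub : `[p, q] `<=` `[m, M] by apply: subset_itv; rewrite bnd_simp.
have [c _ cmin] : exists2 c, c \in `[p, q] & forall t, t \in `[p, q] -> G c <= G t.
  by apply: EVT_min; [exact: ltW|exact: continuous_subspaceW cG].
apply: (@lt_le_trans _ _ (\int[mu]_(x in `[p, q]) G c)); last first.
  apply: le_Rintegral.
  - exact: measurable_itv.
  - apply: continuous_compact_integrable; first exact: segment_compact.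
    by move=> x; exact: cvg_cst.
  - by apply: integrableS intG; rewrite ?measurable_itv.
  - by move=> x xpq; exact: cmin.
rewrite Rintegral_cst// /= mulr_gt0 ?expR_gt0//.
by rewrite lebesgue_measure_itv/= lte_fin pq -EFinD/= subr_gt0.
Qed.

End scale_function_properties.

(** A monotone function that is not bounded above tends to +oo. *)
Lemma bounded_of_lim_lty {R : realType} (F : set_system R) (S : R -> R) (A : set R) :
  ProperFilter F -> (forall x y, A x -> A y -> x <= y -> S x <= S y) ->
  (forall x, A x -> \forall y \near F, A y /\ x <= y) ->
  (lim ((S x)%:E @[x --> F]) < +oo)%E -> exists K : R, forall x, A x -> S x <= K.
Proof.
move=> FF Sle Anear limoo; apply: contrapT => /forallNP unb.
suff lim_oo : lim ((S x)%:E @[x --> F]) = +oo%E by move: limoo; rewrite lim_oo.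
apply: cvg_lim => //; apply/cvgeryP/cvgryPge => K.
have /existsNP[x /not_implyP[Ax /negP]] := unb K.
rewrite -ltNge => Kx; have := Anear x Ax.
by apply: filterS => y [Ay xy]; apply: le_trans (ltW Kx) _; exact: Sle.
Qed.

Lemma bounded_of_scale_at_end {R : realType} (rho : \bar R) (S : R -> R) :
  (forall x y, halfline rho x -> halfline rho y -> x <= y -> S x <= S y) ->
  halfline rho !=set0 ->
  (scale_at_end S rho < +oo)%E -> exists K : R, forall x, halfline rho x -> S x <= K.
Proof.
case: rho => [r| |] Sle [z [z0 zr]] //=; apply: bounded_of_lim_lty => //.
- move=> x [x0]; rewrite lte_fin => xr; near=> y.
  have xy : x <= y by near: y; exact: (nbhs_left_ge xr).
  split => //; split; first exact: le_trans xy.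
  by rewrite lte_fin; near: y; exact: nbhs_left_lt.
- move=> x [x0 _]; near=> y.
  have xy : x <= y by near: y; apply: nbhs_pinfty_ge; exact: num_real.
  by split => //; split; [exact: le_trans xy|rewrite ltry].
Unshelve. all: by end_near. Qed.

(** * The problems for an increasing function in place of the scale function *)

Section optimization_problems.
Context {R : realType}.
Local Notation T := (measurableTypeR R).
Local Notation prob := (probability T R).
Local Open Scope ereal_scope.
Variables (rho : \bar R) (S f : R -> R) (r0 : R) (mu : prob).
Local Notation H := (halfline rho : set T).
Local Notation D := (fdivergence rho f mu).
Local Notation strict := (strictly_convex_function (`]0, +oo[%classic)%R f).
Hypotheses (r0_gt0 : (0 < r0)%R) (Hr0 : H r0) (Sr0 : S r0 = 0%R).
Hypothesis Smono : forall x y, H x -> H y -> (x < y)%R -> (S x < S y)%R.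
Hypothesis mS : measurable_fun H S.
Hypotheses (hf : divergence_function f) (hmu : Pset rho S mu).
Implicit Types (nu P Q M : prob).
Local Notation g := (lower_excess rho S).

Let muH : mu H = 1. Proof. by case: hmu. Qed.
Let H0 : H 0%R. Proof. exact: halfline_down (ltW r0_gt0) Hr0. Qed.
Let mH := @measurable_halfline R rho.
Let mg : measurable_fun [set: T] g.
Proof. exact: measurable_lower_excess. Qed.
Let g0 x : (0 <= g x)%R. Proof. exact: lower_excess_ge0 r0_gt0 Hr0 Smono x. Qed.
Let mgE : measurable_fun [set: T] (fun x => (g x)%:E).
Proof. exact/measurable_EFinP. Qed.
Let g0E (x : T) : 0 <= (g x)%:E. Proof. by rewrite lee_fin. Qed.
Let half01 : (0 <= (2^-1 : R) <= 1)%R.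
Proof. by apply/andP; split; lra. Qed.

Lemma mixture_full_mass (t : R) P Q M (A : set T) :
  (forall B, M B = t%:E * P B + (1 - t)%:E * Q B) ->
  P A = 1 -> Q A = 1 -> M A = 1.
Proof. by move=> -> -> ->; rewrite !mule1 -EFinD; congr EFin; ring. Qed.

(** Dominance consists of upper bounds on the integrals of indicators of rays. *)
Lemma dominates_closed (ok : (R -> R) -> Prop) (K : set prob) nu' :
  (forall nu, K nu -> dominates nu mu) ->
  (forall y, mu `]-oo, y]%classic = 1 \/ ok (\1_(`]-oo, y]%classic))) ->
  inherits_moment_bounds ok K nu' -> dominates nu' mu.
Proof.
move=> Kdom okray inh y.
have mI : measurable (`]-oo, y]%classic : set T) by exact: measurable_itv.
have [mu1|oky] := okray y; first by rewrite mu1; exact: probability_le1.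
have := inh (\1_(`]-oo, y]%classic)) _ _ oky (mu `]-oo, y]%classic).
rewrite integral_indic// setIT; apply => // nu Knu.
by rewrite integral_indic// setIT; exact: Kdom.
Qed.

Section mean_positive.
Hypothesis mu_pos : (0 < mean rho S mu)%R.
Let W : set prob := [set nu | nu H = 1].

Let relaxedE : relaxed_constraint W g (0 - S 0) = feasibleB rho S.
Proof.
rewrite eqEsubset; split=> nu [].
  by move=> nuH /(Pset_mean_le r0_gt0 Hr0 Smono mS _ nuH).
move=> Pnu m0; have nuH := proj1 Pnu; split => //.
by apply/(Pset_mean_le r0_gt0 Hr0 Smono mS _ nuH).
Qed.

Let tightE : tight_constraint W g (0 - S 0) = feasibleG rho S.
Proof.
rewrite eqEsubset; split=> nu [].
  move=> nuH gnu; have Pnu : Pset rho S nu.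
    by apply/(PsetP r0_gt0 Hr0 Smono mS nuH); rewrite gnu ltry.
  split => //; move: gnu; rewrite integral_lower_excessE// => -[]; lra.
move=> Pnu m0; split; first by have [] := Pnu.
by rewrite integral_lower_excessE// m0.
Qed.

Let Wmix (t : R) P Q M : (0 <= t <= 1)%R ->
  (forall A, M A = t%:E * P A + (1 - t)%:E * Q A) -> W P -> W Q -> W M.
Proof. by move=> _ ME; exact: mixture_full_mass ME. Qed.

Let Wclosed (K : set prob) nu' : K `<=` W ->
  inherits_moment_bounds (fun h => h 0%R = 0%R) K nu' -> W nu'.
Proof. by move=> KW cl; exact: full_mass_closed mH H0 KW cl. Qed.

Let gx0 : g 0%R = 0%R. Proof. exact: lower_excess0 r0_gt0 Hr0. Qed.

Let mub : (0 - S 0)%:E < \int[mu]_x (g x)%:E.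
Proof. by rewrite integral_lower_excessE// lte_fin ltrD2r. Qed.

Let muoo : \int[mu]_x (g x)%:E < +oo.
Proof. by rewrite integral_lower_excessE// ltry. Qed.

Let sep nu : W nu -> nu [set x | x != 0%R /\ g x = 0%R] = 0.
Proof.
move=> Wnu; have null : nu (~` H) = 0 by rewrite probability_setC// Wnu subee.
have mZ := measurable_zeros_off 0%R mg.
apply: (subset_measure0 _ _ _ null) => //; first exact: measurableC.
move=> x [x0 gx] Hx; have := lower_excess_gt0 r0_gt0 Hr0 Smono Hx x0.
by rewrite gx ltxx.
Qed.

Lemma minimizer_G_minimizer_B nu :
  minimizer D (feasibleG rho S) nu -> minimizer D (feasibleB rho S) nu.
Proof.
rewrite -relaxedE -tightE.
exact: (tight_minimizer_relaxed hf muH mg g0 _ Wmix).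
Qed.

Lemma has_finite_G_B : has_finite_value D (feasibleG rho S) ->
  has_finite_value D (feasibleB rho S).
Proof.
rewrite -relaxedE -tightE => -[nu [Knu Dnu]]; exists nu; split => //.
exact: tight_constraint_sub.
Qed.

Lemma has_minimizer_G : has_finite_value D (feasibleB rho S) ->
  has_minimizer D (feasibleG rho S).
Proof.
rewrite -relaxedE -tightE.
exact: (tight_minimizer_exists hf muH mg g0 gx0 H0 _ Wmix Wclosed muH mub muoo).
Qed.

Lemma minimizer_B_unique : has_finite_value D (feasibleB rho S) ->
  strict -> unique_minimizer D (feasibleB rho S).
Proof.
rewrite -relaxedE => fin sf.
exact: (relaxed_minimizer_unique hf muH mg g0 gx0 _ Wmix Wclosed muH mub muoo sf sep fin).
Qed.

(** The moment problem with atom at 0 and [g = lower_excess]: here W consists of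
    all probability measures on the half-line, the relaxed constraint is that of
    (B) and the tight one that of (G). *)
Theorem problems_G_B :
  [/\ has_finite_value D (feasibleG rho S) ->
        has_minimizer D (feasibleG rho S) /\
        (strict -> unique_minimizer D (feasibleG rho S)),
      has_minimizer D (feasibleG rho S) -> has_minimizer D (feasibleB rho S)
    & has_finite_value D (feasibleB rho S) ->
        has_minimizer D (feasibleB rho S) /\
        (strict -> unique_minimizer D (feasibleB rho S))].
Proof.
have GB : has_minimizer D (feasibleG rho S) -> has_minimizer D (feasibleB rho S).
  by move=> [nu minnu]; exists nu; exact: minimizer_G_minimizer_B.
split => //.
  move=> /has_finite_G_B finB; split; first exact: has_minimizer_G.
  move=> sf P Q minP minQ.
  by apply: minimizer_B_unique => //; exact: minimizer_G_minimizer_B.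
move=> finB; split; last exact: minimizer_B_unique.
exact/GB/has_minimizer_G.
Qed.

End mean_positive.

Section mean_negative.
Hypothesis mu_neg : (mean rho S mu < 0)%R.

Lemma feasibleCE nu : feasibleC rho S mu nu <->
  [/\ Pset rho S nu, mean rho S nu = 0%R & dominates nu mu].
Proof.
apply: (feasible_domE r0_gt0 Hr0 Smono mS) => // {}nu Pnu m0.
have [nu' [Pnu' m0' sdom _]] := push_up r0_gt0 Hr0 Sr0 Smono mS Pnu m0.
by exists nu'.
Qed.

Section superlinear.
Hypothesis rec_oo : recession f = +oo.

(** Finite divergence leaves no singular part when [recession f = +oo], so the
    density determines the measure. *)
Lemma minimizer_C_unique : has_finite_value D (feasibleC rho S mu) ->
  strict -> unique_minimizer D (feasibleC rho S mu).
Proof.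
move=> [nu0 [Knu0 nu0oo]] sf P Q /minimizerP[KP leP] /minimizerP[KQ leQ].
have Poo : D P < +oo by apply: le_lt_trans nu0oo; exact: leP.
have QP : D Q = D P by apply: le_anti; rewrite leQ// leP.
have [PP mP domP] := (feasibleCE _).1 KP.
have [PQ mQ domQ] := (feasibleCE _).1 KQ.
have [thP [nP decP]] := has_lebesgue_decomposition mu P.
have [thQ [nQ decQ]] := has_lebesgue_decomposition mu Q.
have [M ME] := mixture_exists P Q half01.
have KM : feasibleC rho S mu M.
  apply/feasibleCE.
  have [PM mM] := mean_mixture r0_gt0 Hr0 Smono mS half01 ME PP PQ.
  by split => //; [rewrite mM mP mQ !mulr0 addr0|exact: dominates_mixture ME _ _].
have thPQ := density_unique_of_midpoint hf muH sf (proj1 PP) (proj1 PQ)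
  decP decQ ME Poo QP (leP _ KM).
have null nu th (n : {measure set T -> \bar R}) :
    nu H = 1 -> lebesgue_decomposition mu nu th n -> D nu < +oo ->
    n (~` [set 0%R]) = 0.
  move=> nuH dec; rewrite (fdivergenceE hf muH nuH dec) rec_oo => noo.
  suff n0 : n setT = 0.
    apply: (subset_measure0 _ _ _ n0) => //.
    by apply: measurableC; exact: measurable_set1.
  have : 0 <= n setT by exact: measure_ge0.
  rewrite le_eqVlt => /predU1P[//|n0]; move: noo; rewrite gt0_mulye// addey ?ltxx//.
  rewrite -ltNye; apply: lt_le_trans (_ : 0 <= _) => //.
  by apply: integral_ge0 => x _; exact: extend_ge0.
apply: (eq_prob_of_density decP decQ thPQ (x0 := 0%R)).
  exact: null (proj1 PP) decP Poo.
by apply: null (proj1 PQ) decQ _; rewrite QP.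
Qed.

(** As [recession f = +oo], the measure nu of [relaxed_minimizer] inherits all
    bounds on nonnegative integrands: it dominates mu and has mean at most 0. The
    opposite bound comes from truncation. The function [h = k - Num.min S k] is
    nonnegative; over the sublevel set its integral is at most k plus the
    integral of S over the set where S > k, that is, at most k + e if k is large.
    So [\int h <= k + e] for nu too, and the mean of nu is at least - e. *)
Lemma has_minimizer_C (c : R) : uniformly_integrable_sublevel rho S f mu c ->
  has_minimizer D (feasibleC rho S mu).
Proof.
move=> [[nu0 Knu0] ui].
set K := dominating_sublevel rho S f mu c in ui Knu0.
have KH nu : K nu -> nu H = 1 by move=> [[[]]].
have Kmid P Q M : K P -> K Q ->
    (forall A, M A = 2^-1%:E * P A + (1 - 2^-1)%:E * Q A) -> K M.
  move=> [[PP mP] domP DP] [[PQ mQ] domQ DQ] ME.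
  have [PM mM] := mean_mixture r0_gt0 Hr0 Smono mS half01 ME PP PQ.
  split; [|exact: dominates_mixture ME _ _|].
    by split => //; rewrite mM mP mQ !mulr0 addr0.
  apply: le_trans (fdivergence_convex hf half01 ME muH (proj1 PP) (proj1 PQ)) _.
  move: DP DQ (fdivergence_ge0 rho mu hf P) (fdivergence_ge0 rho mu hf Q).
  case: (D P) => [p| |] //; case: (D Q) => [q| |] //.
  by rewrite -!EFinM -EFinD !lee_fin; lra.
have fin : exists nu, K nu /\ D nu < +oo.
  by exists nu0; split => //; have [_ _ Dc] := Knu0; rewrite (le_lt_trans Dc)// ltry.
have [nu [nuH Dnu nuP]] := relaxed_minimizer hf muH KH H0 Kmid fin.
have cl (h : R -> R) : measurable_fun [set: T] h -> (forall x, (0 <= h x)%R) ->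
    forall b : \bar R, (forall nu, K nu -> \int[nu]_x (h x)%:E <= b) ->
    \int[nu]_x (h x)%:E <= b.
  by move=> mh h0 b; apply: nuP => //; right.
have domnu : dominates nu mu.
  by apply: (dominates_closed _ _ nuP) => [? []//|y]; right; right.
have [Pnu mnu_le0] : Pset rho S nu /\ (mean rho S nu <= 0)%R.
  apply/(Pset_mean_le r0_gt0 Hr0 Smono mS _ nuH); apply: cl => // nu' [[Pnu' m0] _ _].
  by rewrite integral_lower_excessE// m0.
have mnu_ge0 : (0 <= mean rho S nu)%R.
  apply/ler_addgt0Pr => e e0.
  have [k [k0 supk]] : exists k : R, (0 <= k)%R /\
      ereal_sup [set \int[nu]_(u in halfline rho `&` [set u | (k < S u)%R]) (S u)%:E
                | nu in K] <= e%:E.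
    have small : \forall k \near +oo%R,
        ereal_sup [set \int[nu]_(u in halfline rho `&` [set u | (k < S u)%R]) (S u)%:E
                  | nu in K] < e%:E.
      by move: ui => /(_ [set y | y < e%:E]); apply; apply: open_ereal_lt'; rewrite lte_fin.
    have pos : \forall k \near +oo%R, (0 <= k :> R)%R.
      by apply: nbhs_pinfty_ge; exact: num_real.
    by have [k [hk /ltW]] := filter_ex (filterI pos small); exists k.
  have kS0 : (0 <= k - S 0)%R.
    have : (S 0 <= S r0)%R by exact: (S_le Smono H0 Hr0 (ltW r0_gt0)).
    by rewrite Sr0; lra.
  pose h := ((fun x => k - Num.min (S x) k) \_ (halfline rho))%R.
  have mh : measurable_fun [set: T] h.
    apply/(measurable_restrictT _ mH); apply: measurable_funB => //.
    exact: measurable_minr.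
  have h0 x : (0 <= h x)%R.
    by rewrite /h patchE; case: ifPn => // _; rewrite subr_ge0 ge_min lexx orbT.
  have mhE : measurable_fun setT (fun x : T => (h x)%:E) by exact/measurable_EFinP.
  have hnu : \int[nu]_x (h x)%:E <= (k + e)%:E.
    apply: cl => // nu' Knu'; have [[Pnu' m0] _ _] := Knu'.
    have nu'H := proj1 Pnu'.
    pose B := (H `&` [set u : T | (k < S u)%R]).
    have mB : measurable B.
      rewrite /B (_ : [set u : T | (k < S u)%R] = S @^-1` `]k, +oo[).
        by apply: mS => //; exact: measurable_itv.
      by rewrite eqEsubset; split=> x /=; rewrite in_itv/= andbT.
    pose s (x : T) := ((S \_ B)%R x)%:E.
    have s0 x : 0 <= s x.
      rewrite /s patchE; case: ifPn => // /set_mem[_ /= kx].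
      by rewrite lee_fin (le_trans k0)// ltW.
    have ms : measurable_fun setT s.
      apply/measurable_EFinP/(measurable_restrictT _ mB).
      by apply: measurable_funS mS => // x [].
    have sB : \int[nu']_x s x <= e%:E.
      apply: le_trans supk; rewrite [leLHS](_ : _ =
        \int[nu']_(u in halfline rho `&` [set u | (k < S u)%R]) (S u)%:E).
        by apply: ereal_sup_ubound; exists nu'.
      rewrite [RHS]integral_mkcond; apply: eq_integral => x _.
      by rewrite /s !patchE; case: ifP.
    (* On the half-line [h + g <= (k - S 0) + s]; all terms are nonnegative, so the
       integrals may be compared before they are known to be finite. *)
    have : \int[nu']_x ((h x)%:E + (g x)%:E) <= \int[nu']_x ((k - S 0)%:E + s x).
      rewrite -(integral_full_set mH nu'H (emeasurable_funD mhE mgE)); last first.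
        by move=> x; rewrite adde_ge0// lee_fin.
      rewrite -(integral_full_set mH nu'H
        (emeasurable_funD (@measurable_cst _ _ T _ setT (k - S 0)%:E) ms)); last first.
        by move=> x; rewrite adde_ge0// lee_fin.
      apply: ge0_le_integral => //.
      - by move=> x _; rewrite adde_ge0// lee_fin.
      - by apply: measurable_funTS; exact: emeasurable_funD.
      - by apply: measurable_funTS; apply: emeasurable_funD => //; exact: measurable_cst.
      move=> x Hx; rewrite lower_excessE// /h /s !patchE mem_set//.
      have [Sk|kS] := leP (S x) k.
        rewrite memNset; last by move=> [_ /=]; rewrite ltNge Sk.
        by rewrite -!EFinD lee_fin (_ : point = 0%R)//; lra.
      rewrite mem_set; last by split.
      by rewrite -!EFinD lee_fin; have := le_lt_trans k0 kS; lra.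
    rewrite ge0_integralD//; [|by move=> x _; rewrite lee_fin].
    rewrite ge0_integralD//.
    rewrite integral_cst_probability integral_lower_excessE// m0.
    have : 0 <= \int[nu']_x s x by exact: integral_ge0.
    have : 0 <= \int[nu']_x (h x)%:E by apply: integral_ge0 => x _; rewrite lee_fin.
    move: sB; case: (\int[nu']_x s x) => [q| |] //; case: (\int[nu']_x _) => [p| |] //.
    by rewrite -!EFinD !lee_fin; lra.
  have : (k - S 0)%:E <= \int[nu]_x ((h x)%:E + (g x)%:E).
    rewrite -(integral_cst_probability nu) -(integral_full_set (g := fun=> (k - S 0)%:E) mH nuH)//.
    - rewrite -(integral_full_set mH nuH (emeasurable_funD mhE mgE)); last first.
        by move=> x; rewrite adde_ge0// lee_fin.
      apply: ge0_le_integral => //.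
      + by apply: measurable_funTS; exact: emeasurable_funD.
      move=> x Hx; rewrite lower_excessE// /h patchE mem_set// -EFinD lee_fin.
      have : (Num.min (S x) k <= S x)%R by rewrite ge_min lexx.
      lra.
  rewrite ge0_integralD//; [|by move=> x _; rewrite lee_fin].
  rewrite integral_lower_excessE//.
  move: hnu; have : 0 <= \int[nu]_x (h x)%:E by apply: integral_ge0 => x _; rewrite lee_fin.
  case: (\int[nu]_x _) => [p| |] //; rewrite -!EFinD !lee_fin; lra.
have Knu : feasibleC rho S mu nu.
  by apply/feasibleCE; split => //; apply/eqP; rewrite eq_le mnu_le0.
exists nu; apply/minimizerP; split => // nu' /feasibleCE[Pnu' m0 dom'].
have [Dc|cD] := leP (D nu') c%:E; first by apply: Dnu; split.
have [_ _ D0c] := Knu0.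
by apply: le_trans (Dnu _ Knu0) _; apply: le_trans D0c _; exact: ltW.
Qed.

End superlinear.

Lemma uniformly_integrable_of_bounded : (exists K : R, forall x, H x -> (S x <= K)%R) ->
  has_finite_value D (feasibleC rho S mu) ->
  exists c : R, uniformly_integrable_sublevel rho S f mu c.
Proof.
move=> [K SK] [nu0 [/feasibleCE[Pnu0 m0 dom0] nu0oo]].
pose c := fine (D nu0).
have Dc : D nu0 = c%:E.
  by rewrite fineK// ge0_fin_numE//; exact: fdivergence_ge0.
have Cnu0 : dominating_sublevel rho S f mu c nu0 by split => //; rewrite Dc.
exists c; split; first by exists nu0.
apply: cvg_near_cst; near=> k.
have Kk : (K <= k)%R by near: k; apply: nbhs_pinfty_ge; exact: num_real.
have -> : halfline rho `&` [set u | (k < S u)%R] = set0.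
  rewrite eqEsubset; split=> x // [Hx /= kx].
  by have := lt_le_trans kx (le_trans (SK _ Hx) Kk); rewrite ltxx.
rewrite (_ : [set _ | _ in _] = [set 0]) ?ereal_sup1//.
rewrite eqEsubset; split=> [_ [nu _ <-]|_ ->]; first by rewrite integral_set0.
by exists nu0 => //; rewrite integral_set0.
Unshelve. all: by end_near. Qed.

Section bounded_support_problem.
Variable b : R.
Hypotheses (rb : (r0 <= b)%R) (Hb : H b) (mub1 : mu `[0%R, b]%classic = 1).
Let W : set prob := [set nu : prob | nu `[0%R, b]%classic = 1 /\ dominates nu mu].
Local Notation u := (upper_excess S b).

Let mI : measurable (`[0%R, b]%classic : set T).
Proof. exact: measurable_itv. Qed.

Let b0 : (0 <= b)%R. Proof. exact: le_trans (ltW r0_gt0) rb. Qed.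

Let moments nu (nu1 : nu `[0%R, b]%classic = 1) :=
  bounded_support_moments r0_gt0 Hr0 Smono mS rb Hb nu1.

Let tightE : tight_constraint W u (S b) = feasibleCM rho S mu b.
Proof.
have PM nu := PsetM_E r0_gt0 Hr0 Smono mS rb Hb nu.
have CM nu : feasibleCM rho S mu b nu <->
    [/\ PsetM rho S b nu, mean rho S nu = 0%R & dominates nu mu].
  apply: (feasible_domE r0_gt0 Hr0 Smono mS) => [nu1 []//|nu1 Pnu1 m0].
  have [nu' [Pnu' m0' sdom hb]] := push_up r0_gt0 Hr0 Sr0 Smono mS (proj1 Pnu1) m0.
  by exists nu'; split => //; apply/PM/hb => //; exact/PM.
rewrite eqEsubset; split=> nu.
  move=> [[nu1 dom] nuu]; apply/CM; split => //; first exact/PM.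
  have [_] := moments nu1; rewrite nuu => -[]; lra.
move=> /CM[/PM nu1 m0 dom]; split => //.
by have [_ ->] := moments nu1; rewrite m0 subr0.
Qed.

Let WH nu : W nu -> nu H = 1.
Proof. by move=> [nu1 _]; exact: (itv_mass_halfline Hb nu1). Qed.

Let Wmix (t : R) P Q M : (0 <= t <= 1)%R ->
  (forall A, M A = t%:E * P A + (1 - t)%:E * Q A) -> W P -> W Q -> W M.
Proof.
move=> t01 ME [P1 domP] [Q1 domQ]; split; first exact: mixture_full_mass ME _ _.
exact: dominates_mixture ME _ _.
Qed.

Let Wclosed (K : set prob) nu' : K `<=` W ->
  inherits_moment_bounds (fun h => h b = 0%R) K nu' -> W nu'.
Proof.
move=> KW cl; split.
  apply: (full_mass_closed mI _ _ cl); first by rewrite /= in_itv/= b0 lexx.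
  by move=> nu /KW[].
apply: (dominates_closed _ _ cl); first by move=> nu /KW[].
move=> y; have [yb|yb] := leP b y; [left|right].
  apply: le_anti; rewrite probability_le1//= -mub1 le_measure ?inE//.
  by move=> x; rewrite /= !in_itv/= => /andP[_ xb]; exact: le_trans yb.
by rewrite indicE memNset//= in_itv/= leNgt yb.
Qed.

Let mu_u : measurable_fun [set: T] u.
Proof. exact: (@measurable_upper_excess _ rho _ mS b Hb). Qed.

Let u0 x : (0 <= u x)%R.
Proof. exact: (upper_excess_ge0 Smono Hb x). Qed.

Let ub : u b = 0%R. Proof. exact: (upper_excess_end S r0_gt0 rb). Qed.

Let Wmu : W mu. Proof. by split => // y; exact: lexx. Qed.

Let mub : (S b)%:E < \int[mu]_x (u x)%:E.
Proof.
have [_ ->] := moments mub1; rewrite lte_fin ltrBrDl.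
by move: mu_neg; lra.
Qed.

Let muoo : \int[mu]_x (u x)%:E < +oo.
Proof. by have [_ ->] := moments mub1; rewrite ltry. Qed.

Let sep nu : W nu -> nu [set x | x != b /\ u x = 0%R] = 0.
Proof.
move=> [nu1 _].
have null : nu (~` (`[0%R, b]%classic : set T)) = 0.
  by rewrite probability_setC// nu1 subee.
have mZ := measurable_zeros_off b mu_u.
apply: (subset_measure0 _ _ _ null) => //; first exact: measurableC.
move=> x [xb ux]; rewrite /= in_itv/= => /andP[x0 xleb].
have : (0 < u x)%R.
  by apply: (upper_excess_gt0 Smono Hb); rewrite x0 lt_neqAle xb.
by rewrite ux ltxx.
Qed.

(** The moment problem with atom at b and [g = upper_excess]: here W consists of
    the measures on [0, b] that dominate mu, and moving mass to b preserves
    dominance. The moment of nu is [S b] minus its mean, so that the relaxed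
    constraint asks for a nonnegative mean. *)
Theorem problem_CM : has_finite_value D (feasibleCM rho S mu b) ->
  has_minimizer D (feasibleCM rho S mu b) /\
  (strict -> unique_minimizer D (feasibleCM rho S mu b)).
Proof.
rewrite -tightE => -[nu0 [Knu0 nu0oo]].
have fin : has_finite_value D (relaxed_constraint W u (S b)).
  by exists nu0; split => //; exact: tight_constraint_sub.
split.
  exact: (tight_minimizer_exists hf muH mu_u u0 ub Hb WH Wmix Wclosed Wmu mub muoo).
move=> sf P Q minP minQ.
by apply: (relaxed_minimizer_unique hf muH mu_u u0 ub WH Wmix Wclosed Wmu mub muoo sf sep fin);
  exact: (tight_minimizer_relaxed hf muH mu_u u0 WH Wmix Wmu mub muoo).
Qed.

End bounded_support_problem.

End mean_negative.

End optimization_problems.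

(** * Existence and uniqueness of minimizers *)

Theorem theorem11 (R : realType) (l rho : \bar R) (r0 : R) (a sigma f : R -> R)
    (mu : probability (measurableTypeR R) R)
    (hl : (l < 0)%E) (hr0 : 0 < r0) (hrho : (r0%:E < rho)%E)
    (ma : measurable_fun (state_space l rho) a)
    (msigma : measurable_fun (state_space l rho) sigma)
    (sigma_gt0 : forall x, state_space l rho x -> 0 < sigma x ^+ 2)
    (loc_sigma :
      locally_integrable (state_space l rho) (fun x => (sigma x ^+ 2)^-1))
    (loc_a :
      locally_integrable (state_space l rho) (fun x => `|a x| / sigma x ^+ 2))
    (hf : divergence_function f)
    (hmu : Pset rho (scale_function a sigma r0) mu) :
  let S := scale_function a sigma r0 in
  let D := fdivergence rho f mu in
  let strict := strictly_convex_function `]0, +oo[%classic f in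
  [/\ (* (i) *)
      0 < mean rho S mu ->
      [/\ has_finite_value D (feasibleG rho S) ->
            has_minimizer D (feasibleG rho S) /\
            (strict -> unique_minimizer D (feasibleG rho S)),
          has_minimizer D (feasibleG rho S) ->
            has_minimizer D (feasibleB rho S)
        & has_finite_value D (feasibleB rho S) ->
            has_minimizer D (feasibleB rho S) /\
            (strict -> unique_minimizer D (feasibleB rho S))],
      (* (ii) *)
      mean rho S mu < 0 -> recession f = +oo%E ->
      has_finite_value D (feasibleC rho S mu) ->
      ((exists c : R, uniformly_integrable_sublevel rho S f mu c) ->
         has_minimizer D (feasibleC rho S mu) /\
         (strict -> unique_minimizer D (feasibleC rho S mu))) /\
      ((scale_at_end S rho < +oo)%E ->
         exists c : R, uniformly_integrable_sublevel rho S f mu c)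
    & (* (iii) *)
      mean rho S mu < 0 ->
      forall M : R, r0 <= M -> (M%:E < rho)%E -> supp mu `<=` `[0, M] ->
      has_finite_value D (feasibleCM rho S mu M) ->
      has_minimizer D (feasibleCM rho S mu M) /\
      (strict -> unique_minimizer D (feasibleCM rho S mu M))].
Proof.
move=> S D strict; rewrite {}/D {}/strict.
have Hr0 : halfline rho r0 by split; [exact: ltW|].
have sub : halfline rho `<=` state_space l rho.
  by move=> x [x0 xrho]; split => //; apply: lt_le_trans hl _; rewrite lee_fin.
have Smono x y : halfline rho x -> halfline rho y -> x < y -> S x < S y.
  move=> /sub Ix /sub Iy.
  exact: (scale_function_lt (sub _ Hr0) ma loc_sigma loc_a).
have mS : @measurable_fun _ _ (measurableTypeR R) R (halfline rho) S.
  have [_ /(measurable_int _) mS] := (Pset_integrable _ _ _).1 hmu.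
  exact/measurable_EFinP.
have Sr0 : S r0 = 0 by exact: scale_function0.
split.
- exact: (problems_G_B hr0 Hr0 Smono mS hf hmu).
- move=> mu_neg rec_oo fin; split.
    move=> [c ui]; split.
      exact: (has_minimizer_C hr0 Hr0 Sr0 Smono mS hf hmu rec_oo ui).
    exact: (minimizer_C_unique hr0 Hr0 Sr0 Smono mS hf hmu rec_oo).
  move=> Soo; apply: (uniformly_integrable_of_bounded hr0 Hr0 Sr0 Smono mS hf) fin.
  apply: bounded_of_scale_at_end Soo; last by exists r0.
  by move=> x y Hx Hy; exact: (S_le Smono).
- move=> mu_neg M rM Mrho suppM.
  apply: (problem_CM hr0 Hr0 Sr0 Smono mS hf hmu mu_neg rM).
    by split => //; exact: le_trans (ltW hr0) rM.
  exact/supp_subset_itv.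
Qed.
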